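(* Let $(\Omega,\mathscr F,\mathbb P)$ be a probability space with a binary filtration $(\mathscr F_n)_{n\ge 0}$ and associated collection of atoms $\mathscr A$, and let $S$ be a finite-dimensional linear space of $\mathscr F$-measurable scalar-valued functions on $\Omega$ satisfying the stability inequality on all atoms of $\mathscr A$. Fix $1<p<\infty$ and $0<\tau<p$ and let $\beta:=1/\tau-1/p>0$. Let $\mathscr C=\{f\cdot\mathbf 1_A: f\in S, A\in\mathscr A\}$ and let $\Psi$ be the $L^p$-normalized local orthonormal system associated with $S$ and $(\mathscr F_n)$. Then: (A) If the Bernstein inequality $\operatorname{BI}(\mathscr A,S,p,\tau)$ is not satisfied, then for all $\alpha>\beta$ and $0<q\le\infty$ we have the continuous embedding $\mathcal A_q^\alpha(L^p(S),\Psi)\hookrightarrow\mathcal A_q^\alpha(L^p(S),\mathscr C)$, but $\mathcal A_q^\alpha(L^p(S),\Psi)\ne\mathcal A_q^\alpha(L^p(S),\mathscr C)$. (B) If the Bernstein inequality $\operatorname{BI}(\mathscr A,S,p,\tau)$ is satisfied, then for all $0<\alpha<\beta$ and $0<q\le\infty$ we have $\mathcal A_q^\alpha(L^p(S),\mathscr C)=\mathcal A_q^\alpha(L^p(S),\Psi)$.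
   Context: Write $|A|=\mathbb P(A)$; $\mathbf 1_A$ is the characteristic function of $A$. Binary filtration: $\mathscr F_0=\{\emptyset,\Omega\}$ and, for each $n\ge1$, $\mathscr F_n\subset\mathscr F$ is generated by $\mathscr F_{n-1}$ and the subdivision of exactly one atom $A_n$ of $\mathscr F_{n-1}$ into two atoms $A_n',A_n''$ of $\mathscr F_n$ with $|A_n''|\ge|A_n'|>0$. $\mathscr A_n$ is the collection of atoms of $\mathscr F_n$ and $\mathscr A=\bigcup_n\mathscr A_n$. Stability inequality on atoms: there are constants $c_1,c_2\in(0,1]$ such that for each $A\in\mathscr A$, $$|\{\omega\in A:|f(\omega)|\ge c_1\|f\|_A\}|\ge c_2|A|\qquad\text{for all } f\in S,$$ where $\|f\|_A$ is the $L^\infty$-norm of $f$ on $A$. (In particular $S\subset L^\infty(\Omega)$.) Let $S_n$ be the space of scalar functions $f$ on $\Omega$ such that for each atom $A$ of $\mathscr F_n$ there is $g\in S$ with $f\mathbf 1_A=g\mathbf 1_A$. $P_n$ is the $L^2$-orthogonal projector onto $S_n$ (it extends to $L^1(\Omega)$), $P_{-1}=0$, and $Q_n=P_n-P_{n-1}$ for $n\ge0$. Let $\Phi_n$ be an arbitrary orthonormal basis of the range of $Q_n$ and $\Phi=\bigcup_{n\ge0}\Phi_n$ (local orthonormal system). $\Psi=\{\varphi/\|\varphi\|_p:\varphi\in\Phi\}$. $L^p(S)$ is the closure in $L^p(\Omega)$ of $\operatorname{span}\mathscr C$, which equals the closure of $\operatorname{span}\Phi$. Approximation spaces: for a Banach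 space $(\mathcal X,\|\cdot\|)$ and a linearly dense subset (dictionary) $\mathcal D\subset\mathcal X$ let $\Sigma_n^{\mathcal D}=\{\sum_{j=1}^nc_jx_j: x_j\in\mathcal D,\ c_j\text{ scalars}\}$, $E_n(x)=\inf\{\|x-y\|:y\in\Sigma_n^{\mathcal D}\}$, and for $\alpha>0$, $0<q\le\infty$ $$\mathcal A_q^\alpha(\mathcal X,\mathcal D)=\{x\in\mathcal X:\ \|x\|_{\mathcal A_q^\alpha}=\|x\|+\|(2^{n\alpha}E_{2^n}(x))_{n\ge0}\|_{\ell^q}<\infty\}.$$ For $n\ge1$ let $\Sigma_n(S)=\{\sum_{i=1}^n v_i\mathbf 1_{A_i}: v_i\in S,\ A_i\in\mathscr A\}$ (the $A_i$ are not necessarily disjoint). Bernstein inequality $\operatorname{BI}(\mathscr A,S,p,\tau)$: there is a constant $C$ such that for all positive integers $n$ and all $g\in\Sigma_n(S)$, $$\Big(\sum_{j\ge0}\|Q_jg\|_p^\tau\Big)^{1/\tau}\le C\,n^\beta\|g\|_p.$$ *)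

(* Defs.v *)
From HB Require Import structures.
From mathcomp Require Import all_boot all_order all_algebra.
From mathcomp Require Import complex.
From mathcomp Require Import all_classical all_reals all_analysis.

Set Implicit Arguments.
Unset Strict Implicit.
Unset Printing Implicit Defensive.
Import Order.TTheory GRing.Theory Num.Theory.
Import numFieldNormedType.Exports.

Local Open Scope classical_set_scope.
Local Open Scope ring_scope.

(* Scalars are either real or complex.  Both cases are treated at once: every
   function takes values in R[i], and in the real case all values and all
   coefficients are required to have zero imaginary part. *)
Variant scalar_kind := RealScalars | ComplexScalars.

Definition scalars (R : realType) (k : scalar_kind) : set R[i] :=
  match k with
  | RealScalars => [set z | complex.Im z = 0]
  | ComplexScalars => setT
  end.

(* [R[i]^o] is R[i] as a module over itself, so that functions form an
   lmodType over R[i]. *)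
Notation cfun T R := (T -> R[i]^o).

Section approximation.
Context (R : realType) (V : lmodType R[i]).
(* [K] is the set of admissible coefficients, [X] the space, [N] its norm. *)
Variables (K : set R[i]) (X : set V) (N : V -> \bar R) (D : set V).

(* Sums of at most n terms rather than of exactly n terms: for a nonempty
   dictionary this is the same set (use zero coefficients), and for the empty
   dictionary, which is linearly dense in X = {0}, it gives {0}. *)
Definition nterm (n : nat) : set V :=
  [set y | exists (l : nat) (c : 'I_l -> R[i]) (x : 'I_l -> V),
    [/\ (l <= n)%N, forall j, K (c j), forall j, D (x j) &
        y = \sum_(j < l) c j *: x j]].

Definition lin_span : set V := \bigcup_n nterm n.

Definition best_approx (n : nat) (x : V) : \bar R :=
  ereal_inf [set N (x - y) | y in nterm n].

(* The l^q norm is the Lnorm for the counting measure, 0 < q <= +oo. *)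
Definition approx_norm (alpha : R) (q : \bar R) (x : V) : \bar R :=
  (N x + Lnorm counting q
           (fun n : nat => (2 `^ (n%:R * alpha))%:E * best_approx (2 ^ n) x))%E.

Definition approx_space (alpha : R) (q : \bar R) : set V :=
  [set x | X x /\ (approx_norm alpha q x < +oo)%E].

End approximation.

Definition approx_embed (R : realType) (V : lmodType R[i]) (K : set R[i])
    (X : set V) (N : V -> \bar R) (D1 D2 : set V) (alpha : R) (q : \bar R) :=
  approx_space K X N D1 alpha q `<=` approx_space K X N D2 alpha q /\
  exists C : R, forall x, approx_space K X N D1 alpha q x ->
    (approx_norm K N D2 alpha q x <= C%:E * approx_norm K N D1 alpha q x)%E.

Section atoms.
Context d (T : measurableType d) (R : realType) (P : probability T R).

Definition is_atom (G : set (set T)) (A : set T) :=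
  [/\ G A, A !=set0 & forall B, G B -> B `<=` A -> B = set0 \/ B = A].

Definition binary_filtration (F : nat -> set (set T)) :=
  F 0%N = [set set0; setT] /\
  forall n, exists A A' A'' : set T,
    [/\ is_atom (F n) A,
        [/\ measurable A', measurable A'', A' `&` A'' = set0 & A' `|` A'' = A],
        F n.+1 = <<s F n `|` [set A'; A''] >>,
        is_atom (F n.+1) A' /\ is_atom (F n.+1) A'' &
        (0 < P A')%E /\ (P A' <= P A'')%E].

Definition all_atoms (F : nat -> set (set T)) : set (set T) :=
  \bigcup_n [set A | is_atom (F n) A].

End atoms.

Section functions.
Context d (T : measurableType d) (R : realType) (P : probability T R).
Variable k : scalar_kind.
Implicit Types (f g h : cfun T R) (A : set T).

Definition modulus f : T -> R := fun x => ComplexField.Normc.normc (f x).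

Definition scalar_mfun : set (cfun T R) :=
  [set f | [/\ forall x, scalars k (f x),
               measurable_fun setT (fun x => complex.Re (f x)) &
               measurable_fun setT (fun x => complex.Im (f x))]].

Definition Lpnorm (p : \bar R) f : \bar R := Lnorm P p (EFin \o modulus f).

(* L^p consists of functions, not of classes, so [Lpnorm] is a seminorm on it;
   this set, its subspace [LpS] and the approximation spaces built on them are
   invariant under changes on null sets. *)
Definition Lpfun (p : \bar R) : set (cfun T R) :=
  [set f | scalar_mfun f /\ (Lpnorm p f < +oo)%E].

Definition inner f g : R[i] :=
  let h x := f x * conjc (g x) in
  Complex (Rintegral P setT (fun x => complex.Re (h x)))
          (Rintegral P setT (fun x => complex.Im (h x))).

Definition cutoff A f : cfun T R := fun x => f x * \1_A x.

Definition fin_dim_space (S : set (cfun T R)) :=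
  S `<=` scalar_mfun /\
  exists (m : nat) (b : 'I_m -> cfun T R),
    S = [set f | exists c : 'I_m -> R[i],
          (forall i, scalars k (c i)) /\ f = \sum_(i < m) c i *: b i].

Variables (F : nat -> set (set T)) (S : set (cfun T R)).

Definition stability :=
  exists c1 c2 : R, [/\ 0 < c1 <= 1, 0 < c2 <= 1 &
    forall A f, all_atoms F A -> S f ->
      (c2%:E * P A <=
       P [set w | A w /\
            (c1%:E * Lpnorm +oo (cutoff A f) <= (modulus f w)%:E)%E])%E].

Definition piecewise (n : nat) : set (cfun T R) :=
  [set f | forall A, is_atom (F n) A ->
             exists2 g, S g & cutoff A f = cutoff A g].

(* The orthogonal projection is unique only up to null sets; [xget] picks a
   representative.  Since S is contained in L^oo, the defining orthogonality
   relations make sense for every integrable f. *)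
Definition orth_proj (n : nat) f : cfun T R :=
  xget 0 [set g | piecewise n g /\
                  forall h, piecewise n h -> inner (f - g) h = 0].

Definition orth_proj_diff (n : nat) f : cfun T R :=
  if n is n'.+1 then orth_proj n f - orth_proj n' f else orth_proj 0 f.

Definition local_orthonormal_system (m : nat -> nat)
    (Phi : forall n, 'I_(m n) -> cfun T R) :=
  forall n : nat,
    [/\ forall i, Lpfun 2%:E (Phi n i) /\
          exists2 f, Lpfun 2%:E f & Phi n i = orth_proj_diff n f %[ae P],
        forall i j, inner (Phi n i) (Phi n j) = (i == j)%:R &
        forall f, Lpfun 2%:E f ->
          exists2 c : 'I_(m n) -> R[i], forall i, scalars k (c i) &
            orth_proj_diff n f = (\sum_(i < m n) c i *: Phi n i) %[ae P]].

Definition dictC : set (cfun T R) :=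
  [set g | exists f A, [/\ S f, all_atoms F A & g = cutoff A f]].

Definition dictPsi (p : R) (m : nat -> nat)
    (Phi : forall n, 'I_(m n) -> cfun T R) : set (cfun T R) :=
  [set g | exists n (i : 'I_(m n)),
     g = ((fine (Lpnorm p%:E (Phi n i)))^-1)%:C%C *: Phi n i].

Definition LpS (p : R) : set (cfun T R) :=
  [set f | Lpfun p%:E f /\
     forall e : R, 0 < e ->
       exists2 g, lin_span (scalars k) dictC g & (Lpnorm p%:E (f - g)%R < e%:E)%E].

Definition SigmaS (n : nat) : set (cfun T R) :=
  [set g | exists (v : 'I_n -> cfun T R) (A : 'I_n -> set T),
     [/\ forall i, S (v i), forall i, all_atoms F (A i) &
         g = \sum_(i < n) cutoff (A i) (v i)]].

Definition Bernstein (p tau : R) :=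
  exists C : R, forall (n : nat) g, (0 < n)%N -> SigmaS n g ->
    ((\sum_(0 <= j <oo) Lpnorm p%:E (orth_proj_diff j g) `^ tau) `^ tau^-1 <=
     (C * n%:R `^ (tau^-1 - p^-1))%:E * Lpnorm p%:E g)%E.

End functions.

(* Main.v *)
Require Import Defs.
From HB Require Import structures.
From mathcomp Require Import all_boot all_order all_algebra.
From mathcomp Require Import complex.
From mathcomp Require Import all_classical all_reals all_analysis.
From mathcomp Require Import measurable_realfun ess_sup_inf ring lra.

Set Implicit Arguments.
Unset Strict Implicit.
Unset Printing Implicit Defensive.
Import Order.TTheory GRing.Theory Num.Theory.
Import numFieldNormedType.Exports.

Local Open Scope classical_set_scope.
Local Open Scope ring_scope.

(** Nothing bounds |A''| by |A'|: the large halves of many successive splittings can be nested with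
    almost equal measures, so the averages over them overlap without geometric decay. Every
    splitting is therefore measured by its small half. If the atom split at step j lies in the small
    half of step i, then |A'_i| >= 2 |A'_j|; so within one dyadic layer of |A'| the small halves are
    disjoint, and counting steps amounts to adding measures. These sets lie in the split atoms,
    which are nested or disjoint, and only the maximal ones have to be charged to g. The resulting
    bound #{j : weighted average >= lam} <= C lam^(-r) ||g||_r^r enters with two exponents. With r =
    p and g = |f| it yields the Bernstein side; with r = p/(p-1) and g a power of a sum of bumps it
    yields the upper estimate, since the bumps are the functions that represent these weighted
    averages. For tau < 1 the l^tau sums obey no triangle inequality. The telescoping sums are
    therefore arranged to have geometrically decaying terms, and the gap between alpha and beta
    supplies the decay. *)

Lemma eq_ler (disp : Order.disp_t) (V : porderType disp) (x y : V) : x = y -> (x <= y)%O.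
Proof. by move=> ->. Qed.

(* Every increment [Q_j f] lives on the atom split at step j and, by stability,
   is comparable to an explicit bump adapted to the two halves A', A'' of that
   atom; conversely its L^p norm is controlled by the averages of |f| over the
   halves.  A weak-type estimate for these averages over arbitrary finite sets G
   of steps (covering argument on dyadic layers of |A'|) yields
     sum_(j in G) ||Q_j f||^tau <= (C #G^beta ||f||)^tau
   and, by duality, an upper bound for ||sum_(j in G) Q_j f|| when the summands
   have comparable norms.  These are the Bernstein inequality for Psi and a
   Jackson inequality for Psi in terms of (sum_j ||Q_j f||^tau)^(1/tau).
   Each element of Psi is a combination of two elements of C, which gives
   Psi --> C for all parameters.  Under BI, telescoping near-best C-approximants
   and applying Jackson and Hardy gives C --> Psi for alpha < beta.  If alpha >
   beta and 2^(i alpha) E_(2^i)(g; Psi) <= K n^alpha ||g|| held on Sigma_n, then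
   telescoping near-best Psi-approximants of g and applying Bernstein for Psi
   would give BI.  So without BI that inequality fails for every K, and a gliding
   hump produces an element of the C-space outside the Psi-space. *)

(** * Geometric sums, power functions and a Lorentz-type summation *)

Section real_sums.
Context {R : realType}.
Implicit Types (t s W K : R).

Lemma sum_geo_le K (n : nat) : 1 < K -> \sum_(i < n) K ^+ i <= K ^+ n / (K - 1).
Proof.
move=> K1; rewrite ler_pdivlMr ?subr_gt0// mulrC -subrX1.
by rewrite lerBlDr lerDl.
Qed.

Lemma sum_geo_inv_le K (n : nat) : 1 < K -> \sum_(i < n) K ^- i <= K / (K - 1).
Proof.
move=> K1; have K0 : 0 < K by rewrite (lt_trans _ K1).
have K1' : 0 < K - 1 by rewrite subr_gt0.
suff -> : \sum_(i < n) K ^- i = K / (K - 1) * (1 - K ^- n).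
  rewrite -[leRHS]mulr1 ler_wpM2l ?divr_ge0 ?(ltW K0) ?(ltW K1')//.
  by rewrite lerBlDr lerDl invr_ge0 exprn_ge0// ltW.
elim: n => [|n IH]; first by rewrite big_ord0 expr0 invr1 subrr mulr0.
rewrite big_ord_recr/= IH exprS; field.
by rewrite !gt_eqF ?exprn_gt0.
Qed.

(** The predicate holds on an initial segment, so the sum is dominated by its last term, which is at
    most [W], whatever the length of the segment. *)
Lemma sum_geo_down_le K W (p : pred nat) (n : nat) : 1 < K -> 0 <= W ->
  (forall m, p m.+1 -> p m) -> (forall m, p m -> K ^+ m <= W) ->
  \sum_(m < n | p m) K ^+ m <= K / (K - 1) * W.
Proof.
move=> K1 W0 pS pW; elim: n => [|n IH].
  rewrite big_ord0 mulr_ge0// divr_ge0// ?subr_ge0 ltW// (lt_trans _ K1)//.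
have [pn|npn] := boolP (p n); last first.
  by rewrite big_mkcond big_ord_recr/= (negPf npn) addr0 -big_mkcond.
apply: le_trans (_ : \sum_(m < n.+1) K ^+ m <= _).
  rewrite big_mkcond; apply: ler_sum => i _; case: ifP => // _.
  by rewrite exprn_ge0// ltW// (lt_trans _ K1).
apply: le_trans (sum_geo_le _ K1) _.
rewrite exprS mulrAC ler_wpM2l ?pW// divr_ge0// ?subr_ge0 ltW// (lt_trans _ K1)//.
Qed.

(** A substitute for the triangle inequality in l^t, valid for every t > 0: each weighted term K^i
    x_i is at most S^(1/t), where S is the sum on the right, and the remaining weights K^-i form a
    geometric series. *)
Lemma wsum_powR (K t : R) (n : nat) (x : nat -> R) : 1 < K -> 0 < t ->
  (forall i, 0 <= x i) ->
  (\sum_(i < n) x i) `^ t <=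
    (K / (K - 1)) `^ t * \sum_(i < n) (K ^+ i * x i) `^ t.
Proof.
move=> K1 t0 x0; have K0 : 0 < K by rewrite (lt_trans _ K1).
have y0 i : 0 <= K ^+ i * x i by rewrite mulr_ge0// exprn_ge0// ltW.
set S := \sum_(i < n) (_ `^ t).
have S0 : 0 <= S by apply: sumr_ge0 => i _; exact: powR_ge0.
have yS (i : 'I_n) : K ^+ i * x i <= S `^ t^-1.
  rewrite -[leLHS](@powRr1 _ (_ * _))// -(mulfV (lt0r_neq0 t0)) powRrM.
  apply: ge0_ler_powR; rewrite ?nnegrE ?powR_ge0 ?invr_ge0 ?(ltW t0)//.
  by rewrite /S (bigD1 i)//= lerDl sumr_ge0// => j _; exact: powR_ge0.
have : \sum_(i < n) x i <= K / (K - 1) * S `^ t^-1.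
  apply: le_trans (_ : \sum_(i < n) K ^- i * S `^ t^-1 <= _).
    apply: ler_sum => i _; rewrite -ler_pdivrMl ?invr_gt0 ?exprn_gt0// invrK.
    exact: yS.
  by rewrite -mulr_suml ler_wpM2r ?powR_ge0// sum_geo_inv_le.
move/(ge0_ler_powR (ltW t0)); rewrite !nnegrE sumr_ge0//.
rewrite mulr_ge0 ?powR_ge0 ?divr_ge0 ?subr_ge0 ?(ltW K0) ?(ltW K1)// => /(_ isT isT).
by rewrite powRM ?powR_ge0 ?divr_ge0 ?subr_ge0 ?(ltW K0) ?(ltW K1)// -powRrM mulVf ?gt_eqF// powRr1.
Qed.

(** Young's inequality for the product of x^t and 1 with the conjugate exponents 1/t and 1/(1 -
    t). *)
Lemma bernoulli_powR t (x : R) : 0 < t < 1 -> 0 <= x -> x `^ t <= 1 - t * (1 - x).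
Proof.
move=> /andP[t0 t1] x0.
have h := @conjugate_powR R (x `^ t) 1 t^-1 (1 - t)^-1.
have {h} := h (powR_ge0 _ _) ler01.
rewrite !invr_gt0 subr_gt0 t0 t1 !invrK => /(_ isT isT).
rewrite addrC subrK => /(_ erefl).
rewrite mulr1 -powRrM mulfV ?gt_eqF// powRr1// powR1 /= mul1r.
by move=> h; apply: le_trans h _; lra.
Qed.

(** Concavity of the power function, from Bernoulli's inequality at n/(n+1). It is the induction
    step that sums the bounds k^(t-1) to n^t / t in [lorentz_sum]. *)
Lemma powR_step t (n : nat) : 0 < t < 1 ->
  n%:R `^ t + t * n.+1%:R `^ (t - 1) <= n.+1%:R `^ t :> R.
Proof.
move=> /[dup] t01 /andP[t0 t1].
have N0 : 0 < n.+1%:R :> R by rewrite ltr0n.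
have := @bernoulli_powR t (n%:R / n.+1%:R) t01 (divr_ge0 (ler0n _ _) (ler0n _ _)).
rewrite powRM ?invr_ge0 ?ler0n// -powR_inv1 ?ler0n// -powRrM mulN1r powRN.
rewrite ler_pdivrMr ?powR_gt0// powRB; last by rewrite (gt_eqF N0) implybT.
rewrite powRr1 ?ler0n// => h.
have e : 1 - n%:R * n.+1%:R `^ (-1) = n.+1%:R^-1 :> R.
  by rewrite powR_inv1 ?ler0n// -natr1; field; rewrite natr1 gt_eqF.
apply: le_trans (lerD h (lexx _)) _; rewrite e le_eqVlt; apply/orP; left.
by apply/eqP; field; rewrite addrC natr1 gt_eqF.
Qed.

(* Induction on [A], removing a smallest term, which is at most [W * #|A| ^- s]. *)
Lemma lorentz_sum (I : finType) (A : {set I}) (a : I -> R) s W :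
  0 < s < 1 -> 0 <= W -> (forall i, i \in A -> 0 <= a i) ->
  (forall (B : {set I}) (l : R), B \subset A -> 0 < l ->
     (forall i, i \in B -> l <= a i) -> l * #|B|%:R `^ s <= W) ->
  \sum_(i in A) a i <= W / (1 - s) * #|A|%:R `^ (1 - s).
Proof.
move=> /andP[s0 s1] W0; have [n] := ubnP #|A|; elim: n A => // n IH A /ltnSE An a0 h.
have s1' : 0 < 1 - s by rewrite subr_gt0.
have [->|[i0 i0A]] := set_0Vmem A.
  by rewrite big_set0 mulr_ge0 ?powR_ge0// divr_ge0// ltW.
have [i iA imin] := @arg_minP _ _ _ i0 (mem A) a i0A.
have {}iA : i \in A by [].
have cA : #|A| = #|A :\ i|.+1 by rewrite (cardsD1 i) iA.
have sub : A :\ i \subset A by exact: subsetDl.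
have {}IH : \sum_(j in A :\ i) a j <= W / (1 - s) * #|A :\ i|%:R `^ (1 - s).
  apply: IH; first by rewrite -ltnS -cA.
    by move=> j jA; apply: a0; exact: (fintype.subsetP sub).
  by move=> B l BA; apply: h; exact: fintype.subset_trans BA sub.
rewrite (big_setD1 i)//= cA.
have ai_le : a i <= W * #|A|%:R `^ (- s).
  rewrite powRN ler_pdivlMr ?powR_gt0 ?ltr0n ?cA// -cA.
  have := a0 _ iA; rewrite le_eqVlt => /predU1P[<-|ai]; first by rewrite mul0r.
  by apply: h => // j jA; exact: imin.
apply: le_trans (lerD ai_le IH) _.
have := @powR_step (1 - s) #|A :\ i|; rewrite s1' ltrBlDr ltrDl s0 => /(_ isT).
rewrite cA (_ : 1 - s - 1 = - s); last by lra.
set x := _ `^ (- s); set y := _ `^ (1 - s); set z := _ `^ (1 - s) => yz.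
rewrite addrC -subr_ge0.
have -> : W / (1 - s) * z - (W / (1 - s) * y + W * x) =
    W / (1 - s) * (z - (y + (1 - s) * x)).
  by field; rewrite gt_eqF.
by rewrite mulr_ge0 ?subr_ge0// divr_ge0// ltW.
Qed.

Lemma powRV (x a : R) : 0 <= x -> x^-1 `^ a = (x `^ a)^-1.
Proof.
by move=> x0; rewrite -[in LHS]powR_inv1// powRAC powR_inv1// powR_ge0.
Qed.

Lemma powR2_gt1 (x : R) : 0 < x -> 1 < 2 `^ x.
Proof.
by move=> x0; rewrite /powR pnatr_eq0/= expR_gt1 mulr_gt0// ln_gt0// ltr1n.
Qed.

Lemma powRVK (x a : R) : 0 <= x -> 0 < a -> (x `^ a^-1) `^ a = x.
Proof. by move=> x0 a0; rewrite -powRrM mulVf ?powRr1// gt_eqF. Qed.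

Lemma powRKV (x a : R) : 0 <= x -> 0 < a -> (x `^ a) `^ a^-1 = x.
Proof. by move=> x0 a0; rewrite -powRrM mulfV ?powRr1// gt_eqF. Qed.

Lemma le_powR (a x y : R) : 0 <= a -> 0 <= x -> x <= y -> x `^ a <= y `^ a.
Proof.
by move=> a0 x0 xy; apply: ge0_ler_powR; rewrite ?nnegrE// (le_trans x0).
Qed.

Lemma powRM3 (a x y z : R) : 0 <= x -> 0 <= y -> 0 <= z ->
  x `^ a * y `^ a * z `^ a = (x * y * z) `^ a.
Proof. by move=> x0 y0 z0; rewrite !powRM// mulr_ge0. Qed.

End real_sums.

(** * Weak-type estimates on the tree of splittings *)

Section real_integral.
Context d {T : measurableType d} {R : realType}.
Variable P : probability T R.
Implicit Types (f g h : T -> R) (A B : set T).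

Notation ri := (fun f => P.-integrable setT (EFin \o f)).

Lemma ri_meas f : ri f -> measurable_fun setT f.
Proof. by move=> /integrableP[/measurable_EFinP]. Qed.

Lemma riD f g : ri f -> ri g -> ri (fun x => f x + g x).
Proof. by move=> fi gi; apply: eq_integrable (integrableD measurableT fi gi). Qed.

Lemma riZ (a : R) f : ri f -> ri (fun x => a * f x).
Proof. by move=> fi; apply: eq_integrable (integrableZl measurableT a fi). Qed.

Lemma ri_le f g : measurable_fun setT f -> (forall x, `|f x| <= g x) -> ri g -> ri f.
Proof.
move=> mf fg gi; apply: le_integrable gi => //; first exact/measurable_EFinP.
move=> x _ /=; rewrite lee_fin; apply: le_trans (fg x) _; exact: ler_norm.
Qed.

Lemma ri_cst (a : R) : ri (fun=> a).
Proof. exact: finite_measure_integrable_cst. Qed.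

Lemma ri_bounded f (M : R) : measurable_fun setT f -> (forall x, `|f x| <= M) -> ri f.
Proof. by move=> mf fM; apply: ri_le fM _ => //; exact: ri_cst. Qed.

Lemma ri_indic A : measurable A -> ri \1_A.
Proof. by move=> mA; apply: integrable_indic. Qed.

Lemma riM_indic A f : measurable A -> ri f -> ri (fun x => f x * \1_A x).
Proof.
move=> mA fi; apply: (@ri_le _ (fun x => `|f x|)); last exact: integrable_norm.
  by apply: measurable_funM; [exact: ri_meas|exact: measurable_indic].
move=> x; rewrite normrM ler_piMr//.
by rewrite indicE; case: (x \in A); rewrite ?normr1 ?normr0.
Qed.

Lemma ri_sum (I : Type) (s : seq I) (p : pred I) (f : I -> T -> R) :
  (forall i, p i -> ri (f i)) -> ri (fun x => \sum_(i <- s | p i) f i x).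
Proof.
move=> fi; elim: s => [|i s IH].
  by apply: eq_integrable (ri_cst 0) => // x _ /=; rewrite big_nil.
have [pi|npi] := boolP (p i); last first.
  by apply: eq_integrable IH => // x _ /=; rewrite big_cons (negPf npi).
apply: eq_integrable (riD (fi _ pi) IH) => // x _ /=.
by rewrite big_cons pi.
Qed.

Lemma rintD f g : ri f -> ri g ->
  \int[P]_x (f x + g x) = \int[P]_x f x + \int[P]_x g x.
Proof. exact: RintegralD. Qed.

Lemma rintZ (a : R) f : ri f -> \int[P]_x (a * f x) = a * \int[P]_x f x.
Proof. exact: RintegralZl. Qed.

Lemma rint_sum (I : Type) (s : seq I) (p : pred I) (f : I -> T -> R) :
  (forall i, p i -> ri (f i)) ->
  \int[P]_x (\sum_(i <- s | p i) f i x) = \sum_(i <- s | p i) \int[P]_x f i x.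
Proof.
move=> fi; elim: s => [|i s IH].
  rewrite big_nil; under eq_Rintegral do rewrite big_nil.
  by rewrite Rintegral_cst// mul0r.
rewrite big_cons; under eq_Rintegral do rewrite big_cons.
by case: ifPn => // pi; rewrite rintD ?IH//; [exact: fi|exact: ri_sum].
Qed.

Lemma rint_le f g : ri f -> ri g -> (forall x, f x <= g x) ->
  \int[P]_x f x <= \int[P]_x g x.
Proof. by move=> fi gi fg; apply: le_Rintegral. Qed.

Lemma rint_indic A : measurable A -> \int[P]_x \1_A x = fine (P A).
Proof. by move=> mA; rewrite /Rintegral integral_indic// setIT. Qed.

Lemma rint_cst (a : R) : \int[P]_x a = a.
Proof. by rewrite Rintegral_cst//= probability_setT mulr1. Qed.

Lemma fineP_ge0 A : 0 <= fine (P A).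
Proof. exact: fine_ge0. Qed.

Lemma finePK A : measurable A -> (fine (P A))%:E = P A.
Proof. by move=> mA; rewrite fineK// fin_num_measure. Qed.

Lemma fineP_le A B : measurable A -> measurable B -> A `<=` B ->
  fine (P A) <= fine (P B).
Proof.
by move=> mA mB AB; rewrite fine_le ?fin_num_measure// le_measure// inE.
Qed.

Lemma finePU A B : measurable A -> measurable B -> A `&` B = set0 ->
  fine (P (A `|` B)) = fine (P A) + fine (P B).
Proof. by move=> mA mB AB; rewrite measureU// fineD ?fin_num_measure. Qed.

Lemma indic_setU A B x : A `&` B = set0 ->
  \1_(A `|` B) x = \1_A x + \1_B x :> R.
Proof.
move=> AB; rewrite !indicE in_setU.
case: (boolP (x \in A)) => xA; case: (boolP (x \in B)) => xB;
  rewrite ?addr0 ?add0r//.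
by move: xA xB; rewrite !inE => xA xB; have : (A `&` B) x by []; rewrite AB.
Qed.

End real_integral.

Section weak_type.
Context d {T : measurableType d} {R : realType}.
Variable P : probability T R.
Notation mes A := (fine (P A)).
Notation ri := (fun f => P.-integrable setT (EFin \o f)).

(** A covering argument of Vitali type with a finitely additive [nu]. A set D n that lies in an
    earlier one leaves the union of the D j unchanged; otherwise it is disjoint from that union, and
    both [mes] and [nu] simply add. Hence [mes] is at most [nu] on the union, which contains the
    disjoint sets A j. *)
Lemma covering (A D : nat -> set T) (nu : set T -> R) (L : pred nat) (J : nat) :
  (forall j, measurable (A j)) -> (forall j, measurable (D j)) ->
  (forall j, A j `<=` D j) ->
  (forall i j, (i < j)%N -> L i -> L j -> A i `&` A j = set0) ->
  (forall i j, (i < j)%N -> L i -> L j -> D j `<=` D i \/ D i `&` D j = set0) ->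
  (forall B, measurable B -> 0 <= nu B) ->
  (forall B C, measurable B -> measurable C -> B `&` C = set0 ->
     nu (B `|` C) = nu B + nu C) ->
  (forall j, L j -> mes (D j) <= nu (D j)) ->
  \sum_(j < J | L j) mes (A j) <= nu setT.
Proof.
move=> mA mD AD Adisj Dnest nu0 nuD Dnu.
pose UA n := \bigcup_(j in [set j | (j < n)%N /\ L j]) A j.
pose UD n := \bigcup_(j in [set j | (j < n)%N /\ L j]) D j.
have mUA n : measurable (UA n) by apply: bigcup_measurable.
have mUD n : measurable (UD n) by apply: bigcup_measurable.
have US (F : nat -> set T) n : \bigcup_(j in [set j | (j < n.+1)%N /\ L j]) F j =
    \bigcup_(j in [set j | (j < n)%N /\ L j]) F j `|` (if L n then F n else set0).
  apply/seteqP; split => x.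
    move=> [j /= [jn Lj] Fj]; move: jn; rewrite ltnS leq_eqVlt => /predU1P[jn|jn].
      by right; rewrite -jn Lj.
    by left; exists j.
  case=> [[j /= [jn Lj] Fj]|]; first by exists j => //; split=> //; exact: ltnW.
  by case: ifP => // Ln Fn; exists n.
have U0 (F : nat -> set T) : \bigcup_(j in [set j | (j < 0)%N /\ L j]) F j = set0.
  by apply/seteqP; split => x // [j []].
have hA : \sum_(j < J | L j) mes (A j) = mes (UA J).
  elim: J => [|n IH]; first by rewrite big_ord0 /UA U0 measure0.
  rewrite big_mkcond big_ord_recr -big_mkcond/= IH /UA US; case: ifP => Ln.
    rewrite finePU//; first exact: mUA.
    apply/seteqP; split => x // [[j /= [jn Lj] Aj] An].
    by have : (A j `&` A n) x by []; rewrite Adisj.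
  by rewrite setU0 addr0.
have hD : mes (UD J) <= nu (UD J).
  elim: J {hA} => [|n IH]; first by rewrite {1}/UD U0 measure0 nu0.
  rewrite /UD US; case: ifP => Ln; last by rewrite setU0.
  have [[i [iN Li DD]]|nx] := pselect (exists i, [/\ (i < n)%N, L i & D n `<=` D i]).
    rewrite (_ : _ `|` D n = UD n)//; apply/seteqP; split => x; last by left.
    by case=> // /DD Di; exists i.
  have disj : UD n `&` D n = set0.
    apply/seteqP; split => x // [[j /= [jn Lj] Dj] Dn].
    have [jD|DD0] := Dnest _ _ jn Lj Ln; first by exfalso; apply: nx; exists j.
    by have : (D j `&` D n) x by []; rewrite DD0.
  by rewrite finePU// ?nuD//; [apply: lerD => //; exact: Dnu|exact: mUD|exact: mUD].
rewrite hA; apply: le_trans (_ : mes (UD J) <= _).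
  by apply: fineP_le => // x [j jL Aj]; exists j => //; exact: AD.
apply: le_trans hD _.
rewrite -[X in _ <= nu X](setUv (UD J)) nuD//; last exact: setICr.
  by rewrite lerDl nu0//; exact: measurableC.
exact: measurableC.
Qed.

Lemma dyadic_level (x : R) : 0 < x -> x <= 1 ->
  exists m : nat, 2^-1 ^+ m.+1 < x <= 2^-1 ^+ m.
Proof.
move=> x0 x1; have half1 : `|2^-1 : R| < 1 by rewrite ger0_norm ?invf_lt1// ltr1n.
have exm : exists m : nat, 2^-1 ^+ m.+1 < x.
  have /cvgrPdist_lt /(_ _ x0) [N _ /(_ N.+1 (leqnSn _))] := cvg_expr half1.
  by rewrite sub0r normrN ger0_norm ?exprn_ge0 ?invr_ge0// => h; exists N.
exists (ex_minn exm); case: ex_minnP => -[|m] -> mmin; first by rewrite expr0 x1.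
by rewrite leNgt; apply/negP => /mmin; rewrite ltnn.
Qed.

(** With theta = 2^(1/r) the summed powers are theta^(m (r - 1)). The condition theta^m < s thus
    bounds every term by s^(r - 1), and the sum is of the order of its largest term. *)
Lemma weak_type_geo (r : R) (s : R) (M : nat) : 1 < r -> 0 <= s ->
  \sum_(m < M | (2 `^ r^-1) ^+ m < s) (2 `^ (1 - r^-1)) ^+ m <=
  2 `^ (1 - r^-1) / (2 `^ (1 - r^-1) - 1) * s `^ (r - 1) :> R.
Proof.
move=> r1 s0; have r0 : 0 < r by rewrite (lt_trans _ r1).
have ri1 : r^-1 < 1 by rewrite invf_lt1.
have K1 : 1 < 2 `^ (1 - r^-1) :> R by rewrite powR2_gt1// subr_gt0.
have th1 : 1 <= 2 `^ r^-1 :> R.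
  by rewrite -[leLHS](@powRr0 _ 2) ler_powR ?invr_ge0 ?(ltW r0)// ler1n.
apply: (@sum_geo_down_le _ _ _ (fun m => (2 `^ r^-1) ^+ m < s)) => //.
- exact: powR_ge0.
- by move=> m; apply: le_lt_trans; rewrite exprS ler_peMl// exprn_ge0// powR_ge0.
- move=> m h; rewrite -!powR_mulrn ?powR_ge0// in h *.
  apply: le_trans (_ : ((2 `^ r^-1) `^ m%:R) `^ (r - 1) <= _).
    rewrite -!powRrM le_eqVlt; apply/orP; left; apply/eqP; congr (_ `^ _).
    by field; rewrite gt_eqF.
  by apply: ge0_ler_powR; rewrite ?nnegrE ?powR_ge0// ?subr_ge0 ltW.
Qed.

(** The factor 8 is 2 times 4: 2 because on layer m the measure of A j is only known to exceed
    2^-(m+1), 4 from the normalization of [nu] in [weak_type]. The quotient is the constant of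
    [weak_type_geo], and 2^(r-1) comes from the truncation at half the level. *)
Definition weak_cst (r : R) : R :=
  8 * (2 `^ (1 - r^-1) / (2 `^ (1 - r^-1) - 1)) * 2 `^ (r - 1).

(* Truncating [g] at half the level [lam / mes (A j) `^ r^-1] lets the measure
   [nu] below be used on all sets of one dyadic layer of [mes (A j)] at once;
   the truncated integrals sum up geometrically over the layers. *)
Lemma weak_type (A D E : nat -> set T) (L : pred nat) (J : nat) (g : T -> R)
    (r lam : R) :
  1 < r -> 0 < lam ->
  (forall j, measurable (A j)) -> (forall j, measurable (D j)) ->
  (forall j, measurable (E j)) ->
  (forall j, A j `<=` D j) -> (forall j, E j `<=` D j) ->
  (forall j, 0 < mes (A j)) ->
  (forall j, L j -> mes (D j) <= 2 * mes (E j)) ->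
  (forall c i j, (i < j)%N -> L i -> L j -> c < mes (A i) <= 2 * c ->
     c < mes (A j) <= 2 * c ->
     A i `&` A j = set0 /\ (D j `<=` D i \/ D i `&` D j = set0)) ->
  (forall x, 0 <= g x) -> ri g -> ri (fun x => g x `^ r) ->
  (forall j, L j -> lam * mes (A j) `^ (- r^-1) * mes (E j) <=
     \int[P]_x (g x * \1_(E j) x)) ->
  (\sum_(j < J | L j) 1%N)%N%:R * lam `^ r <=
    weak_cst r * \int[P]_x (g x `^ r).
Proof.
move=> r1 l0 mA mD mE AD ED Apos DE nest g0 ig igr h.
have r0 : 0 < r by rewrite (lt_trans _ r1).
have A1 j : mes (A j) <= 1.
  have -> : 1 = mes (@setT T) :> R by rewrite probability_setT.
  exact: fineP_le.
have /choice[lev levP] j : exists m : nat, 2^-1 ^+ m.+1 < mes (A j) <= 2^-1 ^+ m.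
  exact: dyadic_level.
set th : R := 2 `^ r^-1; set K : R := 2 `^ (1 - r^-1).
have th0 : 0 < th by rewrite powR_gt0.
have thK : th * K = 2.
  by rewrite /th /K -powRD ?(addrC _ (1 - _)) ?subrK ?powRr1// oner_eq0.
pose t m := lam * th ^+ m.
have t0 m : 0 < t m by rewrite mulr_gt0// exprn_gt0.
pose B m := [set x | t m / 2 < g x].
have mB m : measurable (B m).
  rewrite (_ : B m = g @^-1` `]t m / 2, +oo[); last first.
    by apply/seteqP; split => x /=; rewrite in_itv/= andbT.
  by rewrite -[X in measurable X]setTI; apply: (ri_meas ig).
pose gm m x := g x * \1_(B m) x.
have igm m : ri (gm m) by exact: riM_indic.
have gm0 m x : 0 <= gm m x by rewrite mulr_ge0.
(* The constant 4 is 2 times 2: after the truncation at [t m / 2] at least half of the integral over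
   E j remains, and mes (D j) <= 2 mes (E j). *)
pose nu m X := 4 / t m * \int[P]_x (gm m x * \1_X x).
have nu0 m X : 0 <= nu m X.
  rewrite mulr_ge0 ?divr_ge0 ?(ltW (t0 m))//.
  by apply: Rintegral_ge0 => x _; rewrite mulr_ge0.
have nuD m X Y : measurable X -> measurable Y -> X `&` Y = set0 ->
    nu m (X `|` Y) = nu m X + nu m Y.
  move=> mX mY XY; rewrite /nu -mulrDr -rintD; [|exact: riM_indic|exact: riM_indic].
  congr (_ * _); apply: eq_Rintegral => x _.
  by rewrite indic_setU// mulrDr.
have Dnu j : L j -> mes (D j) <= nu (lev j) (D j).
  move=> Lj; apply: le_trans (DE j Lj) _.
  have tE : t (lev j) * mes (E j) <= \int[P]_x (g x * \1_(E j) x).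
    apply: le_trans (h j Lj); rewrite ler_wpM2r ?fineP_ge0// ler_pM2l//.
    rewrite powRN -[leLHS]invrK lef_pV2 ?posrE ?invr_gt0 ?exprn_gt0 ?powR_gt0//.
    have /andP[_ {}hj] := levP j.
    rewrite -powR_mulrn ?(ltW th0)// /th -powRrM mulrC powRrM powR_mulrn//.
    rewrite -powRV ?exprn_ge0// -exprVn.
    by apply: ge0_ler_powR; rewrite ?nnegrE ?invr_ge0 ?fineP_ge0 ?exprn_ge0// ?invr_ge0// ltW.
  have split_le : \int[P]_x (g x * \1_(E j) x) <=
      \int[P]_x (gm (lev j) x * \1_(E j) x) + t (lev j) / 2 * mes (E j).
    rewrite -rint_indic// -rintZ; last exact: ri_indic.
    rewrite -rintD; [|exact: riM_indic|by apply: riZ; exact: ri_indic].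
    apply: rint_le; first exact: riM_indic.
      by apply: riD; [exact: riM_indic|apply: riZ; exact: ri_indic].
    move=> x; rewrite -mulrDl ler_wpM2r// /gm indicE.
    case: (boolP (x \in B _)) => xB; first by rewrite mulr1 lerDl divr_ge0// ltW.
    rewrite mulr0 add0r leNgt; apply/negP => xx; move: xB.
    by rewrite notin_setE /B /=; apply.
  have gE : \int[P]_x (gm (lev j) x * \1_(E j) x) <=
            \int[P]_x (gm (lev j) x * \1_(D j) x).
    apply: rint_le; [exact: riM_indic|exact: riM_indic|move=> x].
    rewrite ler_wpM2l// !indicE; case: (boolP (x \in E j)) => [/set_mem/ED xD|//].
    by rewrite mem_set.
  rewrite /nu -ler_pdivrMl ?divr_gt0//.
  apply: le_trans gE.
  have := le_trans tE split_le; rewrite -lerBlDr; apply: le_trans.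
  rewrite le_eqVlt; apply/orP; left; apply/eqP.
  by field; rewrite gt_eqF.
have cov m : (\sum_(j < J | L j && (lev j == m)) 1%N)%N%:R <=
    8 / lam * \int[P]_x (K ^+ m * gm m x).
  have := @covering A D (nu m) (fun j => L j && (lev j == m)) J mA mD AD.
  have nst i j : (i < j)%N -> L i && (lev i == m) -> L j && (lev j == m) ->
      A i `&` A j = set0 /\ (D j `<=` D i \/ D i `&` D j = set0).
    move=> ij /andP[Li /eqP im] /andP[Lj /eqP jm].
    apply: (nest (2^-1 ^+ m.+1)) => //.
      by rewrite [2^-1 ^+ m.+1]exprS mulrA mulfV// mul1r -exprS -im.
    by rewrite [2^-1 ^+ m.+1]exprS mulrA mulfV// mul1r -exprS -jm.
  move=> /(_ (fun i j ij Li Lj => (nst i j ij Li Lj).1)).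
  move=> /(_ (fun i j ij Li Lj => (nst i j ij Li Lj).2)).
  move=> /(_ (fun X _ => nu0 m X) (nuD m)).
  have nn j : L j && (lev j == m) -> mes (D j) <= nu m (D j).
    by move=> /andP[Lj /eqP <-]; exact: Dnu.
  move=> /(_ nn) c.
  have {c} := le_trans _ c.
  move=> /(_ ((\sum_(j < J | L j && (lev j == m)) 1%N)%N%:R * 2^-1 ^+ m.+1)) c.
  have /c : (\sum_(j < J | L j && (lev j == m)) 1%N)%N%:R * 2^-1 ^+ m.+1 <=
      \sum_(j < J | L j && (lev j == m)) mes (A j).
    rewrite natr_sum mulr_suml; apply: ler_sum => j /andP[Lj /eqP <-].
    by rewrite mul1r; have /andP[/ltW] := levP j.
  rewrite /nu rintZ// => {c}.
  under eq_Rintegral do rewrite indicT mulr1.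
  rewrite -ler_pdivlMr ?exprn_gt0 ?invr_gt0// => c; apply: le_trans c _.
  rewrite exprVn invrK /t le_eqVlt; apply/orP; left; apply/eqP.
  have -> : 2 ^+ m.+1 = 2 * (th ^+ m * K ^+ m) :> R by rewrite -exprMn thK exprS.
  by field; rewrite !gt_eqF// ?exprn_gt0.
pose M := (\max_(j < J) lev j).+1.
have levM (j : 'I_J) : (lev j < M)%N.
  by rewrite /M ltnS; apply: (@leq_bigmax _ (fun j : 'I_J => lev j)).
have -> : (\sum_(j < J | L j) 1%N)%N =
    (\sum_(m < M) \sum_(j < J | L j && (lev j == m)) 1%N)%N.
  rewrite (partition_big (fun j : 'I_J => Ordinal (levM j)) xpredT)//=.
rewrite natr_sum.
have igrK : ri (fun x => 8 / lam * (K / (K - 1) * (2 / lam) `^ (r - 1)) * g x `^ r).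
  exact: riZ.
have step : \sum_(m < M) (\sum_(j < J | L j && (lev j == m)) 1%N)%N%:R <=
   \int[P]_x (8 / lam * (K / (K - 1) * (2 / lam) `^ (r - 1)) * g x `^ r).
  apply: le_trans (ler_sum _ (fun m _ => cov (nat_of_ord m))) _.
  rewrite -mulr_sumr -rint_sum; last by move=> m _; exact: riZ.
  rewrite -rintZ; last by apply: ri_sum => m _; exact: riZ.
  apply: rint_le => //; first by apply: riZ; apply: ri_sum => m _; exact: riZ.
  (* At a fixed point x only the layers with th^m < 2 g x / lam contribute, so the sum over all
     layers is a truncated geometric sum. *)
  move=> x; rewrite -!mulrA 2?ler_pM2l ?invr_gt0//.
  have := @weak_type_geo r (2 / lam * g x) M r1; rewrite -/K -/th.
  rewrite mulr_ge0 ?divr_ge0 ?(ltW l0)// => /(_ isT) hg.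
  rewrite (_ : \sum_(i < M) K ^+ i * gm i x =
    (\sum_(m < M | th ^+ m < 2 / lam * g x) K ^+ m) * g x); last first.
    rewrite [in RHS]big_mkcond mulr_suml; apply: eq_bigr => m _.
    rewrite /gm indicE (_ : (x \in B m) = (th ^+ m < 2 / lam * g x)).
      by case: ifP; rewrite ?mul0r ?mulr0 ?mulr1.
    rewrite /B /t; apply/idP/idP; rewrite inE/=.
      by rewrite ltr_pdivrMr// [2 / lam]mulrC -mulrA ltr_pdivlMl// [2 * _]mulrC.
    by rewrite ltr_pdivrMr// [2 / lam]mulrC -mulrA ltr_pdivlMl// [2 * _]mulrC.
  apply: le_trans (ler_wpM2r (g0 x) hg) _.
  rewrite powRM ?divr_ge0 ?(ltW l0)// le_eqVlt; apply/orP; left; apply/eqP.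
  by rewrite -(mulr_powRB1 (g0 x) r0) -/K; ring.
rewrite rintZ// in step.
apply: le_trans (ler_wpM2r (powR_ge0 _ _) step) _.
rewrite mulrAC ler_wpM2r//; first by apply: Rintegral_ge0 => x _; exact: powR_ge0.
rewrite /weak_cst -/K -(mulr_powRB1 (ltW l0) r0) powRM ?invr_ge0 ?(ltW l0)//.
rewrite powRV ?(ltW l0)// le_eqVlt; apply/orP; left; apply/eqP.
by field; rewrite !gt_eqF ?powR_gt0// subr_gt0 powR2_gt1// subr_gt0 invf_lt1.
Qed.

End weak_type.

Section split_tree.
Context d {T : measurableType d} {R : realType}.
Variable P : probability T R.
Notation mes A := (fine (P A)).
Notation ri := (fun f => P.-integrable setT (EFin \o f)).

(* The sets [A1 j] and [A2 j] are the two halves of the atom split at step j;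
   step 0, which creates the whole space, is encoded by [A2 0 = set0]. *)
Record split_tree (A1 A2 : nat -> set T) : Prop := SplitTree {
  st_m1 : forall j, measurable (A1 j);
  st_m2 : forall j, measurable (A2 j);
  st_pos : forall j, 0 < mes (A1 j);
  st_disj : forall j, A1 j `&` A2 j = set0;
  st_le : forall j, (0 < j)%N -> mes (A1 j) <= mes (A2 j);
  st_0 : A2 0%N = set0;
  st_nest : forall i j, (i < j)%N ->
    [\/ A1 j `|` A2 j `<=` A1 i, A1 j `|` A2 j `<=` A2 i |
        (A1 i `|` A2 i) `&` (A1 j `|` A2 j) = set0] }.

Variables (A1 A2 : nat -> set T).
Hypothesis tree : split_tree A1 A2.

Let m1 := st_m1 tree.
Let m2 := st_m2 tree.
Let pos := st_pos tree.

(** The weight |A1|^(1/r) makes this the pairing of g with the bump of the dual exponent, see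
    [rint_bump]. At step 0 the second summand is 0, since the inverse of 0 is 0. *)
Definition bavg (r : R) (g : T -> R) (j : nat) : R :=
  mes (A1 j) `^ r^-1 * ((mes (A1 j))^-1 * (\int[P]_x (g x * \1_(A1 j) x)) +
                        (mes (A2 j))^-1 * (\int[P]_x (g x * \1_(A2 j) x))).

Lemma bavg_ge0 r g j : (forall x, 0 <= g x) -> 0 <= bavg r g j.
Proof.
move=> g0; rewrite mulr_ge0 ?powR_ge0// addr_ge0// mulr_ge0 ?invr_ge0 ?fineP_ge0//;
  by apply: Rintegral_ge0 => x _; rewrite mulr_ge0.
Qed.

(** If the atom split at step j lay in A1 i, its two halves would give mes (A1 i) >= 2 mes (A1 j) >
    2 c. In the two other cases of [st_nest] disjointness is immediate. *)
Lemma layer_disjoint c i j : (i < j)%N -> c < mes (A1 i) <= 2 * c ->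
  c < mes (A1 j) <= 2 * c -> A1 i `&` A1 j = set0.
Proof.
move=> ij /andP[_ ic] /andP[cj _].
have j0 : (0 < j)%N by exact: leq_ltn_trans ij.
have U1 : A1 j `<=` A1 j `|` A2 j by move=> x; left.
case: (st_nest tree ij) => [h|h|h].
- exfalso; have := fineP_le P (measurableU _ _ (m1 j) (m2 j)) (m1 i) h.
  rewrite finePU ?(st_disj tree)// => h'.
  have := st_le tree j0; lra.
- apply/seteqP; split => x // [xi xj].
  by have : (A1 i `&` A2 i) x; [split => //; exact/h/U1|rewrite (st_disj tree)].
- apply/seteqP; split => x // [xi xj].
  by rewrite -h; split; left.
Qed.

(** One of the two averages accounts for at least [lam / 2], which is the origin of the factors 2
    and 2^r. For the small halves [weak_type] applies with D = E = A1, disjoint within a layer. For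
    the large halves E = A2, and D is the whole split atom, because D must contain A1 as well; then
    mes D <= 2 mes E since |A1| <= |A2|. *)
Lemma bavg_weak (r : R) (g : T -> R) (L : pred nat) (J : nat) (lam : R) :
  1 < r -> 0 < lam -> (forall x, 0 <= g x) -> ri g -> ri (fun x => g x `^ r) ->
  (forall j, L j -> lam <= bavg r g j) ->
  (\sum_(j < J | L j) 1%N)%N%:R * lam `^ r <=
    2 * 2 `^ r * weak_cst r * \int[P]_x (g x `^ r).
Proof.
move=> r1 l0 g0 ig igr h; have r0 : 0 < r by rewrite (lt_trans _ r1).
pose Q (E : nat -> set T) j :=
  lam / 2 <= mes (A1 j) `^ r^-1 * ((mes (E j))^-1 * (\int[P]_x (g x * \1_(E j) x))).
have key (E : nat -> set T) j : Q E j ->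
    0 < mes (E j) /\ lam / 2 * mes (A1 j) `^ (- r^-1) * mes (E j) <=
      \int[P]_x (g x * \1_(E j) x).
  move=> QE; have E0 : 0 < mes (E j).
    rewrite lt0r fineP_ge0 andbT; apply/eqP => E0; move: QE.
    by rewrite /Q E0 invr0 mul0r mulr0 leNgt divr_gt0.
  split=> //; rewrite powRN -ler_pdivlMr// [leRHS]mulrC ler_pdivrMr ?powR_gt0//.
  by rewrite [leRHS]mulrC; exact: QE.
have l20 : 0 < lam / 2 by rewrite divr_gt0.
have W1 := @weak_type d T R P A1 A1 A1 (Q A1) J g r (lam / 2) r1 l20 m1 m1 m1.
have {W1} W1 := W1 (fun _ => @subset_refl _ _) (fun _ => @subset_refl _ _) pos.
have {W1} W1 : (\sum_(j < J | Q A1 j) 1%N)%N%:R * (lam / 2) `^ r <=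
    weak_cst r * \int[P]_x (g x `^ r).
  apply: W1 => //; last by move=> j /key[].
    by move=> j _; rewrite ler_peMl ?fineP_ge0// ler1n.
  move=> c i j ij _ _ ic jc; have := layer_disjoint ij ic jc.
  by split => //; right.
have U1 j : A1 j `<=` A1 j `|` A2 j by move=> x; left.
have U2 j : A2 j `<=` A1 j `|` A2 j by move=> x; right.
have mU j : measurable (A1 j `|` A2 j) by exact: measurableU.
have W2 := @weak_type d T R P A1 (fun j => A1 j `|` A2 j) A2 (Q A2) J g r (lam / 2) r1
  l20 m1 mU m2 U1 U2 pos.
have {W2} W2 : (\sum_(j < J | Q A2 j) 1%N)%N%:R * (lam / 2) `^ r <=
    weak_cst r * \int[P]_x (g x `^ r).
  apply: W2 => //; last by move=> j /key[].
    (* At step 0 the set A2 is empty and [st_le] gives nothing; but then the average over A2 is 0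
       and [Q A2 0] cannot hold. *)
    move=> j /key[+ _]; case: j => [|j _]; first by rewrite (st_0 tree) measure0 ltxx.
    by rewrite finePU ?(st_disj tree)// mulr_natl mulr2n lerD2r (st_le tree).
  move=> c i j ij _ _ ic jc; split; first exact: layer_disjoint ij ic jc.
  case: (st_nest tree ij) => hh; [left|left|by right].
    exact: subset_trans hh (U1 i).
  exact: subset_trans hh (U2 i).
have cnt : (\sum_(j < J | L j) 1 <=
    \sum_(j < J | Q A1 j) 1 + \sum_(j < J | Q A2 j) 1)%N.
  rewrite big_mkcond [X in (_ <= X + _)%N]big_mkcond [X in (_ <= _ + X)%N]big_mkcond.
  rewrite -big_split/=; apply: leq_sum => j _; case: ifP => // /h.
  rewrite /bavg mulrDr => hj; case: ifP => // /negP Q1; case: ifP => // /negP Q2.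
  exfalso; move: Q1 Q2; rewrite /Q => /negP; rewrite -ltNge => Q1 /negP; rewrite -ltNge => Q2.
  by have := le_lt_trans hj (ltrD Q1 Q2); rewrite -splitr ltxx.
have l2 : lam `^ r = 2 `^ r * (lam / 2) `^ r.
  by rewrite -powRM ?(ltW l20)// mulrC divfK.
move: (weak_cst r) W1 W2 => w W1 W2.
rewrite l2 mulrCA -!mulrA [X in _ <= X]mulrCA ler_wpM2l ?powR_ge0//.
apply: le_trans (_ : (\sum_(j < J | Q A1 j) 1 + \sum_(j < J | Q A2 j) 1)%N%:R *
    (lam / 2) `^ r <= _); first by rewrite ler_wpM2r ?powR_ge0// ler_nat.
by rewrite natrD mulrDl [leRHS]mulr_natl mulr2n lerD.
Qed.

Definition bavg_cst (r t : R) : R :=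
  (2 * 2 `^ r * weak_cst r) `^ (t / r) / (1 - t / r).

Lemma weak_cst_ge0 (r : R) : 1 < r -> 0 <= weak_cst r.
Proof.
move=> r1; have r0 : 0 < r by rewrite (lt_trans _ r1).
rewrite /weak_cst !mulr_ge0 ?powR_ge0// invr_ge0 subr_ge0 ltW// powR2_gt1//.
by rewrite subr_gt0 invf_lt1.
Qed.

Lemma bavg_cst_ge0 (r t : R) : 1 < r -> t < r -> 0 <= bavg_cst r t.
Proof.
move=> r1 tr; have r0 : 0 < r by rewrite (lt_trans _ r1).
by rewrite /bavg_cst divr_ge0 ?powR_ge0// subr_ge0 ler_pdivrMr// mul1r ltW.
Qed.

(** The weak-type bound places the averages in weak l^r. [lorentz_sum] with s = t/r trades this for
    an l^t sum over G at the price of #|G|^(1 - t/r). *)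
Lemma bavg_sum (r t : R) (g : T -> R) (J : nat) (G : {set 'I_J}) :
  1 < r -> 0 < t < r -> (forall x, 0 <= g x) -> ri g -> ri (fun x => g x `^ r) ->
  \sum_(j in G) bavg r g j `^ t <=
    bavg_cst r t * (\int[P]_x (g x `^ r)) `^ (t / r) * #|G|%:R `^ (1 - t / r).
Proof.
move=> r1 /andP[t0 tr] g0 ig igr; have r0 : 0 < r by rewrite (lt_trans _ r1).
have I0 : 0 <= \int[P]_x (g x `^ r) by apply: Rintegral_ge0 => x _; exact: powR_ge0.
set W := 2 * 2 `^ r * weak_cst r.
have W0 : 0 <= W by rewrite /W mulr_ge0 ?weak_cst_ge0// mulr_ge0// powR_ge0.
have tr1 : t / r < 1 by rewrite ltr_pdivrMr// mul1r.
have := @lorentz_sum R 'I_J G (fun j => bavg r g j `^ t) (t / r)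
  ((W * \int[P]_x (g x `^ r)) `^ (t / r)).
rewrite divr_gt0//= tr1 powR_ge0 => /(_ isT isT (fun _ _ => powR_ge0 _ _)) h.
apply: le_trans (h _) _.
  move=> B l BG l0 lB.
  (* The weak-type bound counts over a predicate on nat, so membership in [B] is expressed through
     the values of its ordinals. *)
  have := @bavg_weak r g (fun j => [exists i : 'I_J, (i == j :> nat) && (i \in B)])
    J (l `^ t^-1) r1 (powR_gt0 _ l0) g0 ig igr.
  have LB : forall j, [exists i : 'I_J, (i == j :> nat) && (i \in B)] ->
      l `^ t^-1 <= bavg r g j.
    move=> j /existsP[i /andP[/eqP <- iB]].
    rewrite -[leRHS]powRr1 ?bavg_ge0// -(mulfV (lt0r_neq0 t0)) powRrM.
    by apply: ge0_ler_powR; rewrite ?nnegrE ?powR_ge0 ?invr_ge0 ?(ltW l0) ?(ltW t0)// lB.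
  move=> /(_ LB).
  rewrite (eq_bigl (fun i => i \in B)); last first.
    move=> i /=; apply/existsP/idP => [[j /andP[/eqP/val_inj ->]]//|iB].
    by exists i; rewrite eqxx.
  rewrite sum1_card -powRrM => hB.
  rewrite -/W in hB.
  have -> : l = (l `^ (t^-1 * r)) `^ (t / r).
    rewrite -powRrM (_ : t^-1 * r * (t / r) = 1) ?powRr1 ?(ltW l0)//.
    by field; rewrite !gt_eqF.
  rewrite -powRM ?powR_ge0//.
  apply: le_powR; [by rewrite divr_ge0 ?ltW|by rewrite mulr_ge0 ?powR_ge0|].
  by rewrite mulrC.
rewrite /bavg_cst -/W powRM// le_eqVlt; apply/orP; left; apply/eqP; ring.
Qed.

(** The absolute value of the Haar function 1_A1/|A1| - 1_A2/|A2| of the splitting, scaled by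
    |A1|^(1 - 1/p) so that the L^p norm remains bounded independently of the splitting. At step 0 it
    is the constant 1 if A1 is the whole space. *)
Definition bump (p : R) (j : nat) (x : T) : R :=
  mes (A1 j) `^ (- p^-1) * \1_(A1 j) x +
  mes (A1 j) `^ (1 - p^-1) / mes (A2 j) * \1_(A2 j) x.

Lemma bump_ge0 p j x : 0 <= bump p j x.
Proof. by rewrite addr_ge0// mulr_ge0// ?divr_ge0 ?powR_ge0 ?fineP_ge0. Qed.

Lemma measurable_bump p j : measurable_fun setT (bump p j).
Proof.
by apply: measurable_funD; apply: measurable_funM => //; exact: measurable_indic.
Qed.

Lemma bump_bounded p j : exists M, forall x, bump p j x <= M.
Proof.
exists (mes (A1 j) `^ (- p^-1) + mes (A1 j) `^ (1 - p^-1) / mes (A2 j)) => x.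
apply: lerD; rewrite ler_piMr ?divr_ge0 ?powR_ge0 ?fineP_ge0// indicE;
  by case: (_ \in _).
Qed.

Lemma rint_bump p j g : 1 < p -> ri g ->
  \int[P]_x (bump p j x * g x) = bavg (p / (p - 1)) g j.
Proof.
move=> p1 ig; have p0 : 0 < p by rewrite (lt_trans _ p1).
have e : (p / (p - 1))^-1 = 1 - p^-1 by field; rewrite !gt_eqF// subr_gt0.
rewrite /bavg e mulrDr.
have -> : (fun x => bump p j x * g x) = (fun x =>
   mes (A1 j) `^ (- p^-1) * (g x * \1_(A1 j) x) +
   mes (A1 j) `^ (1 - p^-1) / mes (A2 j) * (g x * \1_(A2 j) x)).
  by apply/funext => x; rewrite /bump; ring.
rewrite rintD ?rintZ//; try (by [apply: riM_indic|apply: riZ; apply: riM_indic]).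
rewrite !mulrA; congr (_ * _ + _).
rewrite powRB; last by rewrite (gt_eqF (pos j)) implybT.
by rewrite powRr1 ?fineP_ge0// powRN mulrAC mulfV ?mul1r// gt_eqF.
Qed.

(** Let W be the integral of F^p for the sum F of the bumps, and q = p/(p-1). Then W is the sum of
    the pairings of the bumps with g = F^(p-1), and the integral of g^q is again W. So [bavg_sum]
    with r = q and t = 1 gives W <= c W^(1/q) #|G|^(1/p), and W^(1/q) can be divided out: W is
    finite because the bumps are bounded. *)
Lemma bump_sum_norm (p : R) (J : nat) (G : {set 'I_J}) : 1 < p ->
  \int[P]_x ((\sum_(j in G) bump p j x) `^ p) <=
    (bavg_cst (p / (p - 1)) 1) `^ p * #|G|%:R.
Proof.
move=> p1; have p0 : 0 < p by rewrite (lt_trans _ p1).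
have p10 : 0 < p - 1 by rewrite subr_gt0.
pose F x := \sum_(j in G) bump p j x.
have F0 x : 0 <= F x by apply: sumr_ge0 => j _; exact: bump_ge0.
have mF : measurable_fun setT F.
  rewrite (_ : F = fun x => \sum_(j <- enum G) bump p j x).
    by apply: measurable_sum => j; exact: measurable_bump.
  by apply/funext => x; rewrite big_enum.
have [M FM] : exists M, forall x, F x <= M.
  have /choice[N hN] j := bump_bounded p j.
  by exists (\sum_(j in G) N j) => x; apply: ler_sum => j _.
have riF a : 0 <= a -> ri (fun x => F x `^ a).
  move=> a0; apply: (@ri_bounded _ _ _ _ _ (M `^ a)).
    exact: measurableT_comp (measurable_powR a) mF.
  move=> x; rewrite ger0_norm ?powR_ge0//; apply: ge0_ler_powR; rewrite ?nnegrE//.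
  exact: le_trans (F0 x) (FM x).
pose g x := F x `^ (p - 1).
have g0 x : 0 <= g x by exact: powR_ge0.
have ig : ri g by apply: riF; exact: ltW.
have gpE : (fun x => g x `^ (p / (p - 1))) = (fun x => F x `^ p).
  apply/funext => x; rewrite /g -powRrM; congr (_ `^ _).
  by field; rewrite gt_eqF.
have igp : ri (fun x => g x `^ (p / (p - 1))) by rewrite gpE; apply: riF; exact: ltW.
have pp1 : 1 < p / (p - 1) by rewrite ltr_pdivlMr// mul1r gtrBl.
set W := \int[P]_x (F x `^ p).
have W0 : 0 <= W by apply: Rintegral_ge0 => x _; exact: powR_ge0.
have : W <= \sum_(j in G) bavg (p / (p - 1)) g j `^ 1.
  rewrite (eq_bigr (fun j : 'I_J => \int[P]_x (bump p j x * g x))); last first.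
    by move=> j _; rewrite powRr1 ?bavg_ge0// rint_bump.
  have ib (j : 'I_J) : j \in G -> ri (fun x => bump p j x * g x).
    move=> _; have [N hN] := bump_bounded p j.
    apply: (@ri_bounded _ _ _ _ _ (N * M `^ (p - 1))).
      by apply: measurable_funM; [exact: measurable_bump|exact: ri_meas ig].
    move=> x; rewrite ger0_norm ?mulr_ge0 ?bump_ge0//; apply: ler_pM => //.
      exact: bump_ge0.
    by apply: ge0_ler_powR; rewrite ?nnegrE// ?(ltW p10)// (le_trans (F0 x)).
  rewrite -rint_sum//; apply: rint_le; first exact/riF/ltW.
    exact: ri_sum.
  by move=> x; rewrite -mulr_suml -/(F x) mulr_powRB1.
have one : 0 < (1 : R) < p / (p - 1) by rewrite ltr01.
move/le_trans/(_ (bavg_sum G pp1 one g0 ig igp)); rewrite gpE -/W mul1r => h.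
have [W00|Wn0] := eqVneq W 0; first by rewrite W00 mulr_ge0 ?powR_ge0.
have Wpos : 0 < W by rewrite lt0r Wn0.
have e : (p / (p - 1))^-1 = 1 - p^-1 by field; rewrite !gt_eqF.
have {}h : W `^ p^-1 <= bavg_cst (p / (p - 1)) 1 * #|G|%:R `^ p^-1.
  move: h; rewrite e subKr mulrAC -ler_pdivrMr ?powR_gt0//; apply: le_trans.
  rewrite le_eqVlt -[X in X / _]powRr1// -powRB; last by rewrite (gt_eqF Wpos) implybT.
  by rewrite subKr eqxx.
rewrite -(powRVK W0 p0).
have c0 : 0 <= bavg_cst (p / (p - 1)) 1 by exact: bavg_cst_ge0.
rewrite -[X in _ <= _ * X](@powRVK _ _ p)// -powRM ?powR_ge0//.
by apply: le_powR h; rewrite ?powR_ge0 ?(ltW p0).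
Qed.

End split_tree.

(** * Scalar-valued functions in L^p *)

Section complex_modulus.
Context {R : realType}.
Implicit Types (z w : R[i]) (k : scalar_kind).
Notation normc := ComplexField.Normc.normc.

Lemma normcRI z : normc z = (complex.Re z ^+ 2 + complex.Im z ^+ 2) `^ 2^-1.
Proof. by case: z => a b; rewrite powR12_sqrt// addr_ge0 ?sqr_ge0. Qed.

Lemma normc_ge0 z : 0 <= normc z.
Proof. by rewrite normcRI powR_ge0. Qed.

Lemma normcZ_real (a : R) : normc (a%:C)%C = `|a|.
Proof. by rewrite /= expr0n/= addr0 sqrtr_sqr. Qed.

Lemma normc_conj z : normc (conjc z) = normc z.
Proof. by case: z => a b; rewrite /= sqrrN. Qed.

Lemma Re_mulJ z : complex.Re (z * conjc z) = normc z `^ 2.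
Proof.
case: z => a b /=; rewrite powR_mulrn ?sqrtr_ge0// sqr_sqrtr ?addr_ge0 ?sqr_ge0//.
by rewrite mulrN opprK !expr2.
Qed.

Lemma Im_mulJ z : complex.Im (z * conjc z) = 0.
Proof. by case: z => a b /=; rewrite mulrN [b * a]mulrC addNr. Qed.

Lemma abs_Re_le z : `|complex.Re z| <= normc z.
Proof.
by case: z => a b /=; rewrite -sqrtr_sqr ler_wsqrtr// lerDl sqr_ge0.
Qed.

Lemma abs_Im_le z : `|complex.Im z| <= normc z.
Proof.
by case: z => a b /=; rewrite -sqrtr_sqr ler_wsqrtr// lerDr sqr_ge0.
Qed.

Lemma scalars0 k : scalars k (0 : R[i]). Proof. by case: k. Qed.

Lemma scalars1 k : scalars k (1 : R[i]). Proof. by case: k. Qed.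

Lemma scalarsD k z w : scalars k z -> scalars k w -> scalars k (z + w).
Proof. by case: k => //; case: z w => a b [c d] /= -> ->; rewrite addr0. Qed.

Lemma scalarsM k z w : scalars k z -> scalars k w -> scalars k (z * w).
Proof. by case: k => //; case: z w => a b [c d] /= -> ->; rewrite mulr0 mul0r addr0. Qed.

Lemma scalarsN k z : scalars k z -> scalars k (- z).
Proof. by case: k => //; case: z => a b /= ->; rewrite oppr0. Qed.

Lemma scalarsV k z : scalars k z -> scalars k z^-1.
Proof. by case: k => //; case: z => a b /= -> /=; rewrite mul0r oppr0. Qed.

Lemma scalars_real k (a : R) : scalars k (a%:C)%C.
Proof. by case: k. Qed.

End complex_modulus.

Section lp_functions.
Context d {T : measurableType d} {R : realType}.
Variables (P : probability T R) (k : scalar_kind).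
Implicit Types (f g h : cfun T R) (p : R) (c : R[i]).
Notation ri := (fun f : T -> R => P.-integrable setT (EFin \o f)).
Notation normc := ComplexField.Normc.normc.

Lemma rint_eq_ae (f g : T -> R) : measurable_fun setT f -> measurable_fun setT g ->
  (\forall x \ae P, f x = g x) -> \int[P]_x f x = \int[P]_x g x.
Proof.
move=> mf mg fg; rewrite /Rintegral; congr fine; apply: ae_eq_integral => //.
- exact/measurable_EFinP.
- exact/measurable_EFinP.
- by apply: filterS fg => x -> _.
Qed.

Lemma ri_le_ae (f g : T -> R) : measurable_fun setT f -> (forall x, 0 <= f x) ->
  (forall x, 0 <= g x) -> ri g ->
  (\forall x \ae P, f x <= g x) -> ri f.
Proof.
move=> mf f0 g0 ig fg; apply/integrableP; split; first exact/measurable_EFinP.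
have /integrableP[mg] := ig; apply: le_lt_trans; apply: ae_ge0_le_integral => //.
- exact/measurableT_comp/measurable_EFinP.
- exact: measurableT_comp.
- by apply: filterS fg => x h _ /=; rewrite !ger0_norm// lee_fin.
Qed.

Lemma rint_le_ae (f g : T -> R) : measurable_fun setT f -> (forall x, 0 <= f x) ->
  (forall x, 0 <= g x) -> ri g ->
  (\forall x \ae P, f x <= g x) -> \int[P]_x f x <= \int[P]_x g x.
Proof.
move=> mf f0 g0 ig fg; have If := ri_le_ae mf f0 g0 ig fg.
rewrite /Rintegral fine_le ?integrable_fin_num//; apply: ae_ge0_le_integral => //.
- by move=> x _; rewrite lee_fin.
- exact/measurable_EFinP.
- by move=> x _; rewrite lee_fin.
- by apply/measurable_EFinP; exact: ri_meas ig.
- by apply: filterS fg => x h _ /=; rewrite lee_fin.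
Qed.

Lemma rint0_ae (f : T -> R) : (forall x, 0 <= f x) -> ri f ->
  \int[P]_x f x = 0 -> \forall x \ae P, f x = 0.
Proof.
move=> f0 If e.
have : (\int[P]_x (EFin \o f) x = 0)%E.
  by rewrite -[LHS]fineK ?integrable_fin_num// [fine _]e.
have mf : measurable_fun setT (EFin \o f) by apply/measurable_EFinP; exact: ri_meas If.
move=> h; have : (\int[P]_x `|(EFin \o f) x| = 0)%E.
  by rewrite -h; apply: eq_integral => x _ /=; rewrite ger0_norm.
move/(ae_eq_integral_abs P measurableT mf).
by apply: filterS => x /(_ I) [].
Qed.

Lemma modulus_ge0 f x : 0 <= modulus f x. Proof. exact: normc_ge0. Qed.

Lemma modulusD f g x : modulus (f + g) x <= modulus f x + modulus g x.
Proof. exact: le_normcD. Qed.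

Lemma modulusZ c f x : modulus (c *: f) x = normc c * modulus f x.
Proof. exact: ComplexField.Normc.normcM. Qed.

Lemma modulusN f x : modulus (- f) x = modulus f x.
Proof. exact: normcN. Qed.

Lemma modulus0 x : modulus (0 : cfun T R) x = 0.
Proof. exact: ComplexField.Normc.normc0. Qed.

Lemma modulus_eq0 f x : modulus f x = 0 -> f x = 0.
Proof. exact: ComplexField.Normc.eq0_normc. Qed.

Lemma modulus_cutoff (A : set T) f x : modulus (cutoff A f) x = modulus f x * \1_A x.
Proof.
rewrite /modulus /cutoff ComplexField.Normc.normcM !indicE.
by case: (x \in A); rewrite ?(ComplexField.Normc.normc1, ComplexField.Normc.normc0).
Qed.

Lemma scalar_mfun0 : scalar_mfun k (0 : cfun T R).
Proof. by split=> [x||]; [exact: scalars0|exact: measurable_cst|exact: measurable_cst]. Qed.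

Lemma scalar_mfunD f g : scalar_mfun k f -> scalar_mfun k g -> scalar_mfun k (f + g).
Proof.
move=> [kf rf imf] [kg rg img]; split => [x||].
- exact: scalarsD.
- rewrite (_ : (fun x => _) = fun x => complex.Re (f x) + complex.Re (g x)).
    exact: measurable_funD.
  by apply/funext => x; rewrite /= [(f + g) x]/(f x + g x); case: (f x) (g x) => ? ? [].
- rewrite (_ : (fun x => _) = fun x => complex.Im (f x) + complex.Im (g x)).
    exact: measurable_funD.
  by apply/funext => x; rewrite /= [(f + g) x]/(f x + g x); case: (f x) (g x) => ? ? [].
Qed.

Lemma scalar_mfunZ c f : scalars k c -> scalar_mfun k f -> scalar_mfun k (c *: f).
Proof.
move=> kc [kf rf imf]; split => [x||].
- exact: scalarsM.
- rewrite (_ : (fun x => _) = fun x => complex.Re c * complex.Re (f x) -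
     complex.Im c * complex.Im (f x)).
    by apply: measurable_funB; apply: measurable_funM.
  by apply/funext => x; rewrite /= [(c *: f) x]/(c * f x); case: c (f x) {kc} => ? ? [].
- rewrite (_ : (fun x => _) = fun x => complex.Re c * complex.Im (f x) +
     complex.Im c * complex.Re (f x)).
    by apply: measurable_funD; apply: measurable_funM.
  by apply/funext => x; rewrite /= [(c *: f) x]/(c * f x); case: c (f x) {kc} => ? ? [].
Qed.

Lemma scalar_mfun_cutoff (A : set T) f : measurable A -> scalar_mfun k f ->
  scalar_mfun k (cutoff A f).
Proof.
move=> mA [kf rf imf].
have E x : cutoff A f x = Complex (complex.Re (f x) * \1_A x) (complex.Im (f x) * \1_A x).
  by rewrite /cutoff !indicE; case: (f x) => a b; case: (x \in A);
    rewrite ?mulr0 ?mulr1.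
split => [x||].
- rewrite /cutoff; apply: scalarsM => //; rewrite indicE.
  by case: (x \in A); [exact: scalars1|exact: scalars0].
- by under eq_fun do rewrite E/=; apply: measurable_funM => //; exact: measurable_indic.
- by under eq_fun do rewrite E/=; apply: measurable_funM => //; exact: measurable_indic.
Qed.

Lemma scalar_mfun_sum (I : Type) (s : seq I) (Q : pred I) (F : I -> cfun T R) :
  (forall i, Q i -> scalar_mfun k (F i)) -> scalar_mfun k (\sum_(i <- s | Q i) F i).
Proof.
move=> h; elim/big_rec: _ => [|i f Qi IH]; first exact: scalar_mfun0.
by apply: scalar_mfunD => //; exact: h.
Qed.

Lemma measurable_modulus f : scalar_mfun k f -> measurable_fun setT (modulus f).
Proof.
move=> [_ rf imf]; rewrite (_ : modulus f = fun x =>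
  (complex.Re (f x) ^+ 2 + complex.Im (f x) ^+ 2) `^ 2^-1); last first.
  by apply/funext => x; exact: normcRI.
apply: (measurableT_comp (measurable_powR _)).
by apply: measurable_funD; apply: measurable_funX.
Qed.

Lemma measurable_modulus_powR f p : scalar_mfun k f ->
  measurable_fun setT (fun x => modulus f x `^ p).
Proof.
by move=> mf; apply: (measurableT_comp (measurable_powR _)); exact: measurable_modulus.
Qed.

(** A real-valued stand-in for [Lpnorm], meaningful only on [Lpfun]: if the integral is infinite,
    [Rintegral] returns 0. *)
Definition nrm p f : R := (\int[P]_x (modulus f x `^ p)) `^ p^-1.

Lemma nrm_ge0 p f : 0 <= nrm p f. Proof. exact: powR_ge0. Qed.

Lemma LpnormE0 p f : 0 < p ->
  Lpnorm P p%:E f = ((\int[P]_x (modulus f x `^ p)%:E) `^ p^-1)%E.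
Proof.
move=> p0; rewrite /Lpnorm unlock.
have -> // : (\int[P]_x (`|(EFin \o modulus f) x| `^ p) =
  \int[P]_x (modulus f x `^ p)%:E)%E.
by apply: eq_integral => x _; rewrite /= ger0_norm ?modulus_ge0.
Qed.

Lemma Lpfun_ri p f : 0 < p -> Lpfun P k p%:E f -> ri (fun x => modulus f x `^ p).
Proof.
move=> p0 [mf]; rewrite LpnormE0// => h; apply/integrableP; split.
  exact/measurable_EFinP/measurable_modulus_powR.
apply: le_lt_trans (_ : (\int[P]_x (modulus f x `^ p)%:E < +oo)%E).
  rewrite le_eqVlt; apply/orP; left; apply/eqP.
  by apply: eq_integral => x _ /=; rewrite ger0_norm ?powR_ge0.
by apply: lty_poweRy h; rewrite invr_neq0// gt_eqF.
Qed.

Lemma Lpfun_intro p f : 0 < p -> scalar_mfun k f ->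
  ri (fun x => modulus f x `^ p) -> Lpfun P k p%:E f.
Proof.
move=> p0 mf If; split=> //; rewrite LpnormE0//; apply: poweR_lty.
have /integrableP[_] := If; apply: le_lt_trans; rewrite le_eqVlt; apply/orP; left; apply/eqP.
by apply: eq_integral => x _ /=; rewrite ger0_norm ?powR_ge0.
Qed.

Lemma LpnormE p f : 0 < p -> Lpfun P k p%:E f -> Lpnorm P p%:E f = (nrm p f)%:E.
Proof.
move=> p0 Lf; rewrite LpnormE0// /nrm -poweR_EFin /Rintegral fineK//.
by apply: integrable_fin_num => //; exact: Lpfun_ri.
Qed.

Lemma nrm_pow p f : 0 < p -> nrm p f `^ p = \int[P]_x (modulus f x `^ p).
Proof.
move=> p0; rewrite /nrm powRVK//.
by apply: Rintegral_ge0 => x _; exact: powR_ge0.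
Qed.

Lemma Lpfun_mfun p f : Lpfun P k p%:E f -> scalar_mfun k f. Proof. by case. Qed.

Lemma Lpfun_dom p f (h : T -> R) : 0 < p -> scalar_mfun k f -> (forall x, 0 <= h x) ->
  ri (fun x => h x `^ p) -> (\forall x \ae P, modulus f x <= h x) ->
  Lpfun P k p%:E f /\ nrm p f <= (\int[P]_x (h x `^ p)) `^ p^-1.
Proof.
move=> p0 mf h0 ih fh.
have fhp : \forall x \ae P, modulus f x `^ p <= h x `^ p.
  by apply: filterS fh => x; apply: le_powR; [exact: ltW|exact: modulus_ge0].
have mfp := measurable_modulus_powR p mf.
split.
  by apply: Lpfun_intro => //; apply: ri_le_ae fhp => // x; exact: powR_ge0.
apply: le_powR; first by rewrite invr_ge0 ltW.
  by apply: Rintegral_ge0 => x _; exact: powR_ge0.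
by apply: rint_le_ae fhp => // x; exact: powR_ge0.
Qed.

Lemma nrm_ae p f g : scalar_mfun k f -> scalar_mfun k g ->
  (\forall x \ae P, f x = g x) -> nrm p f = nrm p g.
Proof.
move=> mf mg fg; have e : \int[P]_x (modulus f x `^ p) = \int[P]_x (modulus g x `^ p).
  apply: rint_eq_ae; [exact: measurable_modulus_powR|exact: measurable_modulus_powR|].
  by apply: filterS fg => x; rewrite /modulus => ->.
by rewrite /nrm e.
Qed.

Lemma Lpfun_ae p f g : 0 < p -> Lpfun P k p%:E f -> scalar_mfun k g ->
  (\forall x \ae P, g x = f x) -> Lpfun P k p%:E g.
Proof.
move=> p0 Lf mg gf; apply: (proj1 (@Lpfun_dom p g (modulus f) _ _ _ _ _)) => //.
- by move=> x; exact: modulus_ge0.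
- exact: Lpfun_ri.
- by apply: filterS gf => x; rewrite /modulus => ->.
Qed.

Lemma nrm0 p : 0 < p -> nrm p (0 : cfun T R) = 0.
Proof.
move=> p0; rewrite /nrm; under eq_Rintegral do rewrite modulus0 powR0 ?gt_eqF//.
by rewrite Rintegral_cst// mul0r powR0// invr_neq0// gt_eqF.
Qed.

Lemma Lpfun0 p : 0 < p -> Lpfun P k p%:E (0 : cfun T R).
Proof.
move=> p0; apply: Lpfun_intro => //; first exact: scalar_mfun0.
apply: eq_integrable (ri_cst P 0) => // x _ /=.
by rewrite modulus0 powR0// gt_eqF.
Qed.

Lemma LpfunZ p c f : 0 < p -> scalars k c -> Lpfun P k p%:E f ->
  Lpfun P k p%:E (c *: f).
Proof.
move=> p0 kc Lf; apply: Lpfun_intro => //; first exact: scalar_mfunZ (Lpfun_mfun Lf).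
apply: eq_integrable (riZ (normc c `^ p) (Lpfun_ri p0 Lf)) => // x _ /=.
by rewrite modulusZ powRM ?normc_ge0.
Qed.

Lemma nrmZ p c f : 0 < p -> Lpfun P k p%:E f -> nrm p (c *: f) = normc c * nrm p f.
Proof.
move=> p0 Lf; rewrite /nrm.
under eq_Rintegral do rewrite modulusZ powRM ?normc_ge0 ?modulus_ge0//.
rewrite rintZ; last exact: Lpfun_ri.
rewrite powRM ?powR_ge0 ?powRKV ?normc_ge0//.
by apply: Rintegral_ge0 => x _; exact: powR_ge0.
Qed.

Lemma LpnormD p f g : 1 <= p -> scalar_mfun k f -> scalar_mfun k g ->
  (Lpnorm P p%:E (f + g)%R <= Lpnorm P p%:E f + Lpnorm P p%:E g)%E.
Proof.
move=> p1 mf mg; have p0 : 0 < p by exact: lt_le_trans p1.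
apply: le_trans (minkowski_EFin P (measurable_modulus mf) (measurable_modulus mg) p1).
rewrite LpnormE0// unlock; apply: gt0_ler_poweR; first by rewrite invr_ge0 ltW.
- by rewrite in_itv/= leey andbT integral_ge0// => x _; rewrite lee_fin powR_ge0.
- by rewrite in_itv/= leey andbT integral_ge0// => x _; rewrite poweR_ge0.
apply: ge0_le_integral => //.
- by move=> x _; rewrite lee_fin powR_ge0.
- by apply/measurable_EFinP/measurable_modulus_powR/scalar_mfunD.
- apply: (measurableT_comp (measurable_poweR _)); apply: measurableT_comp => //.
  by apply/measurable_EFinP/measurable_funD; exact: measurable_modulus.
- move=> x _ /=; rewrite lee_fin; apply: le_powR; [exact: ltW|exact: modulus_ge0|].
  by rewrite ger0_norm ?addr_ge0 ?modulus_ge0// modulusD.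
Qed.

Lemma LpfunD p f g : 1 <= p -> Lpfun P k p%:E f -> Lpfun P k p%:E g ->
  Lpfun P k p%:E (f + g).
Proof.
move=> p1 [mf nf] [mg ng]; split; first exact: scalar_mfunD.
by apply: le_lt_trans (LpnormD p1 mf mg) _; rewrite lte_add_pinfty.
Qed.

Lemma nrmD p f g : 1 <= p -> Lpfun P k p%:E f -> Lpfun P k p%:E g ->
  nrm p (f + g) <= nrm p f + nrm p g.
Proof.
move=> p1 Lf Lg; have p0 : 0 < p by exact: lt_le_trans p1.
have := LpnormD p1 (Lpfun_mfun Lf) (Lpfun_mfun Lg).
by rewrite (LpnormE p0 Lf) (LpnormE p0 Lg) (LpnormE p0 (LpfunD p1 Lf Lg)) -EFinD lee_fin.
Qed.

Lemma LpfunN p f : 0 < p -> Lpfun P k p%:E f -> Lpfun P k p%:E (- f).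
Proof.
by move=> p0 Lf; rewrite -scaleN1r; apply: LpfunZ => //; exact/scalarsN/scalars1.
Qed.

Lemma nrmN p f : nrm p (- f) = nrm p f.
Proof. by rewrite /nrm; under eq_Rintegral do rewrite modulusN. Qed.

Lemma LpfunB p f g : 1 <= p -> Lpfun P k p%:E f -> Lpfun P k p%:E g ->
  Lpfun P k p%:E (f - g).
Proof. by move=> p1 Lf Lg; apply: LpfunD => //; apply: LpfunN => //; exact: lt_le_trans p1. Qed.

Lemma nrmB p f g : 1 <= p -> Lpfun P k p%:E f -> Lpfun P k p%:E g ->
  nrm p (f - g) <= nrm p f + nrm p g.
Proof.
move=> p1 Lf Lg; rewrite -(nrmN p g); apply: nrmD => //; apply: LpfunN => //.
exact: lt_le_trans p1.
Qed.

Lemma Lpfun_sum p (I : Type) (s : seq I) (Q : pred I) (F : I -> cfun T R) : 1 <= p ->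
  (forall i, Q i -> Lpfun P k p%:E (F i)) -> Lpfun P k p%:E (\sum_(i <- s | Q i) F i).
Proof.
move=> p1 h; elim/big_rec: _ => [|i f Qi IH]; first by apply: Lpfun0; exact: lt_le_trans p1.
by apply: LpfunD => //; exact: h.
Qed.

Lemma nrm_sum p (I : Type) (s : seq I) (Q : pred I) (F : I -> cfun T R) : 1 <= p ->
  (forall i, Q i -> Lpfun P k p%:E (F i)) ->
  nrm p (\sum_(i <- s | Q i) F i) <= \sum_(i <- s | Q i) nrm p (F i).
Proof.
move=> p1 h; elim: s => [|i s IH].
  by rewrite !big_nil nrm0//; exact: lt_le_trans p1.
rewrite !big_cons; case: ifP => // Qi.
apply: le_trans (nrmD p1 (h _ Qi) (Lpfun_sum _ p1 h)) _.
by rewrite lerD2l.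
Qed.

Lemma hoelder_modulus p f (h : T -> R) : 1 < p -> Lpfun P k p%:E f ->
  measurable_fun setT h -> (forall x, 0 <= h x) ->
  ri (fun x => h x `^ (p / (p - 1))) ->
  ri (fun x => modulus f x * h x) /\
  \int[P]_x (modulus f x * h x) <=
    nrm p f * (\int[P]_x (h x `^ (p / (p - 1)))) `^ (1 - p^-1).
Proof.
move=> p1 Lf mh h0 ih; have p0 : 0 < p by rewrite (lt_trans _ p1).
have p10 : 0 < p - 1 by rewrite subr_gt0.
set q := p / (p - 1); have q0 : 0 < q by rewrite divr_gt0.
have qi : q^-1 = 1 - p^-1 by rewrite /q; field; rewrite !gt_eqF.
have mf := measurable_modulus (Lpfun_mfun Lf).
have := hoelder P mf mh p0 q0; rewrite qi addrC subrK => /(_ erefl).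
have -> : ('N[P]_p%:E[(fun x => (modulus f x)%:E)] = (nrm p f)%:E)%E.
  by rewrite -(LpnormE p0 Lf).
have -> : ('N[P]_q%:E[(fun x => (h x)%:E)] =
    ((\int[P]_x (h x `^ q)) `^ q^-1)%:E)%E.
  rewrite unlock -poweR_EFin /Rintegral fineK; last exact: integrable_fin_num ih.
  have -> // : (\int[P]_x (`|(h x)%:E| `^ q) = \int[P]_x (h x `^ q)%:E)%E.
  by apply: eq_integral => x _ /=; rewrite ger0_norm.
rewrite Lnorm1 -EFinM qi => hh.
have ifh : ri (fun x => modulus f x * h x).
  apply/integrableP; split; first by apply/measurable_EFinP; exact: measurable_funM.
  by apply: le_lt_trans hh _; exact: ltry.
split=> //; rewrite -lee_fin; apply: le_trans hh; rewrite /Rintegral fineK; last first.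
  exact: integrable_fin_num ifh.
rewrite le_eqVlt; apply/orP; left; apply/eqP; apply: eq_integral => x _ /=.
by rewrite ger0_norm ?mulr_ge0 ?modulus_ge0.
Qed.

End lp_functions.

(** * Inner product and existence of orthogonal projections *)

Section inner_product.
Context d {T : measurableType d} {R : realType}.
Variables (P : probability T R) (k : scalar_kind).
Implicit Types (f g h : cfun T R) (c : R[i]).
Notation ri := (fun f : T -> R => P.-integrable setT (EFin \o f)).
Notation normc := ComplexField.Normc.normc.
Notation L2 := (Lpfun P k 2%:E).
Notation inner := (inner P).

Let two0 : 0 < 2 :> R. Proof. by []. Qed.

Let two1 : 1 <= 2 :> R. Proof. by rewrite ler1n. Qed.

Lemma measurable_ReMJ f g : scalar_mfun k f -> scalar_mfun k g ->
  measurable_fun setT (fun x => complex.Re (f x * conjc (g x))).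
Proof.
move=> [_ rf imf] [_ rg img].
rewrite (_ : (fun x => _) = fun x => complex.Re (f x) * complex.Re (g x) +
     complex.Im (f x) * complex.Im (g x)).
  by apply: measurable_funD; apply: measurable_funM.
by apply/funext => x; case: (f x) (g x) => a b [? ?] /=; rewrite mulrN opprK.
Qed.

Lemma measurable_ImMJ f g : scalar_mfun k f -> scalar_mfun k g ->
  measurable_fun setT (fun x => complex.Im (f x * conjc (g x))).
Proof.
move=> [_ rf imf] [_ rg img].
rewrite (_ : (fun x => _) = fun x => complex.Im (f x) * complex.Re (g x) -
     complex.Re (f x) * complex.Im (g x)).
  by apply: measurable_funB; apply: measurable_funM.
by apply/funext => x; case: (f x) (g x) => a b [? ?] /=; rewrite mulrN addrC.
Qed.

Lemma abs_ReMJ f g x : `|complex.Re (f x * conjc (g x))| <= modulus f x * modulus g x.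
Proof.
apply: le_trans (abs_Re_le _) _.
by rewrite ComplexField.Normc.normcM normc_conj.
Qed.

Lemma abs_ImMJ f g x : `|complex.Im (f x * conjc (g x))| <= modulus f x * modulus g x.
Proof.
apply: le_trans (abs_Im_le _) _.
by rewrite ComplexField.Normc.normcM normc_conj.
Qed.

Lemma ri_modulusM f g : L2 f -> L2 g -> ri (fun x => modulus f x * modulus g x).
Proof.
move=> Lf Lg.
apply: ri_le (riD (Lpfun_ri two0 Lf) (Lpfun_ri two0 Lg)).
  apply: measurable_funM; apply: (@measurable_modulus _ _ _ k); first by case: Lf.
  by case: Lg.
move=> x; rewrite ger0_norm ?mulr_ge0 ?modulus_ge0//.
rewrite !powR_mulrn ?modulus_ge0//.
have := sqr_ge0 (modulus f x - modulus g x).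
have := modulus_ge0 f x; have := modulus_ge0 g x.
set a := modulus f x; set b := modulus g x; nra.
Qed.

Lemma ri_ReMJ f g : L2 f -> L2 g -> ri (fun x => complex.Re (f x * conjc (g x))).
Proof.
move=> Lf Lg; apply: ri_le (ri_modulusM Lf Lg); last by move=> x; exact: abs_ReMJ.
by apply: measurable_ReMJ; [case: Lf|case: Lg].
Qed.

Lemma ri_ImMJ f g : L2 f -> L2 g -> ri (fun x => complex.Im (f x * conjc (g x))).
Proof.
move=> Lf Lg; apply: ri_le (ri_modulusM Lf Lg); last by move=> x; exact: abs_ImMJ.
by apply: measurable_ImMJ; [case: Lf|case: Lg].
Qed.

Lemma Re_inner f g : complex.Re (inner f g) = \int[P]_x complex.Re (f x * conjc (g x)).
Proof. by []. Qed.

Lemma innerDl f g h : L2 f -> L2 g -> L2 h -> inner (f + g) h = inner f h + inner g h.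
Proof.
move=> Lf Lg Lh; rewrite /inner; apply/eqP; rewrite eq_complex/=; apply/andP; split; apply/eqP.
  rewrite -rintD; [|exact: ri_ReMJ|exact: ri_ReMJ].
  apply: eq_Rintegral => x _; rewrite [(f + g) x]/(f x + g x).
  by case: (f x) (g x) (h x) => ? ? [? ?] [? ?] /=; ring.
rewrite -rintD; [|exact: ri_ImMJ|exact: ri_ImMJ].
apply: eq_Rintegral => x _; rewrite [(f + g) x]/(f x + g x).
by case: (f x) (g x) (h x) => ? ? [? ?] [? ?] /=; ring.
Qed.

Lemma innerZl c f h : L2 f -> L2 h -> inner (c *: f) h = c * inner f h.
Proof.
move=> Lf Lh; rewrite /inner; case: c => a b.
apply/eqP; rewrite eq_complex/=; apply/andP; split; apply/eqP.
  rewrite -mulNr -!rintZ; [|exact: ri_ImMJ|exact: ri_ReMJ].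
  rewrite -rintD; [|by apply: riZ; exact: ri_ReMJ|by apply: riZ; exact: ri_ImMJ].
  apply: eq_Rintegral => x _.
  rewrite [(_ *: f) x]/((a +i* b)%C * f x).
  by case: (f x) (h x) => ? ? [? ?] /=; ring.
rewrite -!rintZ; [|exact: ri_ReMJ|exact: ri_ImMJ].
rewrite -rintD; [|by apply: riZ; exact: ri_ImMJ|by apply: riZ; exact: ri_ReMJ].
apply: eq_Rintegral => x _.
rewrite [(_ *: f) x]/((a +i* b)%C * f x).
by case: (f x) (h x) => ? ? [? ?] /=; ring.
Qed.

Lemma inner_conj f g : L2 f -> L2 g -> inner g f = conjc (inner f g).
Proof.
move=> Lf Lg; rewrite /inner; apply/eqP; rewrite eq_complex/=; apply/andP; split; apply/eqP.
  apply: eq_Rintegral => x _; case: (f x) (g x) => ? ? [? ?] /=; ring.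
rewrite -mulN1r -rintZ; last exact: ri_ImMJ.
apply: eq_Rintegral => x _; case: (f x) (g x) => ? ? [? ?] /=; ring.
Qed.

Lemma innerNl f h : L2 f -> L2 h -> inner (- f) h = - inner f h.
Proof. by move=> Lf Lh; rewrite -scaleN1r innerZl// mulN1r. Qed.

Lemma innerBl f g h : L2 f -> L2 g -> L2 h -> inner (f - g) h = inner f h - inner g h.
Proof. by move=> Lf Lg Lh; rewrite innerDl ?innerNl//; exact: LpfunN. Qed.

Lemma innerDr f g h : L2 f -> L2 g -> L2 h -> inner h (f + g) = inner h f + inner h g.
Proof.
move=> Lf Lg Lh; rewrite (inner_conj (LpfunD two1 Lf Lg) Lh).
by rewrite (inner_conj Lf Lh) (inner_conj Lg Lh) innerDl// rmorphD.
Qed.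

Lemma innerZr c f h : scalars k c -> L2 f -> L2 h -> inner h (c *: f) = conjc c * inner h f.
Proof.
move=> kc Lf Lh; rewrite (inner_conj (LpfunZ two0 kc Lf) Lh).
by rewrite (inner_conj Lf Lh) innerZl// rmorphM.
Qed.

Lemma inner_self f : L2 f -> inner f f = ((nrm P 2 f `^ 2)%:C)%C.
Proof.
move=> Lf; rewrite nrm_pow// /inner; apply/eqP; rewrite eq_complex/=; apply/andP; split; apply/eqP.
  by apply: eq_Rintegral => x _; exact: Re_mulJ.
under eq_Rintegral do rewrite Im_mulJ.
by rewrite Rintegral_cst// mul0r.
Qed.

Lemma nrm2_eq0 f : L2 f -> nrm P 2 f = 0 -> \forall x \ae P, f x = 0.
Proof.
move=> Lf n0; have : \int[P]_x (modulus f x `^ 2) = 0.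
  by rewrite -nrm_pow// n0 powR0.
move/(rint0_ae (fun x => powR_ge0 _ _) (Lpfun_ri two0 Lf)).
by apply: filterS => x /powR_eq0_eq0/modulus_eq0.
Qed.

Lemma inner_ae f g h : scalar_mfun k f -> scalar_mfun k g -> scalar_mfun k h ->
  (\forall x \ae P, f x = g x) -> inner f h = inner g h.
Proof.
move=> mf mg mh fg; rewrite /inner; congr (Complex _ _); apply: rint_eq_ae;
  try exact: measurable_ReMJ; try exact: measurable_ImMJ.
  by apply: filterS fg => x ->.
by apply: filterS fg => x ->.
Qed.

Lemma inner0l h : inner 0 h = 0.
Proof.
rewrite /inner; apply/eqP; rewrite eq_complex/=; apply/andP; split; apply/eqP.
  under eq_Rintegral do rewrite mul0r.
  by rewrite Rintegral_cst// mul0r.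
under eq_Rintegral do rewrite mul0r.
by rewrite Rintegral_cst// mul0r.
Qed.

Lemma inner_scalar f g : L2 f -> L2 g -> scalars k (inner f g).
Proof.
move=> [[+ _ _] _] [[+ _ _] _]; case: k => //= rf rg.
under eq_Rintegral => x _.
  rewrite (_ : complex.Im _ = 0); last first.
    by move: (rf x) (rg x); case: (f x) (g x) => ? ? [? ?] /= -> ->; ring.
  over.
by rewrite Rintegral_cst// mul0r.
Qed.

Lemma inner_suml (I : Type) (s : seq I) (Q : pred I) (F : I -> cfun T R) h :
  (forall i, Q i -> L2 (F i)) -> L2 h ->
  inner (\sum_(i <- s | Q i) F i) h = \sum_(i <- s | Q i) inner (F i) h.
Proof.
move=> LF Lh; elim: s => [|i s IH]; first by rewrite !big_nil inner0l.
rewrite !big_cons; case: ifP => // Qi.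
by rewrite innerDl ?IH//; [exact: LF|exact: Lpfun_sum].
Qed.

Definition has_proj (W : set (cfun T R)) :=
  forall f, L2 f -> exists2 g, W g & forall h, W h -> inner (f - g) h = 0.

(** One Gram-Schmidt step. The component e' = e - e0 is orthogonal to W, and the projection of f
    onto the larger space adds c0 e' with c0 = <r, e'> / <e', e'>. Since functions are not
    identified up to null sets, e' may vanish almost everywhere without e lying in W; the projection
    onto W then serves unchanged. *)
Lemma has_proj_extend (W W' : set (cfun T R)) e :
  W `<=` L2 -> (forall g h, W g -> W h -> W (g + h)) ->
  (forall c g, scalars k c -> W g -> W (c *: g)) -> L2 e ->
  (forall f, W' f <-> exists (c : R[i]) (g : cfun T R), [/\ scalars k c, W g & f = g + c *: e]) ->
  has_proj W -> has_proj W'.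
Proof.
move=> WL WD WZ Le W'E hW f Lf.
have [g0 Wg0 og0] := hW _ Lf; have [e0 We0 oe0] := hW _ Le.
have Lg0 := WL _ Wg0; have Le0 := WL _ We0.
pose e' := e - e0; have Le' : L2 e' by exact: LpfunB.
have We e1 : W e1 -> inner e1 e' = 0.
  by move=> We1; rewrite (inner_conj Le')// ?oe0 ?rmorph0//; exact: WL.
pose r := f - g0; have Lr : L2 r by exact: LpfunB.
have nn : inner e' e' = ((nrm P 2 e' `^ 2)%:C)%C by exact: inner_self.
have [n0|n0] := eqVneq (nrm P 2 e') 0.
  exists g0.
    by apply/W'E; exists 0, g0; split => //; [exact: scalars0|rewrite scale0r addr0].
  move=> h /W'E [c [g [kc Wg ->]]].
  have -> : g + c *: e = (g + c *: e0) + c *: e'.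
    by rewrite -addrA -scalerDr /e' [e0 + _]addrC subrK.
  have Wg' : W (g + c *: e0) by apply: WD => //; exact: WZ.
  rewrite innerDr//; [|exact: WL|exact: LpfunZ].
  rewrite og0// add0r innerZr// inner_conj// (inner_ae (g := 0)).
  - by rewrite inner0l rmorph0 mulr0.
  - by case: Le'.
  - exact: scalar_mfun0.
  - by case: Lr.
  - exact: nrm2_eq0.
have nn0 : inner e' e' != 0.
  by rewrite nn eq_complex/= eqxx andbT powR_eq0 negb_and n0.
pose c0 := inner r e' / inner e' e'.
have kc0 : scalars k c0 by apply: scalarsM; [exact: inner_scalar|exact/scalarsV/inner_scalar].
exists (g0 + c0 *: e').
  apply/W'E; exists c0, (g0 + (- c0) *: e0); split => //.
    by apply: WD => //; apply: WZ => //; exact: scalarsN.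
  by rewrite -addrA /e' scalerBr scaleNr [- _ + _]addrC.
move=> h /W'E [c [g [kc Wg ->]]].
have -> : g + c *: e = (g + c *: e0) + c *: e'.
  by rewrite -addrA -scalerDr /e' [e0 + _]addrC subrK.
have Wg' : W (g + c *: e0) by apply: WD => //; exact: WZ.
have LWg := WL _ Wg'.
have Lc : L2 (c0 *: e') by exact: LpfunZ.
have Lce : L2 (c *: e') by exact: LpfunZ.
rewrite opprD addrA -/r (innerDr LWg Lce (LpfunB two1 Lr Lc)).
rewrite (innerBl Lr Lc LWg) (innerBl Lr Lc Lce) (og0 _ Wg' : inner r _ = 0).
rewrite sub0r (innerZl _ Le' LWg) (inner_conj LWg Le') We// rmorph0 mulr0 oppr0 add0r.
rewrite (innerZr kc Le' Lr) (innerZl _ Le' Lce) (innerZr kc Le' Le').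
by rewrite /c0 mulrCA divfK// subrr.
Qed.

Lemma has_proj_span (W : set (cfun T R)) (m : nat) (b : 'I_m -> cfun T R) :
  W `<=` L2 -> (forall g h, W g -> W h -> W (g + h)) ->
  (forall c g, scalars k c -> W g -> W (c *: g)) -> (forall i, L2 (b i)) ->
  has_proj W ->
  has_proj [set f | exists (c : 'I_m -> R[i]) (g : cfun T R), [/\ forall i, scalars k (c i), W g &
                     f = g + \sum_(i < m) c i *: b i]].
Proof.
move=> WL WD WZ; elim: m b => [|m IH] b Lb hW.
  move=> f /hW[g Wg og]; exists g.
    by exists (fun _ => 0), g; split => // [[]|]; rewrite ?big_ord0 ?addr0.
  by move=> h [c [g' [_ Wg' ->]]]; rewrite big_ord0 addr0; exact: og.
pose b' (i : 'I_m) := b (widen_ord (leqnSn m) i).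
have := IH b' (fun i => Lb _) hW.
set W1 := [set f | _] => hW1.
apply: (@has_proj_extend W1 _ (b ord_max)) => //.
- move=> f [c [g [kc Wg ->]]]; apply: LpfunD => //; first exact: WL.
  by apply: Lpfun_sum => // i _; apply: LpfunZ => //; exact: Lb.
- move=> f f' [c [g [kc Wg ->]]] [c' [g' [kc' Wg' ->]]].
  exists (fun i => c i + c' i), (g + g'); split; first by move=> i; exact: scalarsD.
    exact: WD.
  rewrite addrACA -big_split; congr (_ + _).
  by apply: eq_bigr => i _; rewrite scalerDl.
- move=> a f ka [c [g [kc Wg ->]]].
  exists (fun i => a * c i), (a *: g); split; first by move=> i; exact: scalarsM.
    exact: WZ.
  rewrite scalerDr scaler_sumr; congr (_ + _).
  by apply: eq_bigr => i _; rewrite scalerA.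
- move=> f; split.
    move=> [c [g [kc Wg ->]]]; rewrite big_ord_recr/= addrA.
    exists (c ord_max), (g + \sum_(i < m) c (widen_ord (leqnSn m) i) *: b' i).
    split => //; exists (fun i => c (widen_ord (leqnSn m) i)), g; split => //.
  move=> [a [_ [ka [c [g [kc Wg ->]]] ->]]].
  exists (fun i : 'I_m.+1 => if unlift ord_max i is Some j then c j else a), g.
  split => //; first by move=> i; case: (unlift _ _).
  rewrite big_ord_recr/= unlift_none addrA; congr (_ + _ + _); apply: eq_bigr => i _.
  have wl : widen_ord (leqnSn m) i = lift ord_max i.
    by apply: ord_inj; rewrite lift_max.
  by rewrite /b' wl liftK.
Qed.

End inner_product.

(** * Atoms and orthogonal projections *)

Section atom_tree.
Context d {T : measurableType d} {R : realType}.
Variables (P : probability T R) (F : nat -> set (set T)).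
Hypothesis Fbin : binary_filtration P F.
Notation mes A := (fine (P A)).
Notation at_ n := (is_atom (F n)).

Lemma atom_nonempty n A : at_ n A -> A !=set0. Proof. by case. Qed.

Lemma filtration_step : exists A A1 A2 : nat -> set T, forall n,
  [/\ at_ n (A n),
      [/\ measurable (A1 n), measurable (A2 n), A1 n `&` A2 n = set0 &
          A1 n `|` A2 n = A n],
      F n.+1 = <<s F n `|` [set A1 n; A2 n] >>,
      at_ n.+1 (A1 n) /\ at_ n.+1 (A2 n) &
      (0 < P (A1 n))%E /\ (P (A1 n) <= P (A2 n))%E].
Proof.
have [_ h] := Fbin.
have /choice[A /= hA] := h; have /choice[A1 /= hA1] := hA; have /choice[A2 hA2] := hA1.
by exists A, A1, A2.
Qed.

Definition split_atom : nat -> set T := sval (cid filtration_step).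
Let step1 := svalP (cid filtration_step).
Definition small_half : nat -> set T := sval (cid step1).
Let step2 := svalP (cid step1).
Definition large_half : nat -> set T := sval (cid step2).

Lemma splitP n : [/\ at_ n (split_atom n),
      [/\ measurable (small_half n), measurable (large_half n),
          small_half n `&` large_half n = set0 &
          small_half n `|` large_half n = split_atom n],
      F n.+1 = <<s F n `|` [set small_half n; large_half n] >>,
      at_ n.+1 (small_half n) /\ at_ n.+1 (large_half n) &
      (0 < P (small_half n))%E /\ (P (small_half n) <= P (large_half n))%E].
Proof. exact: (svalP (cid step2)). Qed.

Lemma setT_nonempty : [set: T] !=set0.
Proof.
apply/set0P/eqP => T0; have := probability_setT P.
by rewrite T0 measure0 => /eqP; rewrite eq_sym onee_eq0.
Qed.

Lemma filtration_sigma n : sigma_algebra setT (F n).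
Proof.
case: n => [|n]; last by have [_ _ -> _ _] := splitP n; exact: smallest_sigma_algebra.
have [-> _] := Fbin; split; first by left.
- by move=> A [->|->]; [right; rewrite setD0|left; rewrite setDv].
- move=> A hA; have [[n An]|/forallNP nA] := pselect (exists n, A n = setT).
    by right; apply/seteqP; split => // x _; exists n => //; rewrite An.
  left; apply/seteqP; split => // x [n _]; case: (hA n) => [->//|/nA[]].
Qed.

Lemma filtrationI n A B : F n A -> F n B -> F n (A `&` B).
Proof.
move=> FA FB; have /sigma_algebraP h := filtration_sigma n.
have [] := h (fun A _ => @subsetT _ A).
by move=> _ _ _ hI; exact: hI.
Qed.

Lemma atom_separates n D B : at_ n D -> F n B -> D `<=` B \/ D `&` B = set0.
Proof.
move=> [FD _ minD] FB; have [|->|e] := minD (D `&` B) (filtrationI FD FB).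
- exact: subIsetl.
- by right.
- by left => x; rewrite -e => -[].
Qed.

Lemma atom_disjoint n D D' x : at_ n D -> at_ n D' -> D x -> D' x -> D = D'.
Proof.
have sub E E' : at_ n E -> at_ n E' -> E x -> E' x -> E `<=` E'.
  move=> aE [FE' _ _] Ex E'x; have [//|e] := atom_separates aE FE'.
  by have : (E `&` E') x by []; rewrite e.
by move=> aD aD' Dx D'x; apply/seteqP; split; apply: sub.
Qed.

Lemma atom0 A : at_ 0 A <-> A = setT.
Proof.
have [F0 _] := Fbin; rewrite /is_atom F0; split.
  by move=> [[->|->//] [x //]].
move=> ->; split; [by right|exact: setT_nonempty|].
by move=> B [->|->] _; [left|right].
Qed.

Lemma filtrationS n : F n `<=` F n.+1.
Proof.
by have [_ _ -> _ _] := splitP n => B FB; apply: sub_gen_smallest; left.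
Qed.

Lemma filtration_le i j : (i <= j)%N -> F i `<=` F j.
Proof.
elim: j => [|j IH]; first by rewrite leqn0 => /eqP ->.
rewrite leq_eqVlt => /predU1P[->//|]; rewrite ltnS => /IH h.
exact: subset_trans h (@filtrationS j).
Qed.

(** The sets that contain D or are disjoint from it form a sigma-algebra. It contains F n and both
    halves of the split atom, hence F (n+1), so no set of F (n+1) cuts D. *)
Lemma atomS_old n D : at_ n D -> D <> split_atom n -> at_ n.+1 D.
Proof.
move=> aD DA; have [aA [m1 m2 disj U] FS _ _] := splitP n.
have sep B : F n.+1 B -> D `<=` B \/ D `&` B = set0.
  rewrite FS.
  pose G := [set B : set T | D `<=` B \/ D `&` B = set0].
  suff h : <<s F n `|` [set small_half n; large_half n] >> `<=` G by exact: h.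
  apply: smallest_sub; last first.
    move=> C [FC|]; first exact: atom_separates aD FC.
    have dA : D `&` split_atom n = set0.
      apply/seteqP; split => // x [Dx Ax]; apply: DA.
      exact: atom_disjoint aD aA Dx Ax.
    case=> ->; right; apply/seteqP; split => // x [Dx h].
      by rewrite -dA -U; split => //; left.
    by rewrite -dA -U; split => //; right.
  split; first by right; rewrite setI0.
    move=> C [DC|DC]; [right|left].
      by rewrite setTD; apply/seteqP; split => // x [/DC].
    by move=> x Dx; rewrite setTD => Cx; have : (D `&` C) x by []; rewrite DC.
  move=> C hC; have [[i Di]|/forallNP nD] := pselect (exists i, D `<=` C i).
    by left => x /Di; exists i.
  right; apply/seteqP; split => // x [Dx [i _ Cx]].
  have [/nD//|e] := hC i; by rewrite -e.
split; [by apply: filtrationS; case: aD|exact: atom_nonempty aD|].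
move=> B FB BD; have [DB|DB] := sep _ FB.
  by right; apply/seteqP.
by left; rewrite -DB; apply/esym/setIidPr.
Qed.

Lemma atom_cover n x : exists2 E, at_ n E & E x.
Proof.
elim: n => [|n [E aE Ex]]; first by exists setT => //; exact/atom0.
have [e|ne] := pselect (E = split_atom n); last by exists E => //; exact: atomS_old.
have [_ [_ _ _ U] _ [a1 a2] _] := splitP n.
by move: Ex; rewrite e -U => -[]; [exists (small_half n)|exists (large_half n)].
Qed.

(** Pick a point of the atom and the atom of F n around it. If the latter is not split it survives
    to step n+1, otherwise the point lies in one of the halves; atoms with a common point
    coincide. *)
Lemma atomS n A : at_ n.+1 A <->
  (at_ n A /\ A <> split_atom n) \/ A = small_half n \/ A = large_half n.
Proof.
have [aA [m1 m2 disj U] _ [a1 a2] _] := splitP n.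
split; last by case=> [[aA' nA]|[->|->]] //; exact: atomS_old.
move=> aD; have [_ [x Dx] _] := aD; have [E aE Ex] := atom_cover n x.
have [e|ne] := pselect (E = split_atom n); last first.
  by rewrite (atom_disjoint aD (atomS_old aE ne) Dx Ex); left.
by right; move: Ex; rewrite e -U => -[] Ex; [left|right]; apply: (atom_disjoint aD _ Dx Ex).
Qed.

Lemma atom_measurable n A : at_ n A -> measurable A.
Proof.
elim: n A => [A /atom0 ->//|n IH A /atomS].
have [_ [m1 m2 _ _] _ _ _] := splitP n.
by case=> [[/IH]|[->|->]].
Qed.

Lemma atom_pos n A : at_ n A -> 0 < mes A.
Proof.
move=> aA; have mA := atom_measurable aA; rewrite -lte_fin finePK//.
elim: n A aA {mA} => [A /atom0 ->|n IH A /atomS]; first by rewrite probability_setT lte_fin.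
have [_ _ _ _ [p1 p12]] := splitP n.
by case=> [[/IH]|[->|->]]//; exact: lt_le_trans p12.
Qed.

Lemma atom_refine i j D E : (i <= j)%N -> at_ i E -> at_ j D ->
  D `<=` E \/ D `&` E = set0.
Proof. by move=> ij [FE _ _] aD; apply: atom_separates aD (filtration_le ij FE). Qed.

Lemma half_measurable n : measurable (small_half n) /\ measurable (large_half n).
Proof. by have [_ []] := splitP n. Qed.

Lemma halves_disjoint n : small_half n `&` large_half n = set0.
Proof. by have [_ []] := splitP n. Qed.

Lemma halvesU n : small_half n `|` large_half n = split_atom n.
Proof. by have [_ []] := splitP n. Qed.

Lemma small_half_atom n : at_ n.+1 (small_half n).
Proof. by have [_ _ _ []] := splitP n. Qed.

Lemma large_half_atom n : at_ n.+1 (large_half n).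
Proof. by have [_ _ _ []] := splitP n. Qed.

Lemma split_atom_atom n : at_ n (split_atom n).
Proof. by have [] := splitP n. Qed.

(** The index is shifted by one against [split_atom]: the nonempty halves at step j are atoms of F
    j, so step j is the splitting seen by Q_j. Taking the whole space as first half at step 0 lets
    Q_0 be treated like the other increments. *)
Definition half1 (j : nat) : set T := if j is j'.+1 then small_half j' else setT.

Definition half2 (j : nat) : set T := if j is j'.+1 then large_half j' else set0.

Lemma halves_tree : split_tree P half1 half2.
Proof.
split.
- by case=> [|j] //=; have [] := half_measurable j.
- by case=> [|j] //=; have [] := half_measurable j.
- by case=> [|j] /=; [rewrite probability_setT|exact: atom_pos (small_half_atom j)].
- by case=> [|j] /=; [rewrite setI0|exact: halves_disjoint].
- case=> [|j] // _ /=; have [m1 m2] := half_measurable j.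
  have [_ _ _ _ [_ le]] := splitP j.
  by rewrite -lee_fin !finePK.
- by [].
- move=> i [|j] // ij /=; rewrite halvesU.
  case: i ij => [|i] /= ij; first by constructor 1.
  have aD := split_atom_atom j; rewrite ltnS in ij.
  rewrite halvesU; have [h|h1] := atom_refine ij (small_half_atom i) aD.
    by constructor 1.
  have [h|h2] := atom_refine ij (large_half_atom i) aD.
    by constructor 2.
  by constructor 3; rewrite -halvesU setIUl !(setIC _ (split_atom j)) h1 h2 setU0.
Qed.

End atom_tree.

Section piecewise_functions.
Context d {T : measurableType d} {R : realType}.
Variables (P : probability T R) (k : scalar_kind).
Variables (F : nat -> set (set T)) (S : set (cfun T R)).
Hypothesis Fbin : binary_filtration P F.
Hypothesis Sfin : fin_dim_space k S.
Implicit Types (f g h : cfun T R) (c : R[i]) (A : set T).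
Notation mes A := (fine (P A)).
Notation ri := (fun f : T -> R => P.-integrable setT (EFin \o f)).
Notation normc := ComplexField.Normc.normc.
Notation at_ n := (is_atom (F n)).
Notation pw := (piecewise F S).

Lemma cfunBE f g x : (f - g) x = f x - g x. Proof. by []. Qed.

Lemma cfunZE c f x : (c *: f) x = c * f x. Proof. by []. Qed.

Lemma S_mfun f : S f -> scalar_mfun k f. Proof. by case: Sfin => h _; exact: h. Qed.

Lemma S_zero : S 0.
Proof.
have [_ [m [b ->]]] := Sfin; exists (fun=> 0); split; first by move=> i; exact: scalars0.
by rewrite big1// => i _; rewrite scale0r.
Qed.

Lemma S_add f g : S f -> S g -> S (f + g).
Proof.
have [_ [m [b ->]]] := Sfin => -[c [kc ->]] [c' [kc' ->]].
exists (fun i => c i + c' i); split; first by move=> i; exact: scalarsD.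
by rewrite -big_split; apply: eq_bigr => i _; rewrite scalerDl.
Qed.

Lemma S_scale c f : scalars k c -> S f -> S (c *: f).
Proof.
move=> kc; have [_ [m [b ->]]] := Sfin => -[c' [kc' ->]].
exists (fun i => c * c' i); split; first by move=> i; exact: scalarsM.
by rewrite scaler_sumr; apply: eq_bigr => i _; rewrite scalerA.
Qed.

Lemma S_opp f : S f -> S (- f).
Proof. by move=> Sf; rewrite -scaleN1r; apply: S_scale => //; exact/scalarsN/scalars1. Qed.

Lemma cutoff_in A f x : A x -> cutoff A f x = f x.
Proof. by move=> Ax; rewrite /cutoff indicE mem_set// mulr1. Qed.

Lemma cutoff_out A f x : ~ A x -> cutoff A f x = 0.
Proof. by move=> Ax; rewrite /cutoff indicE memNset// mulr0. Qed.

Lemma cutoff_eq A f g : (forall x, A x -> f x = g x) <-> cutoff A f = cutoff A g.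
Proof.
split=> [h|h x Ax]; last by have := congr1 (@^~ x) h; rewrite !cutoff_in.
apply/funext => x; have [Ax|nAx] := pselect (A x); first by rewrite !cutoff_in ?h.
by rewrite !cutoff_out.
Qed.

Lemma cutoffT f : cutoff setT f = f.
Proof. by apply/funext => x; rewrite cutoff_in. Qed.

Lemma pwP n f : pw n f <->
  forall A, at_ n A -> exists2 g, S g & forall x, A x -> f x = g x.
Proof.
by split=> h A aA; have [g Sg e] := h A aA; exists g => //; exact/cutoff_eq.
Qed.

Lemma pw_zero n : pw n 0.
Proof. by apply/pwP => A _; exists 0 => //; exact: S_zero. Qed.

Lemma pw_add n f g : pw n f -> pw n g -> pw n (f + g).
Proof.
move=> /pwP hf /pwP hg; apply/pwP => A aA.
have [f' Sf ef] := hf A aA; have [g' Sg eg] := hg A aA.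
exists (f' + g'); first exact: S_add.
by move=> x Ax; rewrite [LHS]/(f x + g x) ef ?eg.
Qed.

Lemma pw_scale n c f : scalars k c -> pw n f -> pw n (c *: f).
Proof.
move=> kc /pwP hf; apply/pwP => A aA; have [f' Sf ef] := hf A aA.
exists (c *: f'); first exact: S_scale.
by move=> x Ax; rewrite [LHS]/(c * f x) ef.
Qed.

Lemma pw_opp n f : pw n f -> pw n (- f).
Proof. by move=> h; rewrite -scaleN1r; apply: pw_scale => //; exact/scalarsN/scalars1. Qed.

Lemma pw_sub n f g : pw n f -> pw n g -> pw n (f - g).
Proof. by move=> hf hg; apply: pw_add => //; exact: pw_opp. Qed.

Lemma pw_sum n (I : Type) (s : seq I) (Q : pred I) (f : I -> cfun T R) :
  (forall i, Q i -> pw n (f i)) -> pw n (\sum_(i <- s | Q i) f i).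
Proof.
move=> h; elim/big_rec: _ => [|i g Qi IH]; first exact: pw_zero.
by apply: pw_add => //; exact: h.
Qed.

Lemma pw_cutoff n A v : at_ n A -> S v -> pw n (cutoff A v).
Proof.
move=> aA Sv; apply/pwP => D aD.
have [e|ne] := pselect (A = D).
  by rewrite e; exists v => // x Dx; rewrite cutoff_in.
exists 0; first exact: S_zero.
by move=> x Dx; rewrite cutoff_out// => Ax; apply: ne; exact: (atom_disjoint Fbin aA aD Ax Dx).
Qed.

Lemma pw_le n m : (n <= m)%N -> pw n `<=` pw m.
Proof.
move=> nm f /pwP hf; apply/pwP => D aD; have [_ [x Dx] _] := aD.
have [A aA Ax] := atom_cover Fbin n x.
have [DA|e] := atom_refine Fbin nm aA aD; last by have : (D `&` A) x by []; rewrite e.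
by have [g Sg eg] := hf A aA; exists g => // y /DA; exact: eg.
Qed.

Lemma pw_S f : S f -> pw 0 f.
Proof. by move=> Sf; apply/pwP => A _; exists f. Qed.

Lemma pw0E f : pw 0 f -> S f.
Proof.
move/pwP/(_ setT ((atom0 Fbin setT).2 erefl)) => [g Sg e].
by rewrite (_ : f = g)//; apply/funext => x; exact: e.
Qed.

Lemma S_basis : exists (m : nat) (b : 'I_m -> cfun T R), (forall i, S (b i)) /\
  S = [set f | exists c : 'I_m -> R[i], (forall i, scalars k (c i)) /\
                                         f = \sum_(i < m) c i *: b i].
Proof.
have [_ [m [b e]]] := Sfin; exists m, b; split => // i; rewrite e.
exists (fun j => (j == i)%:R); split.
  by move=> j; case: (j == i); [exact: scalars1|exact: scalars0].
rewrite (bigD1 i)//= eqxx scale1r big1 ?addr0// => j /negPf ->.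
by rewrite scale0r.
Qed.

(** An upper bound for the dimension of S: the chosen family is only known to span. *)
Definition sdim : nat := sval (cid S_basis).
Definition sbasis : 'I_sdim -> cfun T R := sval (cid (svalP (cid S_basis))).

Lemma sbasis_in i : S (sbasis i).
Proof. by have [h _] := svalP (cid (svalP (cid S_basis))); exact: h. Qed.

Lemma sbasisE f : S f <-> exists c : 'I_sdim -> R[i], (forall i, scalars k (c i)) /\
                                         f = \sum_(i < sdim) c i *: sbasis i.
Proof. by have [_ h] := svalP (cid (svalP (cid S_basis))); rewrite {1}h. Qed.

Lemma sum_cfunE (I : Type) (s : seq I) (Q : pred I) (G : I -> cfun T R) x :
  (\sum_(i <- s | Q i) G i) x = \sum_(i <- s | Q i) G i x.
Proof. by elim/big_rec2: _ => //= i y1 y2 _ <-. Qed.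

Lemma cutoff_sum A (m : nat) (c : 'I_m -> R[i]) (b : 'I_m -> cfun T R) :
  cutoff A (\sum_(i < m) c i *: b i) = \sum_(i < m) c i *: cutoff A (b i).
Proof.
apply/funext => x; rewrite /cutoff !sum_cfunE mulr_suml; apply: eq_bigr => i _.
by rewrite [LHS]mulrAC mulrC mulrCA.
Qed.

(** If f equals v on the small half and w on the large half, then subtracting (v - w) cut to the
    small half leaves a function that equals w on the whole split atom. So S_(n+1) arises from S_n
    by adding finitely many functions, which is what the induction for projections and boundedness
    needs. *)
Lemma pwS n : pw n.+1 = [set f | exists (c : 'I_sdim -> R[i]) (g : cfun T R),
    [/\ forall i, scalars k (c i), pw n g &
        f = g + \sum_(i < sdim) c i *: cutoff (small_half Fbin n) (sbasis i)]].
Proof.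
have [m1 m2] := half_measurable Fbin n.
have a1 := small_half_atom Fbin n; have a2 := large_half_atom Fbin n.
have disj := halves_disjoint Fbin n; have U := halvesU Fbin n.
have aA := split_atom_atom Fbin n.
apply/seteqP; split => f; last first.
  move=> [c [g [kc pg ->]]]; apply: pw_add; first exact: pw_le pg.
  apply: pw_sum => i _; apply: pw_scale => //; apply: pw_cutoff => //.
  exact: sbasis_in.
move=> /pwP pf.
have [v Sv ev] := pf _ a1; have [w Sw ew] := pf _ a2.
have Svw : S (v - w) by apply: S_add => //; exact: S_opp.
have [c [kc cE]] := (sbasisE _).1 Svw.
exists c, (f - cutoff (small_half Fbin n) (v - w)); split => //; last first.
  by rewrite -cutoff_sum -cE subrK.
apply/pwP => D aD; have [e|ne] := pselect (D = split_atom Fbin n).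
  exists w => // x; rewrite e -U cfunBE => -[x1|x2].
    by rewrite cutoff_in// cfunBE ev// opprB addrC subrK.
  rewrite cutoff_out ?subr0 ?ew// => x1.
  by have : (small_half Fbin n `&` large_half Fbin n) x by []; rewrite disj.
have [g Sg eg] := pf D (atomS_old aD ne); exists g => // x Dx.
rewrite cfunBE cutoff_out ?subr0 ?eg// => x1; apply: ne.
by apply: (atom_disjoint Fbin aD aA Dx); rewrite -U; left.
Qed.

(** Boundedness up to a null set, because the stability inequality controls only the L^oo norm. *)
Definition bfun f := scalar_mfun k f /\ exists M : R, \forall x \ae P, modulus f x <= M.

Lemma bfun0 : bfun 0.
Proof. by split; [exact: scalar_mfun0|exists 0; apply: aeW => x; rewrite modulus0]. Qed.

Lemma bfunD f g : bfun f -> bfun g -> bfun (f + g).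
Proof.
move=> [mf [M hM]] [mg [N hN]]; split; first exact: scalar_mfunD.
exists (M + N); apply: filterS2 hM hN => x h1 h2.
by apply: le_trans (modulusD _ _ _) _; exact: lerD.
Qed.

Lemma bfunZ c f : scalars k c -> bfun f -> bfun (c *: f).
Proof.
move=> kc [mf [M hM]]; split; first exact: scalar_mfunZ.
exists (normc c * M); apply: filterS hM => x h.
by rewrite modulusZ ler_wpM2l ?normc_ge0.
Qed.

Lemma bfun_sum (I : Type) (s : seq I) (Q : pred I) (G : I -> cfun T R) :
  (forall i, Q i -> bfun (G i)) -> bfun (\sum_(i <- s | Q i) G i).
Proof.
move=> h; elim/big_rec: _ => [|i f Qi IH]; first exact: bfun0.
by apply: bfunD => //; exact: h.
Qed.

Lemma bfun_cutoff A f : measurable A -> bfun f -> bfun (cutoff A f).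
Proof.
move=> mA [mf [M hM]]; split; first exact: scalar_mfun_cutoff.
exists M; apply: filterS hM => x h; apply: le_trans h.
by rewrite modulus_cutoff ler_piMr ?modulus_ge0// indicE; case: (_ \in _).
Qed.

Lemma bfun_ri f (p : R) : 0 < p -> bfun f -> ri (fun x => modulus f x `^ p).
Proof.
move=> p0 [mf [M hM]]; apply: (@ri_le_ae _ _ _ _ _ (fun=> `|M| `^ p)).
- exact: measurable_modulus_powR mf.
- by move=> x; exact: powR_ge0.
- by move=> x; exact: powR_ge0.
- exact: ri_cst.
- apply: filterS hM => x h; apply: le_powR; [exact: ltW|exact: modulus_ge0|].
  by apply: le_trans h _; exact: ler_norm.
Qed.

Lemma bfun_Lp f (p : R) : 0 < p -> bfun f -> Lpfun P k p%:E f.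
Proof. by move=> p0 bf; apply: Lpfun_intro => //; [case: bf|exact: bfun_ri]. Qed.

End piecewise_functions.

Lemma subr_via (V : zmodType) (x y z : V) : x - y = (z - y) - (z - x).
Proof. by rewrite opprB [RHS]addrC addrA subrK. Qed.

Section projections.
Context d {T : measurableType d} {R : realType}.
Variables (P : probability T R) (k : scalar_kind).
Variables (F : nat -> set (set T)) (S : set (cfun T R)).
Hypothesis Fbin : binary_filtration P F.
Hypothesis Sfin : fin_dim_space k S.
Hypothesis Sstab : stability P F S.
Implicit Types (f g h : cfun T R) (c : R[i]) (A : set T).
Notation mes A := (fine (P A)).
Notation ri := (fun f : T -> R => P.-integrable setT (EFin \o f)).
Notation normc := ComplexField.Normc.normc.
Notation at_ n := (is_atom (F n)).
Notation pw := (piecewise F S).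
Notation L2 := (Lpfun P k 2%:E).
Notation inner := (inner P).
Notation Q := (orth_proj_diff P F S).
Notation proj := (orth_proj P F S).

(** Stability itself forces the L^oo norm on an atom to be finite: if it were +oo, the set in the
    inequality would be empty, whereas atoms have positive measure and c2 > 0. The number [s] is
    this norm. *)
Lemma stability_real : exists c1 c2 : R, [/\ 0 < c1 <= 1, 0 < c2 <= 1 &
  forall n A f, at_ n A -> S f -> exists s : R, [/\ 0 <= s,
    \forall x \ae P, A x -> modulus f x <= s,
    measurable [set w | A w /\ c1 * s <= modulus f w] &
    c2 * mes A <= mes [set w | A w /\ c1 * s <= modulus f w]]].
Proof.
have [c1 [c2 [c1P c2P st]]] := Sstab; exists c1, c2; split => // n A f aA Sf.
have mA := atom_measurable Fbin aA; have mf := S_mfun Sfin Sf.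
have := st A f (ex_intro2 _ _ n I aA) Sf.
have /andP[c10 c11] := c1P; have /andP[c20 c21] := c2P.
have Pn0 : P setT != 0%E by rewrite probability_setT onee_neq0.
have v0 : (0 <= Lpnorm P +oo (cutoff A f))%E by exact: Lnorm_ge0.
have vE : Lpnorm P +oo (cutoff A f) = ess_sup P (abse \o (EFin \o modulus (cutoff A f))).
  by rewrite /Lpnorm unlock lt0e Pn0 measure_ge0.
move: v0 (ess_sup_ge P (abse \o (EFin \o modulus (cutoff A f)))); rewrite -vE.
case: (Lpnorm P +oo (cutoff A f)) => [s||//]; last first.
  move=> _ _; rewrite mulry gtr0_sg// mul1e.
  rewrite (_ : [set w | _] = set0); last by apply/seteqP; split => x // [_].
  rewrite measure0 -[P A]finePK// -EFinM lee_fin leNgt mulr_gt0//.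
  by have := atom_pos Fbin aA.
rewrite lee_fin => s0 ae h; exists s.
rewrite (_ : [set w | _] = [set w | A w /\ c1 * s <= modulus f w]) in h; last first.
  by apply/seteqP; split => x [Ax] /=; rewrite -EFinM lee_fin.
have mE : measurable [set w | A w /\ c1 * s <= modulus f w].
  rewrite (_ : [set w | _] = A `&` modulus f @^-1` `[c1 * s, +oo[); last first.
    by apply/seteqP; split => x [Ax] /=; rewrite in_itv/= andbT.
  apply: measurableI => //; rewrite -[X in measurable X]setTI.
  by apply: (measurable_modulus mf).
split => //.
  apply: filterS ae => x /= + Ax; rewrite lee_fin; apply: le_trans.
  by rewrite ger0_norm ?modulus_ge0// modulus_cutoff indicE mem_set// mulr1.
by rewrite -lee_fin EFinM !finePK.
Qed.

Lemma S_bfun f : S f -> bfun P k f.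
Proof.
move=> Sf; split; first exact: S_mfun Sf.
have [c1 [c2 [_ _ h]]] := stability_real.
have [s [_ + _ _]] := h 0%N setT f ((atom0 Fbin setT).2 erefl) Sf.
by exists s; apply: filterS p => x; exact.
Qed.

Lemma pw_bfun n f : pw n f -> bfun P k f.
Proof.
elim: n f => [f /(pw0E Fbin)|n IH f]; first exact: S_bfun.
rewrite (pwS Fbin Sfin) => -[c [g [kc pg ->]]].
apply: bfunD; first exact: IH.
apply: bfun_sum => i _; apply: bfunZ => //; apply: bfun_cutoff.
  by have [] := half_measurable Fbin n.
by apply: S_bfun; exact: sbasis_in.
Qed.

Lemma pw_L2 n f : pw n f -> L2 f.
Proof. by move=> h; apply: bfun_Lp => //; exact: pw_bfun h. Qed.

Lemma pw_has_proj n : has_proj P k (pw n).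
Proof.
have two0 : 0 < 2 :> R by [].
elim: n => [|n IH].
  rewrite (_ : pw 0 = [set f | exists (c : 'I_(sdim Sfin) -> R[i]) (g : cfun T R),
      [/\ forall i, scalars k (c i), [set (0 : cfun T R)] g &
        f = g + \sum_(i < sdim Sfin) c i *: sbasis i]]); last first.
    apply/seteqP; split => f.
      move/(pw0E Fbin)/(sbasisE Sfin) => [c [kc e]].
      by exists c, 0; split => //; rewrite add0r.
    move=> [c [_ [kc -> e]]]; apply: pw_S; apply/(sbasisE Sfin).
    by exists c; split => //; rewrite e add0r.
  apply: has_proj_span.
  - by move=> _ ->; exact: Lpfun0.
  - by move=> _ _ -> ->; rewrite addr0.
  - by move=> c _ _ ->; rewrite scaler0.
  - by move=> i; apply: bfun_Lp => //; apply: S_bfun; exact: sbasis_in.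
  - move=> f Lf; exists 0 => // _ ->.
    by rewrite subr0 (inner_conj (Lpfun0 P k two0) Lf) inner0l rmorph0.
rewrite (pwS Fbin Sfin); apply: has_proj_span => //.
- exact: pw_L2.
- by move=> g h; exact: (pw_add Sfin).
- by move=> c g; exact: (pw_scale Sfin).
- move=> i; apply: bfun_Lp => //; apply: bfun_cutoff.
    by have [] := half_measurable Fbin n.
  by apply: S_bfun; exact: sbasis_in.
Qed.

Lemma orth_projP n f : L2 f ->
  pw n (proj n f) /\ forall h, pw n h -> inner (f - proj n f) h = 0.
Proof.
move=> Lf; have [g pg og] := @pw_has_proj n f Lf.
rewrite /orth_proj; set A := [set g | _].
have : A g by [].
by move=> Ag; have := xgetPex 0 (ex_intro _ g Ag).
Qed.

Lemma proj_L2 n f : L2 f -> L2 (proj n f).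
Proof. by move=> /(orth_projP n)[+ _]; exact: pw_L2. Qed.

Lemma Q_L2 n f : L2 f -> L2 (Q n f).
Proof.
by case: n => [|n] Lf; [exact: proj_L2|apply: LpfunB; rewrite ?ler1n//; exact: proj_L2].
Qed.

Lemma orth_proj_uniq n f g : L2 f -> pw n g -> (forall h, pw n h -> inner (f - g) h = 0) ->
  \forall x \ae P, proj n f x = g x.
Proof.
move=> Lf pg og; have [pp op] := orth_projP n Lf.
have Lg := pw_L2 pg; have Lp := pw_L2 pp.
have pd : pw n (proj n f - g) by exact: (pw_sub Sfin).
have Ld := pw_L2 pd; have t1 : 1 <= 2 :> R by rewrite ler1n.
have : inner (proj n f - g) (proj n f - g) = 0.
  rewrite {1}(subr_via (proj n f) g f).
  rewrite (innerBl (k := k)) ?og ?op ?subrr//; exact: LpfunB.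
rewrite (inner_self Ld) => /eqP; rewrite eq_complex/= eqxx andbT powR_eq0 => /andP[/eqP n0 _].
by apply: filterS (nrm2_eq0 Ld n0) => x; rewrite cfunBE => /subr0_eq.
Qed.

Lemma Q_pw n f : L2 f -> pw n (Q n f).
Proof.
case: n => [|n] Lf; first by have [] := orth_projP 0 Lf.
have [h1 _] := orth_projP n.+1 Lf; have [h2 _] := orth_projP n Lf.
by apply: (pw_sub Sfin) => //; exact: (pw_le Fbin _ h2).
Qed.

Lemma Q_orth n f h : L2 f -> pw n h -> inner (Q n.+1 f) h = 0.
Proof.
move=> Lf ph; have [p1 o1] := orth_projP n.+1 Lf; have [p2 o2] := orth_projP n Lf.
have L1 := pw_L2 p1; have L2' := pw_L2 p2; have Lh := pw_L2 ph.
have t1 : 1 <= 2 :> R by rewrite ler1n.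
rewrite /= (subr_via (proj n.+1 f) (proj n f) f).
rewrite (innerBl (k := k)) ?o2 ?o1 ?subrr//; try exact: LpfunB.
exact: (pw_le Fbin _ ph).
Qed.

Lemma Q_inner n f : L2 f -> inner f (Q n f) = inner (Q n f) (Q n f).
Proof.
move=> Lf; have Lp := proj_L2 n Lf; have LQ := Q_L2 n Lf.
have t1 : 1 <= 2 :> R by rewrite ler1n.
have e1 : inner f (Q n f) = inner (proj n f) (Q n f).
  have [_ /(_ _ (Q_pw (n:=n) Lf))] := orth_projP n Lf.
  by rewrite (innerBl Lf Lp LQ) => /subr0_eq.
rewrite e1; case: n Lp LQ {e1} => [//|n] Lp LQ.
have Lp' := proj_L2 n Lf.
have e2 : inner (proj n f) (Q n.+1 f) = 0.
  rewrite (inner_conj LQ Lp') Q_orth ?rmorph0//.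
  by have [] := orth_projP n Lf.
by rewrite {3}/orth_proj_diff (innerBl Lp Lp' LQ) e2 subr0.
Qed.

Lemma Q_sum n f : \sum_(j < n.+1) Q j f = proj n f.
Proof.
elim: n => [|n IH]; first by rewrite big_ord1.
by rewrite big_ord_recr IH /= addrC subrK.
Qed.

Lemma proj_ae n f g : scalar_mfun k f -> pw n g -> (\forall x \ae P, f x = g x) ->
  \forall x \ae P, proj n f x = g x.
Proof.
move=> mf pg fg; have Lg := pw_L2 pg.
have Lf : L2 f by apply: Lpfun_ae Lg _ _ => //.
apply: orth_proj_uniq => // h ph; have [mg _] := Lg; have [mh _] := pw_L2 ph.
rewrite (inner_ae (k := k) (g := 0)) ?inner0l//.
- by case: (LpfunB (ler1n _ 2) Lf Lg).
- exact: scalar_mfun0.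
- by apply: filterS fg => x; rewrite cfunBE => ->; rewrite subrr.
Qed.

Lemma Q_vanish n m f g : scalar_mfun k f -> pw n g -> (\forall x \ae P, f x = g x) ->
  (n < m)%N -> \forall x \ae P, Q m f x = 0.
Proof.
move=> mf pg fg; case: m => // m nm.
have h1 := proj_ae mf (pw_le Fbin (nm : (n <= m)%N) pg) fg.
have h2 := proj_ae mf (pw_le Fbin (leqW (nm : (n <= m)%N)) pg) fg.
by apply: filterS2 h1 h2 => x e1 e2; rewrite /= cfunBE e1 e2 subrr.
Qed.

Lemma projD n f g : L2 f -> L2 g ->
  \forall x \ae P, proj n (f + g) x = proj n f x + proj n g x.
Proof.
move=> Lf Lg; have t1 : 1 <= 2 :> R by rewrite ler1n.
have [pf of_] := orth_projP n Lf; have [pg og] := orth_projP n Lg.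
apply: (@orth_proj_uniq n (f + g) (proj n f + proj n g)).
- exact: LpfunD.
- exact: (pw_add Sfin).
- move=> h ph; have Lh := pw_L2 ph.
  rewrite opprD addrACA (innerDl (k := k)) ?of_ ?og ?addr0//.
    by apply: LpfunB => //; exact: proj_L2.
  by apply: LpfunB => //; exact: proj_L2.
Qed.

Lemma projZ n c f : scalars k c -> L2 f ->
  \forall x \ae P, proj n (c *: f) x = c * proj n f x.
Proof.
move=> kc Lf; have t1 : 1 <= 2 :> R by rewrite ler1n.
have [pf of_] := orth_projP n Lf.
apply: (@orth_proj_uniq n (c *: f) (c *: proj n f)).
- exact: LpfunZ.
- exact: (pw_scale Sfin).
- move=> h ph; have Lh := pw_L2 ph.
  rewrite -scalerBr (innerZl (k := k)) ?of_ ?mulr0//.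
  by apply: LpfunB => //; exact: proj_L2.
Qed.

Lemma QD n f g : L2 f -> L2 g -> \forall x \ae P, Q n (f + g) x = Q n f x + Q n g x.
Proof.
move=> Lf Lg; case: n => [|n]; first exact: projD.
have h1 := projD n.+1 Lf Lg; have h2 := projD n Lf Lg.
by apply: filterS2 h1 h2 => x e1 e2; rewrite /= !cfunBE e1 e2; ring.
Qed.

Lemma QZ n c f : scalars k c -> L2 f -> \forall x \ae P, Q n (c *: f) x = c * Q n f x.
Proof.
move=> kc Lf; case: n => [|n]; first exact: projZ.
have h1 := projZ n.+1 kc Lf; have h2 := projZ n kc Lf.
by apply: filterS2 h1 h2 => x e1 e2; rewrite /= !cfunBE e1 e2; ring.
Qed.

Lemma Q_sum_ae n (I : Type) (s : seq I) (f : I -> cfun T R) :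
  (forall i, L2 (f i)) ->
  \forall x \ae P, Q n (\sum_(i <- s) f i) x = \sum_(i <- s) Q n (f i) x.
Proof.
move=> Lf; have t1 : 1 <= 2 :> R by rewrite ler1n.
elim: s => [|i s IH].
  have L0 : L2 0 by exact: Lpfun0.
  have := QZ n (scalars0 k) L0.
  by rewrite scale0r; apply: filterS => x e; rewrite !big_nil e mul0r.
have := QD n (Lf i) (@Lpfun_sum _ _ _ P k 2 _ s xpredT f t1 (fun j _ => Lf j)).
by apply: filterS2 IH => x e1 e2; rewrite [in LHS]big_cons e2 big_cons e1.
Qed.

Lemma Q_ae n f g : L2 f -> L2 g -> (\forall x \ae P, f x = g x) ->
  \forall x \ae P, Q n f x = Q n g x.
Proof.
move=> Lf Lg fg; have t1 : 1 <= 2 :> R by rewrite ler1n.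
have pr m : \forall x \ae P, proj m f x = proj m g x.
  have [pg og] := orth_projP m Lg.
  apply: orth_proj_uniq => // h ph; rewrite -(og h ph).
  apply: (inner_ae (k := k)).
  - by case: (LpfunB t1 Lf (proj_L2 m Lg)).
  - by case: (LpfunB t1 Lg (proj_L2 m Lg)).
  - by case: (pw_L2 ph).
  - by apply: filterS fg => x; rewrite !cfunBE => ->.
case: n => [|n]; first exact: pr.
by apply: filterS2 (pr n.+1) (pr n) => x e1 e2; rewrite /= !cfunBE e1 e2.
Qed.

(** For j > i the increment Q_i f already lies in both spaces whose projections are subtracted; for
    j < i it is orthogonal to them. *)
Lemma Q_other i j f : L2 f -> i != j -> \forall x \ae P, Q j (Q i f) x = 0.
Proof.
move=> Lf; have LQ := Q_L2 i Lf; have [mQ _] := LQ.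
rewrite neq_ltn => /orP[ij|].
  by apply: (Q_vanish mQ (Q_pw (n:=i) Lf) (aeW _ _) ij).
case: i LQ mQ => // i LQ mQ ji.
have pr m : (m <= i)%N -> \forall x \ae P, proj m (Q i.+1 f) x = 0.
  move=> mi; apply: (@orth_proj_uniq m (Q i.+1 f) 0) => //; first exact: (pw_zero Sfin).
  by move=> h ph; rewrite subr0 Q_orth//; exact: (pw_le Fbin _ ph).
case: j ji => [|j] ji; first exact: pr.
apply: filterS2 (pr j.+1 ji) (pr j (ltnW ji)) => x e1 e2.
by rewrite /= cfunBE e1 e2 subrr.
Qed.

(** Cut u = Q_(n+1) f to the complement of the split atom. The result h belongs to S_n, because it
    vanishes on the split atom and the other atoms are not subdivided. Orthogonality of u to S_n
    gives <h, h> = <u, h> = 0. *)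
Lemma Q_support n f : L2 f -> \forall x \ae P,
  ~ (half1 Fbin n `|` half2 Fbin n) x -> Q n f x = 0.
Proof.
case: n => [|n] Lf; first by apply: aeW => x /= h; exfalso; apply: h; left.
have E : half1 Fbin n.+1 `|` half2 Fbin n.+1 = split_atom Fbin n := halvesU Fbin n.
rewrite E; set A := split_atom Fbin n; rewrite /=.
set u := proj n.+1 f - proj n f.
have pu : pw n.+1 u := Q_pw (n:=n.+1) Lf.
have aA := split_atom_atom Fbin n; have mA := atom_measurable Fbin aA.
pose h := cutoff (~` A) u.
have ph : pw n h.
  apply/pwP => D aD; have [e|ne] := pselect (D = A).
    exists 0; first exact: S_zero Sfin.
    by move=> x; rewrite e => Ax; rewrite /h cutoff_out//; exact.
  have [g Sg eg] := (pwP F S n.+1 u).1 pu D (atomS_old aD ne).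
  exists g => // x Dx; rewrite /h cutoff_in ?eg// => Ax; apply: ne.
  exact: (atom_disjoint Fbin aD aA Dx Ax).
have Lu := pw_L2 pu; have Lh := pw_L2 ph.
have e0 : inner h h = 0.
  rewrite -(Q_orth Lf ph) -/u /inner; congr (Complex _ _);
    apply: eq_Rintegral => x _; rewrite /h /= -/u; have [Ax|nAx] := pselect (A x).
  - by rewrite cutoff_out ?rmorph0 ?mulr0// => /(_ Ax).
  - by rewrite cutoff_in.
  - by rewrite cutoff_out ?rmorph0 ?mulr0// => /(_ Ax).
  - by rewrite cutoff_in.
move: e0; rewrite (inner_self Lh) => /eqP; rewrite eq_complex/= eqxx andbT.
rewrite powR_eq0 => /andP[/eqP n0 _].
by apply: filterS (nrm2_eq0 Lh n0) => x; rewrite /h => + nA; rewrite cutoff_in.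
Qed.

End projections.

(** * Size of the increments *)

Section local_estimates.
Context d {T : measurableType d} {R : realType}.
Variables (P : probability T R) (k : scalar_kind).
Variables (F : nat -> set (set T)) (S : set (cfun T R)).
Hypothesis Fbin : binary_filtration P F.
Hypothesis Sfin : fin_dim_space k S.
Hypothesis Sstab : stability P F S.
Implicit Types (f g h u v w : cfun T R) (c : R[i]) (A : set T).
Notation mes A := (fine (P A)).
Notation ri := (fun f : T -> R => P.-integrable setT (EFin \o f)).
Notation at_ n := (is_atom (F n)).
Notation pw := (piecewise F S).
Notation L2 := (Lpfun P k 2%:E).
Notation Q := (orth_proj_diff P F S).
Notation h1 := (half1 Fbin).
Notation h2 := (half2 Fbin).

Let tree : split_tree P h1 h2 := halves_tree Fbin.

Lemma rint_sqr_indic_le f A : measurable A -> L2 f ->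
  \int[P]_x (modulus f x ^+ 2 * \1_A x) <= nrm P 2 f ^+ 2.
Proof.
move=> mA Lf; rewrite -powR_mulrn ?nrm_ge0// nrm_pow//.
have I2 := Lpfun_ri (ltr0Sn R 1) Lf.
have E : (fun x => modulus f x ^+ 2) = fun x => modulus f x `^ 2.
  by apply/funext => x; rewrite powR_mulrn ?modulus_ge0.
apply: rint_le => //; first by apply: riM_indic => //; rewrite E.
move=> x; rewrite powR_mulrn ?modulus_ge0// ler_piMr ?sqr_ge0//.
Qed.

(** On a share c2 of the atom |f| is at least c1 s, so the L^2 mass there controls the supremum s.
    It is used for both halves. *)
Lemma small_half_bound (c1 c2 : R) n A f v s : 0 < c1 -> 0 < c2 -> at_ n A -> L2 f ->
  S v -> (forall x, A x -> f x = v x) -> 0 <= s ->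
  measurable [set w | A w /\ c1 * s <= modulus v w] ->
  c2 * mes A <= mes [set w | A w /\ c1 * s <= modulus v w] ->
  c1 ^+ 2 * c2 * s ^+ 2 * mes A <= \int[P]_x (modulus f x ^+ 2 * \1_A x).
Proof.
move=> c10 c20 aA Lf Sv fv s0 mE hE.
have mA := atom_measurable Fbin aA.
set E := [set w | _] in mE hE.
apply: le_trans (_ : (c1 * s) ^+ 2 * mes E <= _).
  have -> : c1 ^+ 2 * c2 * s ^+ 2 * mes A = (c1 * s) ^+ 2 * (c2 * mes A) by ring.
  by rewrite ler_wpM2l ?sqr_ge0.
rewrite -rint_indic// -rintZ; last exact: ri_indic.
have I2 : ri (fun x => modulus f x ^+ 2).
  by apply: eq_integrable (Lpfun_ri (ltr0Sn R 1) Lf) => // x _ /=;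
    rewrite powR_mulrn ?modulus_ge0.
apply: rint_le; [by apply: riZ; exact: ri_indic|exact: riM_indic|move=> x].
rewrite !indicE; have [Ex|nEx] := pselect (E x); last first.
  by rewrite (memNset nEx) mulr0 mulr_ge0 ?sqr_ge0.
have [Ax h] := Ex; rewrite (mem_set Ex) (mem_set Ax) !mulr1.
rewrite lerXn2r ?nnegrE ?modulus_ge0 ?mulr_ge0 ?(ltW c10)//.
by rewrite /modulus fv.
Qed.

(* If |A'| < c2 |A|, stability on the whole atom A forces [w] to reach the size
   c1 ||w||_(oo, A) on A''; testing the orthogonality of [u] against w 1_A then
   bounds the integral of |u|^2 over A'' by that of |u| |w| over A'. *)
Lemma large_half_bound (c1 c2 : R) n u w s1 s2 : 0 < c1 -> 0 < c2 ->
  (forall n A f, at_ n A -> S f -> exists s : R, [/\ 0 <= s,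
    \forall x \ae P, A x -> modulus f x <= s,
    measurable [set w | A w /\ c1 * s <= modulus f w] &
    c2 * mes A <= mes [set w | A w /\ c1 * s <= modulus f w]]) ->
  L2 u -> (forall h, pw n h -> inner P u h = 0) ->
  (\forall x \ae P, h1 n.+1 x -> modulus u x <= s1) -> 0 <= s1 ->
  S w -> (forall x, h2 n.+1 x -> u x = w x) ->
  0 <= s2 -> (\forall x \ae P, h2 n.+1 x -> modulus w x <= s2) ->
  mes (h1 n.+1) < c2 * mes (split_atom Fbin n) ->
  c1 * (\int[P]_x (modulus u x ^+ 2 * \1_(h2 n.+1) x)) <= s1 * s2 * mes (h1 n.+1).
Proof.
move=> c10 c20 stab Lu ou us1 s10 Sw uw s20 ws2 small.
set A := split_atom Fbin n.
have aA := split_atom_atom Fbin n; have mA := atom_measurable Fbin aA.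
have m1 := st_m1 tree n.+1; have m2 := st_m2 tree n.+1.
have disj := st_disj tree n.+1.
have U : h1 n.+1 `|` h2 n.+1 = A := halvesU Fbin n.
have [s [s0 ws mE hE]] := stab _ _ _ aA Sw.
set E := [set w | _] in mE hE.
have c1s : c1 * s <= s2.
  rewrite leNgt; apply/negP => lt; move: hE; rewrite leNgt => /negP; apply.
  apply: le_lt_trans small; rewrite -!rint_indic//.
  apply: rint_le_ae => //; [exact: ri_indic|].
  apply: filterS ws2 => x h; rewrite !indicE.
  have [Ex|nEx] := pselect (E x); last by rewrite (memNset nEx).
  rewrite (mem_set Ex); have [Ax hx] := Ex.
  move: Ax; rewrite -/A -U => -[x1|x2]; first by rewrite mem_set.
  by have := lt_le_trans lt (le_trans hx (h x2)); rewrite ltxx.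
have Lw : L2 w by apply: bfun_Lp => //; exact: (S_bfun Fbin Sfin Sstab Sw).
have pwA : pw n (cutoff A w) by exact: (pw_cutoff Fbin Sfin).
have LwA := pw_L2 Fbin Sfin Sstab pwA.
have o := ou _ pwA.
have {o} o : \int[P]_x complex.Re (u x * conjc (cutoff A w x)) = 0.
  by rewrite -Re_inner o.
have I2 : ri (fun x => modulus u x ^+ 2 * \1_(h2 n.+1) x).
  apply: riM_indic => //.
  by apply: eq_integrable (Lpfun_ri (ltr0Sn R 1) Lu) => // x _ /=;
    rewrite powR_mulrn ?modulus_ge0.
have I1 := riM_indic m1 (ri_modulusM Lu Lw).
have key : \int[P]_x (modulus u x ^+ 2 * \1_(h2 n.+1) x) <=
    \int[P]_x (modulus u x * modulus w x * \1_(h1 n.+1) x).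
  have IR := ri_ReMJ Lu LwA.
  rewrite -[leLHS]subr0 -o -mulN1r -rintZ// -rintD//; last exact: riZ.
  apply: rint_le => //; first by apply: riD => //; exact: riZ.
  move=> x; rewrite !indicE.
  have [x1|nx1] := pselect (h1 n.+1 x).
    have nx2 : ~ h2 n.+1 x.
      by move=> x2; have : (h1 n.+1 `&` h2 n.+1) x by []; rewrite disj.
    have Ax : A x by rewrite -U; left.
    rewrite (memNset nx2) (mem_set x1) mulr0 add0r mulr1 cutoff_in// mulN1r.
    by apply: le_trans (abs_ReMJ u w x); rewrite -normrN ler_norm.
  rewrite (memNset nx1) mulr0.
  have [x2|nx2] := pselect (h2 n.+1 x).
    have Ax : A x by rewrite -U; right.
    rewrite (mem_set x2) mulr1 cutoff_in// -uw// Re_mulJ powR_mulrn ?modulus_ge0//.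
    by rewrite mulN1r subrr.
  rewrite cutoff_out; last by rewrite -U => -[].
  by rewrite (memNset nx2) mulr0 rmorph0 mulr0 /= mulr0 addr0.
apply: le_trans (ler_wpM2l (ltW c10) key) _.
rewrite -rintZ// -rint_indic// -rintZ; last exact: ri_indic.
apply: rint_le_ae.
- exact: ri_meas (riZ c1 I1).
- by move=> x; rewrite mulr_ge0 ?(ltW c10)// mulr_ge0// mulr_ge0 ?modulus_ge0.
- by move=> x; rewrite mulr_ge0// mulr_ge0.
- by apply: riZ; exact: ri_indic.
- apply: filterS2 us1 ws => x hu hw; rewrite !indicE.
  have [x1|nx1] := pselect (h1 n.+1 x); last by rewrite (memNset nx1) !mulr0.
  rewrite (mem_set x1) !mulr1 mulrCA; apply: ler_pM => //.
  - exact: modulus_ge0.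
  - by rewrite mulr_ge0 ?(ltW c10) ?modulus_ge0.
  - exact: hu.
  - apply: le_trans c1s; rewrite ler_pM2l//; apply: hw.
    by rewrite -/A -U; left.
Qed.

(** With K = c1 c2^(1/2), the constant collects three estimates, each multiplied by K^-1. The
    summand 1 is stability on A'. If |A'| >= c2 |A|, then stability on A'' suffices, since
    |A''|^(-1/2) <= c2^(-1/2) |A'|^(1/2) / |A''|; this is cc^-1. If |A'| < c2 |A|,
    [large_half_bound] together with stability on A'' bounds s2 |A''| by s1 |A'| / (c1^3 c2), and s1
    is already controlled. *)
Lemma Q_bound : exists2 C0 : R, 0 < C0 & forall j f, L2 f ->
  \forall x \ae P, modulus (Q j f) x <= C0 * nrm P 2 (Q j f) * bump P h1 h2 2 j x.
Proof.
have [c1 [c2 [/andP[c10 c11] /andP[c20 c21] stab]]] := stability_real Fbin Sfin Sstab.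
pose K := (c1 ^+ 2 * c2) `^ 2^-1; pose cc := c2 `^ 2^-1.
have cc0 : 0 < c1 ^+ 2 * c2 by rewrite mulr_gt0// exprn_gt0.
have K0 : 0 < K by rewrite powR_gt0.
have K2 : K ^+ 2 = c1 ^+ 2 * c2 by rewrite -powR_mulrn ?powR_ge0// powRVK// ltW.
have ccp : 0 < cc by rewrite powR_gt0.
have cc2 : cc ^+ 2 = c2 by rewrite -powR_mulrn ?powR_ge0// powRVK// ltW.
exists (K^-1 * (1 + cc^-1 + (c1 ^+ 3 * c2)^-1)).
  by rewrite mulr_gt0 ?invr_gt0// !addr_gt0 ?invr_gt0 ?mulr_gt0 ?exprn_gt0.
move=> j f Lf; set u := Q j f; set N := nrm P 2 u.
have Lu : L2 u := Q_L2 Fbin Sfin Sstab j Lf.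
have N0 : 0 <= N by exact: nrm_ge0.
have pu : pw j u := Q_pw Fbin Sfin Sstab (n:=j) Lf.
have m1 := st_m1 tree j; have m2 := st_m2 tree j; have m1p := st_pos tree j.
set r := mes (h1 j) `^ 2^-1.
have r0 : 0 < r by rewrite powR_gt0.
have r2 : r ^+ 2 = mes (h1 j) by rewrite -powR_mulrn ?powR_ge0// powRVK// ltW.
have bE x : bump P h1 h2 2 j x = r^-1 * \1_(h1 j) x + r / mes (h2 j) * \1_(h2 j) x.
  rewrite /bump powRN -/r; congr (_ + _ / _ * _).
  by rewrite (_ : 1 - 2^-1 = 2^-1 :> R)//; lra.
have a1 : at_ j (h1 j).
  by case: (j) => [|n]; [exact: (atom0 Fbin setT).2|exact: small_half_atom].
have [v Sv ev] := (pwP F S j u).1 pu _ a1.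
have [s1 [s10 vs1 mE1 hE1]] := stab _ _ _ a1 Sv.
have us1 : \forall x \ae P, h1 j x -> modulus u x <= s1.
  by apply: filterS vs1 => x h x1; rewrite /modulus ev//; exact: h.
have B1 : K * r * s1 <= N.
  rewrite -(@ler_pXn2r _ 2)// ?nnegrE ?mulr_ge0 ?(ltW K0) ?(ltW r0)//.
  apply: le_trans (rint_sqr_indic_le m1 Lu).
  apply: le_trans (small_half_bound c10 c20 a1 Lu Sv ev s10 mE1 hE1).
  by rewrite !exprMn K2 r2; apply: eq_ler; ring.
have B1' : s1 <= K^-1 * N * r^-1.
  by rewrite ler_pdivlMr// ler_pdivlMl// mulrA mulrAC.
have KN : 0 <= K^-1 * N by rewrite mulr_ge0 ?invr_ge0 ?(ltW K0).
have sup := Q_support Fbin Sfin Sstab j Lf.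
have ou n : j = n.+1 -> forall h, pw n h -> inner P u h = 0.
  by move=> jn h ph; rewrite /u jn (Q_orth Fbin Sfin Sstab).
have a2 n : j = n.+1 -> at_ j (h2 j) by move=> ->; exact: large_half_atom.
have [s2 [s20 us2 B2]] : exists s2, [/\ 0 <= s2,
    \forall x \ae P, h2 j x -> modulus u x <= s2 &
    s2 <= K^-1 * (cc^-1 + (c1 ^+ 3 * c2)^-1) * N * (r / mes (h2 j))].
  have c0 : 0 <= cc^-1 + (c1 ^+ 3 * c2)^-1.
    by rewrite addr_ge0// invr_ge0 ?mulr_ge0 ?exprn_ge0 ?(ltW ccp) ?(ltW c10) ?(ltW c20).
  have [j0|[n jn]] : j = 0%N \/ exists n, j = n.+1.
    by case: (j) => [|n]; [left|right; exists n].
    (* At step 0 the second half is empty, so 0 bounds u there. *)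
    exists 0; split => //; first by apply: aeW => x; rewrite j0.
    rewrite mulr_ge0 ?divr_ge0 ?fineP_ge0 ?(ltW r0)//.
    by rewrite mulr_ge0// mulr_ge0// invr_ge0 ltW.
  have a2' := a2 _ jn; have [w Sw ew] := (pwP F S j u).1 pu _ a2'.
  have [s2 [s20 ws2 mE2 hE2]] := stab _ _ _ a2' Sw.
  have us2 : \forall x \ae P, h2 j x -> modulus u x <= s2.
    by apply: filterS ws2 => x h x2; rewrite /modulus ew//; exact: h.
  exists s2; split => //.
  have m2p : 0 < mes (h2 j) by have := atom_pos Fbin a2'.
  have B2 := small_half_bound c10 c20 a2' Lu Sw ew s20 mE2 hE2.
  have I2N := rint_sqr_indic_le m2 Lu.
  have U : h1 j `|` h2 j = split_atom Fbin n by rewrite jn; exact: halvesU Fbin n.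
  have mU : mes (split_atom Fbin n) = mes (h1 j) + mes (h2 j).
    by rewrite -U finePU// (st_disj tree).
  rewrite mulrA ler_pdivlMr// mulrDr [leRHS]mulrAC mulrDl mulrDl.
  have t1 : 0 <= K^-1 / cc * N * r.
    by rewrite !mulr_ge0 ?invr_ge0 ?(ltW r0) ?(ltW K0) ?(ltW ccp).
  have t2 : 0 <= K^-1 / (c1 ^+ 3 * c2) * N * r.
    by rewrite !mulr_ge0 ?invr_ge0 ?mulr_ge0 ?exprn_ge0 ?(ltW r0) ?(ltW K0) ?(ltW c10) ?(ltW c20).
  have [big|small] := leP (c2 * mes (split_atom Fbin n)) (mes (h1 j)).
    apply: le_trans (_ : K^-1 / cc * N * r <= _); last first.
      by rewrite -subr_ge0; apply: le_trans t2 _; apply: eq_ler; ring.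
    rewrite -(@ler_pM2l _ (K * cc)) ?mulr_gt0//.
    have -> : K * cc * (K^-1 / cc * N * r) = N * r by field; rewrite !gt_eqF.
    rewrite -(@ler_pXn2r _ 2)// ?nnegrE ?mulr_ge0 ?fineP_ge0 ?(ltW K0) ?(ltW r0) ?(ltW ccp)//.
    rewrite !exprMn K2 cc2 r2.
    have -> : c1 ^+ 2 * c2 * c2 * (s2 ^+ 2 * mes (h2 j) ^+ 2) =
      (c1 ^+ 2 * c2 * s2 ^+ 2 * mes (h2 j)) * (c2 * mes (h2 j)) by ring.
    apply: ler_pM => //.
    - by rewrite !mulr_ge0 ?sqr_ge0 ?fineP_ge0// ltW.
    - by rewrite mulr_ge0 ?fineP_ge0// ltW.
    - exact: le_trans B2 I2N.
    - by apply: le_trans big; rewrite mU ler_pM2l// lerDr fineP_ge0.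
  apply: le_trans (_ : K^-1 / (c1 ^+ 3 * c2) * N * r <= _); last first.
    by rewrite -subr_ge0; apply: le_trans t1 _; apply: eq_ler; ring.
  rewrite jn in us1 ew ws2 small B2 m2p B1' r0 r2.
  have L := large_half_bound c10 c20 stab Lu (ou _ jn) us1 s10 Sw ew s20 ws2 small.
  have {}L := le_trans (ler_wpM2l (ltW c10) B2) L.
  have [->|sn0] := eqVneq s2 0; first by rewrite mul0r.
  have s2p : 0 < s2 by rewrite lt0r sn0.
  move: L; rewrite -r2 => L.
  have {}L : c1 ^+ 3 * c2 * (s2 * mes (h2 n.+1)) <= s1 * r ^+ 2.
    rewrite -(ler_pM2r s2p); apply: le_trans (_ : _ <= s1 * s2 * r ^+ 2) _; last first.
      by apply: eq_ler; ring.
    by apply: le_trans L; apply: eq_ler; ring.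
  have c3 : 0 < c1 ^+ 3 * c2 by rewrite mulr_gt0// exprn_gt0.
  have Lr : s1 * r ^+ 2 <= K^-1 * N * r.
    by rewrite expr2 mulrA ler_pM2r// -ler_pdivlMr.
  rewrite jn -(ler_pM2l c3); apply: le_trans L _; apply: le_trans Lr _.
  by apply: eq_ler; field; rewrite !gt_eqF.
have h12 x : h1 j x -> h2 j x -> False.
  by move=> x1 x2; have : (h1 j `&` h2 j) x by []; rewrite (st_disj tree).
apply: filterS3 us1 us2 sup => x e1 e2 e3; rewrite bE !indicE.
have [x1|nx1] := pselect (h1 j x).
  rewrite (mem_set x1) memNset; last exact: h12.
  rewrite mulr1 mulr0 addr0; apply: le_trans (e1 x1) _; apply: le_trans B1' _.
  rewrite ler_wpM2r ?invr_ge0 ?(ltW r0)// ler_wpM2r// ler_peMr ?invr_ge0 ?(ltW K0)//.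
  by rewrite -addrA lerDl addr_ge0// invr_ge0 ?mulr_ge0 ?exprn_ge0 ?(ltW ccp) ?(ltW c10) ?(ltW c20).
rewrite (memNset nx1) mulr0 add0r.
have [x2|nx2] := pselect (h2 j x).
  rewrite (mem_set x2) mulr1; apply: le_trans (e2 x2) _; apply: le_trans B2 _.
  rewrite ler_wpM2r ?divr_ge0 ?fineP_ge0 ?(ltW r0)// ler_wpM2r// ler_wpM2l ?invr_ge0 ?(ltW K0)//.
  by rewrite -addrA lerDr.
have ux : u x = 0 by apply: e3 => -[].
by rewrite (memNset nx2) !mulr0 /modulus ux ComplexField.Normc.normc0.
Qed.

End local_estimates.

Section bumps.
Context d {T : measurableType d} {R : realType}.
Variables (P : probability T R) (A1 A2 : nat -> set T).
Hypothesis tree : split_tree P A1 A2.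
Notation mes A := (fine (P A)).
Notation ri := (fun f : T -> R => P.-integrable setT (EFin \o f)).
Notation bump := (bump P A1 A2).

Lemma bump_change (a b : R) j x :
  bump a j x = mes (A1 j) `^ (b^-1 - a^-1) * bump b j x.
Proof.
have m0 := st_pos tree j.
rewrite /bump mulrDr !mulrA; congr (_ * _ + _ * _).
  by rewrite -powRD ?(gt_eqF m0) ?implybT//; congr (_ `^ _); ring.
congr (_ / _).
by rewrite -powRD ?(gt_eqF m0) ?implybT//; congr (_ `^ _); ring.
Qed.

Lemma ri_bump (p a : R) j : 0 <= a -> ri (fun x => bump p j x `^ a).
Proof.
move=> a0; have [M hM] := bump_bounded P A1 A2 p j.
apply: (@ri_bounded _ _ _ _ _ (M `^ a)).
  exact: measurableT_comp (measurable_powR a) (measurable_bump tree p j).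
move=> x; rewrite ger0_norm ?powR_ge0//.
by apply: le_powR => //; exact: bump_ge0.
Qed.

Definition bump_cst (p : R) : R := bavg_cst (p / (p - 1)) 1 `^ p.

Lemma bump_norm (p : R) j : 1 < p -> \int[P]_x (bump p j x `^ p) <= bump_cst p.
Proof.
move=> p1; have := bump_sum_norm tree [set @ord_max j] p1.
rewrite cards1 mulr1; apply: le_trans; apply: eq_ler.
by apply: eq_Rintegral => x _; rewrite big_set1.
Qed.

End bumps.

Opaque nrm bump bavg modulus.

Section increments.
Context d {T : measurableType d} {R : realType}.
Variables (P : probability T R) (k : scalar_kind).
Variables (F : nat -> set (set T)) (S : set (cfun T R)).
Hypothesis Fbin : binary_filtration P F.
Hypothesis Sfin : fin_dim_space k S.
Hypothesis Sstab : stability P F S.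
Implicit Types (f g h u v w : cfun T R) (c : R[i]) (A : set T).
Notation mes A := (fine (P A)).
Notation ri := (fun f : T -> R => P.-integrable setT (EFin \o f)).
Notation at_ n := (is_atom (F n)).
Notation pw := (piecewise F S).
Notation L2 := (Lpfun P k 2%:E).
Notation Q := (orth_proj_diff P F S).
Notation h1 := (half1 Fbin).
Notation h2 := (half2 Fbin).
Notation bump := (bump P h1 h2).
Notation bavg := (bavg P h1 h2).
Notation bump_cst := (@bump_cst R).

Let tree : split_tree P h1 h2 := halves_tree Fbin.

Lemma L2_ri f : L2 f -> ri (modulus f).
Proof.
move=> Lf; apply: (@ri_le _ _ _ _ _ (fun x => 1 + modulus f x `^ 2)).
- exact: measurable_modulus (Lpfun_mfun Lf).
- move=> x; rewrite ger0_norm ?modulus_ge0// powR_mulrn ?modulus_ge0//.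
  have := sqr_ge0 (modulus f x - 1); have := modulus_ge0 f x; nra.
- by apply: riD; [exact: ri_cst|exact: Lpfun_ri Lf].
Qed.

Lemma Q_bfun j f : L2 f -> bfun P k (Q j f).
Proof. by move=> Lf; apply: (pw_bfun Fbin Sfin Sstab (Q_pw Fbin Sfin Sstab (n:=j) Lf)). Qed.

Lemma Q_Lp p j f : 0 < p -> L2 f -> Lpfun P k p%:E (Q j f).
Proof. by move=> p0 Lf; apply: bfun_Lp => //; exact: Q_bfun. Qed.

Lemma nrm_sqr_le f (h : T -> R) : L2 f -> measurable_fun setT h -> (forall x, 0 <= h x) ->
  ri (fun x => modulus f x * h x) -> (\forall x \ae P, modulus f x <= h x) ->
  nrm P 2 f ^+ 2 <= \int[P]_x (modulus f x * h x).
Proof.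
move=> Lf mh h0 ih fh; rewrite -powR_mulrn ?nrm_ge0// nrm_pow//.
apply: rint_le_ae => //.
- exact: measurable_modulus_powR (Lpfun_mfun Lf).
- by move=> x; exact: powR_ge0.
- by move=> x; rewrite mulr_ge0 ?modulus_ge0.
- by apply: filterS fh => x h'; rewrite powR_mulrn ?modulus_ge0// expr2 ler_wpM2l ?modulus_ge0.
Qed.

(** Insert the pointwise bound of [Q_bound] into ||u||_2^2 and apply Hoelder's inequality: ||u||_2
    <= C |A'|^e ||u||_p with e = 1/2 - 1/p, since |A'|^e is the order of the dual norm of the bump
    for exponent 2. Rewriting that bump as the one for exponent p produces |A'|^(-e), and the powers
    cancel. *)
Lemma Q_upper p : 1 < p -> exists2 C : R, 0 < C & forall j f, L2 f ->
  \forall x \ae P, modulus (Q j f) x <= C * nrm P p (Q j f) * bump p j x.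
Proof.
move=> p1; have p0 : 0 < p by rewrite (lt_trans _ p1).
have p10 : 0 < p - 1 by rewrite subr_gt0.
have [C0 C00 hQ] := Q_bound Fbin Sfin Sstab.
pose q := p / (p - 1); have q1 : 1 < q by rewrite ltr_pdivlMr// mul1r gtrBl.
have q0 : 0 < q by rewrite (lt_trans _ q1).
have qi : q^-1 = 1 - p^-1 by rewrite /q; field; rewrite !gt_eqF.
pose bc := bump_cst q `^ q^-1; have bc0 : 0 <= bc by exact: powR_ge0.
(* The summand 1 only keeps the constant positive; the same device recurs in the following
   estimates. *)
exists (C0 ^+ 2 * bc + 1); first by rewrite ltr_wpDl// mulr_ge0 ?sqr_ge0.
move=> j f Lf; set u := Q j f.
have Lu : L2 u := Q_L2 Fbin Sfin Sstab j Lf.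
have Lpu : Lpfun P k p%:E u by exact: Q_Lp.
set N := nrm P 2 u; have N0 : 0 <= N by exact: nrm_ge0.
have m0 := st_pos tree j.
pose e := 2^-1 - p^-1.
have mm : mes (h1 j) `^ e * mes (h1 j) `^ (p^-1 - 2^-1) = 1.
  rewrite -powRD; last by rewrite (gt_eqF m0) implybT.
  by rewrite (_ : e + (p^-1 - 2^-1) = 0) ?powRr0// /e; ring.
have e1 : q^-1 - 2^-1 = e by rewrite qi /e; lra.
have bump2_norm : (\int[P]_x (bump 2 j x `^ q)) `^ q^-1 <= mes (h1 j) `^ e * bc.
  have -> : (\int[P]_x (bump 2 j x `^ q)) =
      (mes (h1 j) `^ e) `^ q * \int[P]_x (bump q j x `^ q).
    rewrite -rintZ; last exact: ri_bump (ltW q0).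
    apply: eq_Rintegral => x _; rewrite (bump_change tree 2 q) e1 powRM ?powR_ge0//.
    exact: bump_ge0.
  rewrite powRM ?powR_ge0 ?powRKV ?powR_ge0//; last first.
    by apply: Rintegral_ge0 => x _; exact: powR_ge0.
  rewrite ler_wpM2l ?powR_ge0//; apply: le_powR; rewrite ?invr_ge0 ?(ltW q0)//.
    by apply: Rintegral_ge0 => x _; exact: powR_ge0.
  exact: bump_norm.
have [iub ub] := hoelder_modulus p1 Lpu (measurable_bump tree 2 j) (bump_ge0 P h1 h2 2 j)
  (ri_bump tree 2 j (ltW q0)).
have NB : N <= C0 * bc * mes (h1 j) `^ e * nrm P p u.
  have [->|Nn0] := eqVneq N 0.
    by rewrite !mulr_ge0 ?powR_ge0 ?nrm_ge0// ltW.
  have Np : 0 < N by rewrite lt0r Nn0.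
  rewrite -(ler_pM2l Np) -expr2.
  have := @nrm_sqr_le u (fun x => C0 * N * bump 2 j x) Lu.
  have e2 : (fun x => modulus u x * (C0 * N * bump 2 j x)) =
      (fun x => C0 * N * (modulus u x * bump 2 j x)).
    by apply/funext => x; ring.
  rewrite e2 rintZ// => h.
  apply: le_trans (h _ _ _ (hQ j f Lf)) _.
  - by apply: measurable_funM => //; exact: measurable_bump tree 2 j.
  - by move=> x; rewrite !mulr_ge0 ?bump_ge0// ltW.
  - exact: riZ.
  - have CN : 0 <= C0 * N by rewrite mulr_ge0// ltW.
    apply: le_trans (ler_wpM2l CN ub) _.
    rewrite -/q -qi; apply: le_trans (ler_wpM2l CN (ler_wpM2l (nrm_ge0 _ _ _) bump2_norm)) _.
    by apply: eq_ler; ring.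
have {}hQ : \forall x \ae P, modulus u x <= C0 * N * bump 2 j x := hQ j f Lf.
have me0 : 0 <= mes (h1 j) `^ (p^-1 - 2^-1) by exact: powR_ge0.
have NB' : C0 * N * mes (h1 j) `^ (p^-1 - 2^-1) <= (C0 ^+ 2 * bc + 1) * nrm P p u.
  apply: (@le_trans _ _ (C0 ^+ 2 * bc * nrm P p u)); last first.
    by rewrite ler_wpM2r ?nrm_ge0// lerDl.
  rewrite -mulrA; apply: le_trans (ler_wpM2l (ltW C00) (ler_wpM2r me0 NB)) _.
  have -> : C0 * (C0 * bc * mes (h1 j) `^ e * nrm P p u * mes (h1 j) `^ (p^-1 - 2^-1)) =
    C0 ^+ 2 * bc * nrm P p u * (mes (h1 j) `^ e * mes (h1 j) `^ (p^-1 - 2^-1)) by ring.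
  by rewrite mm; apply: eq_ler; exact: mulr1.
apply: filterS hQ => x hx; apply: le_trans hx _.
have E2 : C0 * N * bump 2 j x = C0 * N * mes (h1 j) `^ (p^-1 - 2^-1) * bump p j x :=
  etrans (congr1 ( *%R (C0 * N)) (bump_change tree 2 p j x)) (mulrA _ _ _).
apply: le_trans (eq_ler E2) _; exact: ler_wpM2r (bump_ge0 P h1 h2 p j x) _ _ NB'.
Qed.

(** Here ||u||_2^2 = <f, u>, and [Q_bound] estimates this by C0 ||u||_2 times the pairing of |f|
    with the bump for exponent 2, which is |A'|^e times the weighted average. Taking the L^p norm of
    the pointwise bound of u then brings in |A'|^(-e), and the powers cancel. *)
Lemma Q_average p : 1 < p -> exists2 C : R, 0 < C & forall j f, L2 f ->
  nrm P p (Q j f) <= C * bavg p (modulus f) j.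
Proof.
move=> p1; have p0 : 0 < p by rewrite (lt_trans _ p1).
have p10 : 0 < p - 1 by rewrite subr_gt0.
have [C0 C00 hQ] := Q_bound Fbin Sfin Sstab.
pose q := p / (p - 1); have q1 : 1 < q by rewrite ltr_pdivlMr// mul1r gtrBl.
have q0 : 0 < q by rewrite (lt_trans _ q1).
have qi : q^-1 = 1 - p^-1 by rewrite /q; field; rewrite !gt_eqF.
have qq : q / (q - 1) = p.
  have -> : q - 1 = (p - 1)^-1 by rewrite /q; field; rewrite gt_eqF.
  by rewrite invrK /q divfK// gt_eqF.
pose bc := bump_cst p `^ p^-1; have bc0 : 0 <= bc by exact: powR_ge0.
exists (C0 ^+ 2 * bc + 1); first by rewrite ltr_wpDl// mulr_ge0 ?sqr_ge0.
move=> j f Lf; set u := Q j f.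
have Lu : L2 u := Q_L2 Fbin Sfin Sstab j Lf.
have Lpu : Lpfun P k p%:E u by exact: Q_Lp.
set N := nrm P 2 u; have N0 : 0 <= N by exact: nrm_ge0.
have m0 := st_pos tree j.
pose e := 2^-1 - p^-1.
have mm : mes (h1 j) `^ e * mes (h1 j) `^ (p^-1 - 2^-1) = 1.
  rewrite -powRD; last by rewrite (gt_eqF m0) implybT.
  by rewrite (_ : e + (p^-1 - 2^-1) = 0) ?powRr0// /e; ring.
have e1 : q^-1 - 2^-1 = e by rewrite qi /e; lra.
have If := L2_ri Lf.
have B0 : 0 <= bavg p (modulus f) j by apply: bavg_ge0 => x; exact: modulus_ge0.
have Ifb r : ri (fun x => bump r j x * modulus f x).
  have [M hM] := bump_bounded P h1 h2 r j.
  apply: ri_le (riZ M If).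
    by apply: measurable_funM; [exact: measurable_bump tree r j|exact: ri_meas If].
  move=> x; rewrite ger0_norm ?mulr_ge0 ?bump_ge0 ?modulus_ge0//.
  by rewrite ler_wpM2r ?modulus_ge0.
have fb : \int[P]_x (bump 2 j x * modulus f x) = mes (h1 j) `^ e * bavg p (modulus f) j.
  have := rint_bump tree j q1 If; rewrite qq => <-; rewrite -rintZ//.
  by apply: eq_Rintegral => x _; rewrite (bump_change tree 2 q) e1 mulrA.
have NB : N <= C0 * mes (h1 j) `^ e * bavg p (modulus f) j.
  have [->|Nn0] := eqVneq N 0.
    by rewrite mulr_ge0// mulr_ge0 ?powR_ge0// ltW.
  have Np : 0 < N by rewrite lt0r Nn0.
  rewrite -(ler_pM2l Np) -expr2.
  have -> : N ^+ 2 = \int[P]_x complex.Re (f x * conjc (u x)).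
    rewrite -Re_inner (Q_inner Fbin Sfin Sstab j Lf) (inner_self Lu) /=.
    by rewrite powR_mulrn ?nrm_ge0.
  apply: le_trans (_ : \int[P]_x (modulus f x * modulus u x) <= _).
    apply: rint_le; [exact: (ri_ReMJ Lf Lu)|exact: (ri_modulusM Lf Lu)|].
    by move=> x; apply: le_trans (ler_norm _) (abs_ReMJ _ _ _).
  apply: le_trans (_ : \int[P]_x (C0 * N * (bump 2 j x * modulus f x)) <= _).
    apply: rint_le_ae.
    - exact: ri_meas (ri_modulusM Lf Lu).
    - by move=> x; rewrite mulr_ge0 ?modulus_ge0.
    - by move=> x; rewrite !mulr_ge0 ?bump_ge0 ?modulus_ge0// ltW.
    - exact: riZ.
    - apply: filterS (hQ j f Lf) => x hx; rewrite [leLHS]mulrC mulrA.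
      by rewrite ler_wpM2r ?modulus_ge0.
  by rewrite rintZ// fb; apply: eq_ler; ring.
pose h x := C0 * N * bump 2 j x.
have CN : 0 <= C0 * N by rewrite mulr_ge0// ltW.
have hp0 : 0 <= C0 * N * mes (h1 j) `^ (p^-1 - 2^-1) by rewrite mulr_ge0 ?powR_ge0.
have hE : (fun x => h x `^ p) =
    fun x => (C0 * N * mes (h1 j) `^ (p^-1 - 2^-1)) `^ p * bump p j x `^ p.
  apply/funext => x; rewrite /h (bump_change tree 2 p) mulrA powRM//.
  exact: bump_ge0.
have ib := ri_bump tree p j (ltW p0).
have ih : ri (fun x => h x `^ p) by rewrite hE; exact: riZ.
have [_ hu] := Lpfun_dom p0 (Lpfun_mfun Lu)
  (fun x => mulr_ge0 CN (bump_ge0 P h1 h2 2 j x)) ih (hQ j f Lf).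
rewrite hE in hu; apply: le_trans hu _.
rewrite rintZ// powRM ?powR_ge0 ?powRKV//; last first.
  by apply: Rintegral_ge0 => x _; exact: powR_ge0.
apply: le_trans (_ : C0 ^+ 2 * bc * bavg p (modulus f) j <= _); last first.
  by rewrite ler_wpM2r// lerDl.
apply: le_trans (_ : C0 * N * mes (h1 j) `^ (p^-1 - 2^-1) * bc <= _).
  rewrite ler_wpM2l//; apply: le_powR; rewrite ?invr_ge0 ?(ltW p0)//.
    by apply: Rintegral_ge0 => x _; exact: powR_ge0.
  exact: bump_norm.
rewrite -!mulrA; have me0 : 0 <= mes (h1 j) `^ (p^-1 - 2^-1) * bc.
  by rewrite mulr_ge0// powR_ge0.
apply: le_trans (ler_wpM2l (ltW C00) (ler_wpM2r me0 NB)) _.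
have -> : C0 * (C0 * mes (h1 j) `^ e * bavg p (modulus f) j *
    (mes (h1 j) `^ (p^-1 - 2^-1) * bc)) =
  C0 ^+ 2 * (bc * bavg p (modulus f) j) * (mes (h1 j) `^ e * mes (h1 j) `^ (p^-1 - 2^-1)).
  by ring.
by rewrite mm; apply: eq_ler; ring.
Qed.

End increments.

Lemma powRX {R : realType} (a b : R) i : 0 <= a -> (a ^+ i) `^ b = (a `^ b) ^+ i.
Proof.
move=> a0; elim: i => [|i IH]; first by rewrite !expr0 powR1.
by rewrite !exprS powRM ?exprn_ge0// IH.
Qed.

(** * Bernstein and Jackson inequalities for the increments *)

Section levels.
Context d {T : measurableType d} {R : realType}.
Variables (P : probability T R) (k : scalar_kind).
Variables (F : nat -> set (set T)) (S : set (cfun T R)).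
Hypothesis Fbin : binary_filtration P F.
Hypothesis Sfin : fin_dim_space k S.
Hypothesis Sstab : stability P F S.
Variables (p tau : R).
Hypotheses (p1 : 1 < p) (tau0 : 0 < tau) (taup : tau < p).
Implicit Types (f g h : cfun T R).
Notation L2 := (Lpfun P k 2%:E).
Notation Q := (orth_proj_diff P F S).
Notation beta := (tau^-1 - p^-1).

Let tree := halves_tree Fbin.

Let p0 : 0 < p. Proof. by rewrite (lt_trans _ p1). Qed.

Lemma beta_gt0 : 0 < beta.
Proof. by rewrite subr_gt0 ltf_pV2. Qed.

Lemma bernstein_levels : exists2 C : R, 0 < C & forall f J (G : {set 'I_J}), L2 f ->
  Lpfun P k p%:E f ->
  \sum_(j in G) nrm P p (Q j f) `^ tau <= (C * #|G|%:R `^ beta * nrm P p f) `^ tau.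
Proof.
have [C C0 hC] := Q_average Fbin Sfin Sstab p1.
pose W := bavg_cst p tau; have W0 : 0 <= W by exact: bavg_cst_ge0.
exists (C * W `^ tau^-1 + 1); first by rewrite ltr_wpDl// mulr_ge0 ?powR_ge0 ?ltW.
move=> f J G Lf Lpf.
have m0 x : 0 <= modulus f x by exact: modulus_ge0.
have tp : 0 < tau < p by rewrite tau0.
have := bavg_sum tree G p1 tp m0 (L2_ri Lf) (Lpfun_ri p0 Lpf).
set I := (\int[P]_x _); set n : R := #|G|%:R.
have I0 : 0 <= I by apply: Rintegral_ge0 => x _; exact: powR_ge0.
have -> : I `^ (tau / p) = nrm P p f `^ tau.
  by rewrite /I -(nrm_pow P f p0) -powRrM mulrCA mulfV ?mulr1 ?gt_eqF.
have -> : n `^ (1 - tau / p) = (n `^ beta) `^ tau.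
  by rewrite -powRrM mulrBl mulVf ?gt_eqF// mulrC.
have -> : bavg_cst p tau = (W `^ tau^-1) `^ tau by rewrite powRVK.
rewrite powRM3; [|exact: powR_ge0|exact: nrm_ge0|exact: powR_ge0] => hB.
set V := W `^ tau^-1 in hB *; have V0 : 0 <= V by exact: powR_ge0.
apply: (@le_trans _ _ (\sum_(j in G) C `^ tau *
    bavg P (half1 Fbin) (half2 Fbin) p (modulus f) j `^ tau)).
  apply: ler_sum => j _; rewrite -powRM; [|exact: ltW|exact: bavg_ge0].
  by apply: le_powR; [exact: ltW|exact: nrm_ge0|exact: hC].
rewrite -mulr_sumr; apply: le_trans (ler_wpM2l (powR_ge0 _ _) hB) _.
have a0 : 0 <= nrm P p f by exact: nrm_ge0.
have b0 : 0 <= n `^ beta by exact: powR_ge0.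
clear hB; move: (nrm P p f) (n `^ beta) V a0 b0 V0 => x y V x0 y0 V0.
rewrite -powRM; [|exact: ltW|by rewrite mulr_ge0// mulr_ge0].
apply: le_powR; [exact: ltW|by rewrite mulr_ge0 ?(ltW C0)// mulr_ge0// mulr_ge0|].
by rewrite -subr_ge0 (_ : _ - _ = y * x) ?mulr_ge0//; ring.
Qed.

(** The increments are bounded pointwise by C t times their bumps, so the bound for sums of bumps
    applies; the upper estimate is insensitive to cancellation. *)
Lemma upper_levels : exists2 C : R, 0 < C & forall f J (G : {set 'I_J}) (t : R), L2 f ->
  0 <= t -> (forall j, j \in G -> nrm P p (Q j f) <= t) ->
  nrm P p (\sum_(j in G) Q j f) <= C * t * #|G|%:R `^ p^-1.
Proof.
have [C C0 hC] := Q_upper Fbin Sfin Sstab p1.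
pose W := bavg_cst (p / (p - 1)) 1.
have W0 : 0 <= W.
  have p10 : 0 < p - 1 by rewrite subr_gt0.
  by apply: bavg_cst_ge0; rewrite ltr_pdivlMr// mul1r gtrBl.
exists (C * W + 1); first by rewrite ltr_wpDl// mulr_ge0// ltW.
move=> f J G t Lf t0 ht.
pose B x := \sum_(j in G) bump P (half1 Fbin) (half2 Fbin) p j x.
have B0 x : 0 <= B x by apply: sumr_ge0 => j _; exact: bump_ge0.
have Ct : 0 <= C * t by rewrite mulr_ge0// ltW.
have mB : measurable_fun setT B.
  rewrite (_ : B = fun x => \sum_(j <- enum G) bump P (half1 Fbin) (half2 Fbin) p j x).
    by apply: measurable_sum => j; exact: (measurable_bump tree).
  by apply/funext => x; rewrite /B big_enum.
have iB : P.-integrable setT (EFin \o (fun x => B x `^ p)).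
  have /choice[N hN] j := bump_bounded P (half1 Fbin) (half2 Fbin) p j.
  apply: (@ri_bounded _ _ _ _ _ ((\sum_(j in G) N j) `^ p)).
    exact: measurableT_comp (measurable_powR p) mB.
  move=> x; rewrite ger0_norm ?powR_ge0//; apply: le_powR => //; first exact: ltW.
  by apply: ler_sum => j _; exact: hN.
have hb : \forall x \ae P, forall j : nat, modulus (Q j f) x <=
    C * nrm P p (Q j f) * bump P (half1 Fbin) (half2 Fbin) p j x.
  by apply: ae_foralln => j; exact: hC.
have mS : scalar_mfun k (\sum_(j in G) Q j f).
  by apply: scalar_mfun_sum => j _; exact: Lpfun_mfun (Q_L2 Fbin Sfin Sstab j Lf).
have [_] : Lpfun P k p%:E (\sum_(j in G) Q j f) /\ nrm P p (\sum_(j in G) Q j f) <=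
    (\int[P]_x ((C * t * B x) `^ p)) `^ p^-1.
  apply: Lpfun_dom => //.
  - by move=> x; rewrite mulr_ge0.
  - apply: eq_integrable (riZ ((C * t) `^ p) iB) => // x _ /=.
    by congr (_%:E); rewrite [RHS]powRM.
  - apply: filterS hb => x hx.
    apply: le_trans (_ : \sum_(j in G) modulus (Q j f) x <= _).
      elim/big_rec2: _ => [|j y1 y2 _ IH]; first by rewrite modulus0.
      by apply: le_trans (modulusD _ _ _) _; rewrite lerD2l.
    rewrite /B mulr_sumr; apply: ler_sum => j jG; apply: le_trans (hx j) _.
    by rewrite ler_wpM2r ?bump_ge0// ler_wpM2l ?(ltW C0)// ht.
have -> : \int[P]_x ((C * t * B x) `^ p) = (C * t) `^ p * \int[P]_x (B x `^ p).
  by rewrite -rintZ//; apply: eq_Rintegral => x _; rewrite powRM.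
have IB0 : 0 <= \int[P]_x (B x `^ p) by apply: Rintegral_ge0 => x _; exact: powR_ge0.
rewrite powRM ?powR_ge0// powRKV// => h; apply: le_trans h _.
have hB := bump_sum_norm tree G p1; rewrite -/W in hB.
apply: le_trans (_ : C * t * (W * #|G|%:R `^ p^-1) <= _).
  rewrite ler_wpM2l//; have -> : W * #|G|%:R `^ p^-1 = (W `^ p * #|G|%:R) `^ p^-1.
    by rewrite powRM ?powR_ge0// powRKV.
  by apply: le_powR; rewrite ?invr_ge0 ?(ltW p0).
rewrite -subr_ge0 (_ : _ - _ = t * #|G|%:R `^ p^-1); last by ring.
by rewrite mulr_ge0 ?powR_ge0.
Qed.

(* Keep the steps with ||Q_j f|| > B (N+1)^(-1/tau) and group the others by the
   thresholds t_i = B (2^i (N+1))^(-1/tau): at most 2^(i+1) (N+1) steps lie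
   between t_(i+1) and t_i. *)
Lemma jackson_levels : exists2 C : R, 0 < C & forall f J (N : nat) (B : R), L2 f ->
  0 <= B -> \sum_(j < J) nrm P p (Q j f) `^ tau <= B `^ tau ->
  exists2 G : {set 'I_J}, (#|G| <= N)%N &
    nrm P p (\sum_(j in ~: G) Q j f) <= C * N.+1%:R `^ (- beta) * B.
Proof.
have [C C0 hC] := upper_levels.
pose K : R := 2 `^ beta; have K1 : 1 < K by rewrite powR2_gt1// beta_gt0.
exists (C * (2 `^ p^-1 * (K / (K - 1)) + 1)).
  rewrite mulr_gt0// ltr_wpDl// mulr_ge0 ?powR_ge0 ?divr_ge0 ?powR_ge0//.
  by rewrite subr_ge0 ltW.
move=> f J N B Lf B0 hB.
pose q (j : 'I_J) := nrm P p (Q j f).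
have q0 j : 0 <= q j by exact: nrm_ge0.
pose n : R := N.+1%:R; have n0 : 0 < n by rewrite ltr0n.
pose t i := B * (2 ^+ i * n) `^ (- tau^-1).
have s0 i : 0 < 2 ^+ i * n by rewrite mulr_gt0// exprn_gt0.
have t0 i : 0 <= t i by rewrite mulr_ge0// powR_ge0.
have tt i : t i `^ tau * (2 ^+ i * n) = B `^ tau.
  rewrite /t powRM ?powR_ge0// -powRrM mulNr mulVf ?gt_eqF//.
  by rewrite powR_inv1 ?(ltW (s0 i))// divfK// gt_eqF.
have td i : t i.+1 <= t i.
  rewrite /t ler_wpM2l// !powRN lef_pV2 ?posrE ?powR_gt0//.
  apply: le_powR; rewrite ?invr_ge0 ?(ltW tau0) ?(ltW (s0 _))//.
  by rewrite ler_pM2r// exprS ler_peMl ?exprn_ge0// ler1n.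
pose Z i := [set j : 'I_J | q j <= t i]%SET.
have cnt i : #|~: Z i|%:R * t i `^ tau <= \sum_(j in ~: Z i) q j `^ tau.
  rewrite mulr_natl -sumr_const; apply: ler_sum => j; rewrite !inE -ltNge => h.
  by apply: le_powR; rewrite ?(ltW tau0)// ltW.
have qB i : \sum_(j in ~: Z i) q j `^ tau <= B `^ tau.
  apply: le_trans hB; rewrite [leRHS](bigID (mem (~: Z i)))/=.
  by rewrite lerDl sumr_ge0// => j _; exact: powR_ge0.
exists (~: Z 0%N).
  (* More than N steps strictly above the threshold t_0 would carry more than (N+1) t_0^tau =
     B^tau. *)
  rewrite leqNgt; apply/negP => hn.
  have /card_gt0P[j0 j0Z] : (0 < #|~: Z 0%N|)%N by exact: leq_ltn_trans hn.
  have lt : #|~: Z 0%N|%:R * t 0%N `^ tau < B `^ tau.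
    apply: lt_le_trans (qB 0%N); rewrite mulr_natl -sumr_const; apply: ltr_sum.
      by apply/hasP; exists j0 => //; exact: mem_index_enum.
    move=> j; rewrite !inE -ltNge => h.
    by apply: gt0_ltr_powR; rewrite ?nnegrE.
  move: lt; rewrite -(tt 0%N) expr0 mul1r ltNge mulrC => /negP; apply.
  by rewrite ler_wpM2r ?powR_ge0// ler_nat.
rewrite finset.setCK.
pose q' (A : {set 'I_J}) := nrm P p (\sum_(j in A) Q j f).
have LQ (A : {set 'I_J}) : Lpfun P k p%:E (\sum_(j in A) Q j f).
  by apply: Lpfun_sum; [exact: ltW|move=> j _; exact: Q_Lp].
pose c := B * n `^ (- beta); have c0 : 0 <= c by rewrite mulr_ge0// powR_ge0.
have tc i : t i * (2 ^+ i * n) `^ p^-1 = c * K ^- i.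
  rewrite /t /c /K -mulrA -powRD; last by rewrite (gt_eqF (s0 i)) implybT.
  rewrite (_ : - tau^-1 + p^-1 = - beta); last by rewrite opprB addrC.
  rewrite powRM ?exprn_ge0 ?(ltW n0)// -mulrA; congr (_ * _); rewrite mulrC; congr (_ * _).
  by rewrite powRN powRX.
have cntZ i : B != 0 -> #|~: Z i|%:R <= 2 ^+ i * n.
  move=> Bn; have tp : 0 < t i `^ tau by rewrite powR_gt0// mulr_gt0 ?powR_gt0// lt0r Bn.
  by rewrite -(ler_pM2r tp); apply: le_trans (cnt i) (le_trans (qB i) _); rewrite -(tt i) mulrC.
have step i : q' (Z i) <= q' (Z i.+1) + C * (2 `^ p^-1 * (c * K ^- i)).
  have ZZ : Z i :&: Z i.+1 = Z i.+1.
    apply/finset.setIidPr/fintype.subsetP => j; rewrite !inE => h.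
    exact: le_trans h (td i).
  rewrite {1}/q' (big_setID (Z i.+1))/= ZZ; apply: le_trans (nrmD (ltW p1) (LQ _) (LQ _)) _.
  rewrite lerD2l; apply: le_trans (hC f J (Z i :\: Z i.+1) (t i) Lf (t0 i) _) _.
    by move=> j; rewrite !inE => /andP[].
  have [Bz|Bn] := eqVneq B 0.
    rewrite /t Bz mul0r mulr0 mul0r mulr_ge0 ?(ltW C0)// mulr_ge0 ?powR_ge0//.
    by rewrite mulr_ge0// invr_ge0 exprn_ge0// powR_ge0.
  rewrite -mulrA ler_wpM2l ?(ltW C0)// -tc mulrCA ler_wpM2l//.
  rewrite -powRM ?(ltW (s0 i))// mulrA -exprS; apply: le_powR => //.
    by rewrite invr_ge0 ltW.
  apply: le_trans (cntZ i.+1 Bn); rewrite ler_nat subset_leq_card//.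
  by apply/fintype.subsetP => j; rewrite !inE => /andP[].
have all I : q' (Z 0%N) <= q' (Z I) + \sum_(i < I) C * (2 `^ p^-1 * (c * K ^- i)).
  elim: I => [|I IH]; first by rewrite big_ord0 addr0.
  rewrite big_ord_recr/=; apply: le_trans IH _.
  move: (\sum_(i < I) _) => s; rewrite [leRHS]addrA [leRHS]addrAC lerD2r.
  exact: step.
apply: le_trans (all J) _.
(* After J thresholds the crude count J <= 2^J of all remaining steps is good enough. *)
have last : q' (Z J) <= C * c.
  apply: le_trans (hC f J (Z J) (t J) Lf (t0 J) _) _; first by move=> j; rewrite inE.
  rewrite -mulrA ler_wpM2l ?(ltW C0)//; apply: le_trans (_ : t J * (2 ^+ J * n) `^ p^-1 <= _).
    rewrite ler_wpM2l//; apply: le_powR; [by rewrite invr_ge0 ltW|by []|].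
    apply: le_trans (_ : J%:R <= _).
      by rewrite ler_nat; apply: leq_trans (max_card _) _; rewrite card_ord.
    apply: le_trans (_ : 2 ^+ J <= _); first by rewrite -natrX ler_nat ltnW// ltn_expl.
    by rewrite ler_peMr ?exprn_ge0// ler1n.
  rewrite tc ler_piMr// invf_le1 ?exprn_gt0 ?(lt_trans _ K1)//.
  by rewrite exprn_ege1// ltW.
apply: le_trans (lerD last (_ : _ <= C * (2 `^ p^-1 * (c * (K / (K - 1)))))) _.
  rewrite -!mulr_sumr ler_wpM2l ?(ltW C0)// ler_wpM2l ?powR_ge0// ler_wpM2l//.
  exact: sum_geo_inv_le.
by apply: eq_ler; rewrite /c -/n; ring.
Qed.

(* For tau < 1 the l^tau norm is only a quasi-norm; the surplus K^-i in the decay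
   of the summands absorbs its constant. *)
Lemma quasi_sum (K : R) : 1 < K -> exists2 C : R, 0 < C &
  forall (I J : nat) (y : nat -> cfun T R) (M : R), 0 <= M -> (forall i, L2 (y i)) ->
  (forall i, (i < I)%N -> \sum_(j < J) nrm P p (Q j (y i)) `^ tau <=
                          (M * K ^- (2 * i)) `^ tau) ->
  \sum_(j < J) nrm P p (Q j (\sum_(i < I) y i)) `^ tau <= (C * M) `^ tau.
Proof.
move=> K1; have K0 : 0 < K by rewrite (lt_trans _ K1).
pose Kt := K `^ tau; have Kt1 : 1 < Kt.
  have : 1 `^ tau < K `^ tau by apply: gt0_ltr_powR; rewrite ?nnegrE ?ltW.
  by rewrite powR1.
have g0 : 0 < Kt / (Kt - 1) by rewrite divr_gt0 ?subr_gt0// (lt_trans ltr01 Kt1).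
have k0 : 0 < K / (K - 1) by rewrite divr_gt0 ?subr_gt0.
exists (K / (K - 1) * (Kt / (Kt - 1)) `^ tau^-1).
  by rewrite mulr_gt0// powR_gt0.
move=> I J y M M0 Ly hy.
have t1 : 1 <= 2 :> R by rewrite ler1n.
have LQ i j : Lpfun P k p%:E (Q j (y i)) by exact: Q_Lp.
have le1 (j : 'I_J) : nrm P p (Q j (\sum_(i < I) y i)) <= \sum_(i < I) nrm P p (Q j (y i)).
  have LS : L2 (\sum_(i < I) y i) by apply: Lpfun_sum.
  have -> : nrm P p (Q j (\sum_(i < I) y i)) = nrm P p (\sum_(i < I) Q j (y i)).
    apply: (@nrm_ae _ _ _ P k).
    - exact: Lpfun_mfun (Q_L2 Fbin Sfin Sstab j LS).
    - by apply: scalar_mfun_sum => i _; exact: Lpfun_mfun (LQ i j).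
    - apply: filterS (Q_sum_ae Fbin Sfin Sstab j (index_enum 'I_I) (fun i : 'I_I => Ly i)) => x ->.
      by rewrite sum_cfunE.
  by apply: (@nrm_sum _ _ _ P k); [exact: ltW|move=> i _].
pose x i (j : 'I_J) := nrm P p (Q j (y i)).
have x0 i j : 0 <= x i j by exact: nrm_ge0.
apply: le_trans (_ : \sum_(j < J) (K / (K - 1)) `^ tau * \sum_(i < I) (K ^+ i * x i j) `^ tau <= _).
  apply: ler_sum => j _; apply: le_trans (@wsum_powR R K tau I (fun i => x i j) K1 tau0 _).
    by apply: le_powR; [exact: ltW|exact: nrm_ge0|exact: le1].
  by move=> i; exact: x0.
rewrite -mulr_sumr exchange_big/= -mulrA (powRM _ (ltW k0)); last by apply: mulr_ge0 => //; exact: powR_ge0.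
rewrite ler_wpM2l ?powR_ge0// powRM ?powR_ge0// powRVK ?(ltW g0)//.
apply: le_trans (_ : \sum_(i < I) M `^ tau * Kt ^- i <= _); last first.
  by rewrite -mulr_sumr mulrC ler_wpM2r ?powR_ge0// sum_geo_inv_le.
apply: ler_sum => i _.
rewrite (eq_bigr (fun j => (K ^+ i) `^ tau * x i j `^ tau)); last first.
  by move=> j _; rewrite powRM// exprn_ge0// ltW.
rewrite -mulr_sumr; apply: le_trans (ler_wpM2l (powR_ge0 _ _) (hy i (ltn_ord i))) _.
have Ki : 0 < K ^+ i by rewrite exprn_gt0.
rewrite -powRM ?mulr_ge0 ?invr_ge0 ?exprn_ge0 ?(ltW K0)//.
have -> : K ^+ i * (M * K ^- (2 * i)) = M * K ^- i.
  by rewrite mul2n -addnn exprD; field; rewrite gt_eqF.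
rewrite powRM ?invr_ge0 ?(ltW Ki)// powRV ?(ltW Ki)// ler_wpM2l ?powR_ge0//.
by rewrite /Kt powRX ?(ltW K0).
Qed.

End levels.

(** * Approximation numbers and Hardy inequalities *)

Section terms.
Context {R : realType} {V : lmodType R[i]}.
Variables (k : scalar_kind) (D : set V).
Notation nterm := (nterm (scalars k) D).

Lemma nterm_le n m : (n <= m)%N -> nterm n `<=` nterm m.
Proof. by move=> nm y [l [c [x [ln kc Dx ->]]]]; exists l, c, x; split=> //; exact: leq_trans nm. Qed.

Lemma nterm0 n : nterm n 0.
Proof.
exists 0%N, (fun=> 0), (fun=> 0); split => //; [by case|by case|by rewrite big_ord0].
Qed.

Lemma nterm1 c x : scalars k c -> D x -> nterm 1 (c *: x).
Proof. by move=> kc Dx; exists 1%N, (fun=> c), (fun=> x); split => //; rewrite big_ord1. Qed.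

Lemma ntermD n m y z : nterm n y -> nterm m z -> nterm (n + m) (y + z).
Proof.
move=> [l [c [x [ln kc Dx ->]]]] [l' [c' [x' [ln' kc' Dx' ->]]]].
exists (l + l')%N, (fun i => match fintype.split i with inl a => c a | inr b => c' b end),
  (fun i => match fintype.split i with inl a => x a | inr b => x' b end); split.
- exact: leq_add.
- by move=> j; case: fintype.split.
- by move=> j; case: fintype.split.
- rewrite big_split_ord/=; congr (_ + _); apply: eq_bigr => i _.
    by rewrite (unsplitK (inl i : 'I_l + 'I_l')%type).
  by rewrite (unsplitK (inr i : 'I_l + 'I_l')%type).
Qed.

Lemma ntermZ n c y : scalars k c -> nterm n y -> nterm n (c *: y).
Proof.
move=> kc [l [c' [x [ln kc' Dx ->]]]]; exists l, (fun i => c * c' i), x; split => //.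
  by move=> j; exact: scalarsM.
by rewrite scaler_sumr; apply: eq_bigr => i _; rewrite scalerA.
Qed.

Lemma ntermN n y : nterm n y -> nterm n (- y).
Proof. by move=> ny; rewrite -scaleN1r; apply: ntermZ => //; exact/scalarsN/scalars1. Qed.

Lemma nterm_sum (I : Type) (s : seq I) (Q : pred I) (n : I -> nat) (y : I -> V) :
  (forall i, Q i -> nterm (n i) (y i)) ->
  nterm (\sum_(i <- s | Q i) n i) (\sum_(i <- s | Q i) y i).
Proof.
move=> h; elim/big_rec2: _ => [|i y1 n1 Qi IH]; first exact: nterm0.
by apply: ntermD => //; exact: h.
Qed.

End terms.

Section approximation_numbers.
Context d {T : measurableType d} {R : realType}.
Variables (P : probability T R) (k : scalar_kind) (p : R) (D : set (cfun T R)).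
Hypothesis p1 : 1 <= p.
Notation Lp := (Lpfun P k p%:E).
Notation N := (Lpnorm P p%:E).
Notation K := (scalars k).
Hypothesis DLp : D `<=` Lp.
Notation nterm := (nterm K D).
Implicit Types (x y : cfun T R).

Let p0 : 0 < p. Proof. exact: lt_le_trans p1. Qed.

Definition approx_num n x : R := fine (best_approx K N D n x).
Notation E := approx_num.

Lemma nterm_Lp n y : nterm n y -> Lp y.
Proof.
move=> [l [c [x [_ kc Dx ->]]]]; apply: Lpfun_sum => // i _.
by apply: LpfunZ => //; exact: DLp.
Qed.

Lemma best_approx_ge0 n x : (0 <= best_approx K N D n x)%E.
Proof. by apply: le_ereal_inf_tmp => _ [y _ <-]; exact: Lnorm_ge0. Qed.

Lemma best_approxE n x : Lp x -> best_approx K N D n x = (E n x)%:E.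
Proof.
move=> Lx; rewrite fineK// ge0_fin_numE ?best_approx_ge0//.
apply: (@le_lt_trans _ _ (N x)); last by case: Lx.
by apply: ereal_inf_lbound; exists 0; [exact: nterm0|rewrite subr0].
Qed.

Lemma approx_num_ge0 n x : 0 <= E n x.
Proof. by apply: fine_ge0; exact: best_approx_ge0. Qed.

Lemma approx_num_le n x y : Lp x -> nterm n y -> E n x <= nrm P p (x - y).
Proof.
move=> Lx ny; have Ly := nterm_Lp ny; have LB := LpfunB p1 Lx Ly.
rewrite -lee_fin -best_approxE// -(LpnormE p0 LB).
by apply: ereal_inf_lbound; exists y.
Qed.

Lemma approx_num_near n x (e : R) : Lp x -> 0 < e ->
  exists2 y, nterm n y & nrm P p (x - y) < E n x + e.
Proof.
move=> Lx e0; have h : best_approx K N D n x \is a fin_num by rewrite best_approxE.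
have [_ [y ny <-]] := lb_ereal_inf_adherent e0 h.
have LB := LpfunB p1 Lx (nterm_Lp ny).
rewrite (LpnormE p0 LB) -/(best_approx K N D n x) best_approxE// -EFinD lte_fin => lt.
by exists y.
Qed.

Lemma approx_numP n x (M : R) : Lp x -> (forall y, nterm n y -> M <= nrm P p (x - y)) ->
  M <= E n x.
Proof.
move=> Lx h; apply/ler_addgt0Pr => e e0; have [y ny lt] := approx_num_near n Lx e0.
exact: le_trans (h y ny) (ltW lt).
Qed.

Lemma approx_num_nrm n x : Lp x -> E n x <= nrm P p x.
Proof. by move=> Lx; have := approx_num_le Lx (nterm0 k D n); rewrite subr0. Qed.

Lemma approx_num_anti n m x : Lp x -> (n <= m)%N -> E m x <= E n x.
Proof.
move=> Lx nm; apply: approx_numP => // y ny; apply: approx_num_le => //.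
exact: nterm_le nm y ny.
Qed.

Lemma approx_numD n m x y : Lp x -> Lp y -> E (n + m) (x + y) <= E n x + E m y.
Proof.
move=> Lx Ly; rewrite -lerBlDr; apply: approx_numP => // x' nx.
rewrite lerBlDr -lerBlDl; apply: approx_numP => // y' ny.
rewrite lerBlDl; apply: le_trans (approx_num_le (LpfunD p1 Lx Ly) (ntermD nx ny)) _.
rewrite opprD addrACA; apply: (@nrmD _ _ _ P k) => //.
  exact: LpfunB (nterm_Lp nx).
exact: LpfunB (nterm_Lp ny).
Qed.

Lemma approx_num_lip n x y : Lp x -> Lp y -> E n x <= E n y + nrm P p (x - y).
Proof.
move=> Lx Ly; have := approx_numD n 0 Ly (LpfunB p1 Lx Ly).
rewrite addn0 addrC subrK => h; apply: le_trans h _; rewrite lerD2l.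
by apply: approx_num_nrm; exact: LpfunB.
Qed.

Lemma approx_numZ n (a : R) x : Lp x -> E n ((a%:C)%C *: x) <= `|a| * E n x.
Proof.
move=> Lx; have ka : K (a%:C)%C by exact: scalars_real.
have h y : nterm n y -> E n ((a%:C)%C *: x) <= `|a| * nrm P p (x - y).
  move=> ny; rewrite -(normcZ_real a) -(nrmZ _ p0 (LpfunB p1 Lx (nterm_Lp ny))) scalerBr.
  by apply: approx_num_le; [exact: LpfunZ|exact: ntermZ].
have [a0|a0] := eqVneq a 0.
  by apply: le_trans (h 0 (nterm0 _ _ _)) _; rewrite a0 normr0 !mul0r.
have a1 : 0 < `|a| by rewrite normr_gt0.
rewrite -ler_pdivrMl//; apply: approx_numP => // y ny.
by rewrite ler_pdivrMl//; exact: h.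
Qed.

End approximation_numbers.

Section ell_q.
Context {R : realType}.
Implicit Types (a b : nat -> R) (M u : R) (q : \bar R).

Lemma nneseries_powR_le a (t M : R) : 0 < t -> (forall n, 0 <= a n) -> 0 <= M ->
  ((\sum_(0 <= j <oo) (a j)%:E `^ t) `^ t^-1 <= M%:E)%E <->
  forall n, \sum_(j < n) a j `^ t <= M `^ t.
Proof.
move=> t0 a0 M0; set X := (\sum_(0 <= j <oo) _)%E.
have u0 n : (0 <= n)%N -> true -> (0 <= (a n)%:E `^ t)%E by move=> _ _; exact: poweR_ge0.
have X0 : (0 <= X)%E by exact: nneseries_ge0.
have pE n : (\sum_(0 <= j < n) (a j)%:E `^ t)%E = (\sum_(j < n) a j `^ t)%:E.
  by rewrite big_mkord sumEFin.
split=> [h n|h].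
  have hX : (X <= (M `^ t)%:E)%E.
    rewrite -poweR_EFin.
    have -> : X = ((X `^ t^-1) `^ t)%E by rewrite -poweRrM mulVf ?gt_eqF// poweRe1.
    by apply: gt0_ler_poweR => //; rewrite ?ltW// in_itv/= leey andbT ?poweR_ge0 ?lee_fin.
  rewrite -lee_fin -pE; apply: le_trans hX.
  exact: nneseries_lim_ge.
have hX : (X <= (M `^ t)%:E)%E.
  apply: lime_le; first exact: is_cvg_nneseries.
  by apply: nearW => n; rewrite pE lee_fin.
have -> : M%:E = (((M `^ t)%:E) `^ t^-1)%E by rewrite poweR_EFin powRKV.
apply: gt0_ler_poweR => //; rewrite ?invr_ge0 ?ltW// in_itv/= leey andbT//.
by rewrite lee_fin powR_ge0.
Qed.

(** The bound ||a||_q <= M for nonnegative sequences, phrased through partial sums so that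
    convergence questions disappear. Only q > 0 occurs, and -oo is sent to False. *)
Definition lq_le q a M : Prop :=
  match q with
  | r%:E => forall n, \sum_(j < n) a j `^ r <= M `^ r
  | +oo%E => forall n, a n <= M
  | -oo%E => False
  end.

Lemma counting_ae (Q : nat -> Prop) : (\forall n \ae (@counting nat R), Q n) -> forall n, Q n.
Proof.
move=> [A [mA A0 sA]] n; apply: contrapT => nQ.
have An : A n by exact: sA.
have : (counting [set n] <= counting A :> \bar R)%E.
  by apply: le_measure; rewrite ?inE// => _ ->.
by rewrite [X in (_ <= X)%E]A0 /counting asboolT// fset_set1 lee_fin finmap.cardfs1 ler10.
Qed.

Lemma Lnorm_countingP q a M : (0 < q)%E -> (forall n, 0 <= a n) -> 0 <= M ->
  (Lnorm counting q (EFin \o a) <= M%:E)%E <-> lq_le q a M.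
Proof.
case: q => [r| |//] q0 a0 M0.
  rewrite Lnorm_counting// (eq_eseriesr (g := fun j => ((a j)%:E `^ r)%E)).
    exact: nneseries_powR_le.
  by move=> i _; rewrite /= ger0_norm.
have c0 : (0 < @counting nat R setT)%E.
  by rewrite /counting asboolF ?ltry//; exact: infinite_nat.
rewrite unlock c0; split=> [/ess_supP/counting_ae h n|h].
  by have := h n; rewrite /= ger0_norm// lee_fin.
by apply/ess_supP; apply: aeW => n; rewrite /= ger0_norm// lee_fin.
Qed.

Lemma lq_le_scale q a b (C M : R) : (0 < q)%E -> (forall n, 0 <= b n) -> 0 <= M -> 0 <= C ->
  (forall n, 0 <= a n) -> (forall n, b n <= C * a n) -> lq_le q a M -> lq_le q b (C * M).
Proof.
case: q => [r| |//] q0 b0 M0 C0 a0 ba /= h n; last first.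
  by apply: le_trans (ba n) _; rewrite ler_wpM2l.
have r0 : 0 <= r by rewrite ltW.
rewrite powRM//; apply: le_trans (ler_wpM2l (powR_ge0 _ _) (h n)).
by rewrite mulr_sumr; apply: ler_sum => i _; rewrite -powRM//; exact: le_powR.
Qed.

(** The discrete Hardy operator with geometric kernel. In the applications [a] consists of
    approximation numbers, possibly weighted, and [u] is the norm of the function, standing for a
    term before index 0. Stopping the sum at i < n gives the simple recursion of [hardy_seqS]. *)
Definition hardy_seq (K u : R) a n : R := K ^+ n * u + \sum_(i < n) K ^+ (n - i) * a i.

Lemma hardy_seqS K u a n : hardy_seq K u a n.+1 = K * (hardy_seq K u a n + a n).
Proof.
rewrite /hardy_seq big_ord_recr/= subSnn expr1 exprS.
rewrite (eq_bigr (fun i : 'I_n => K * (K ^+ (n - i) * a i))); last first.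
  by move=> i _; rewrite subSn ?(ltnW (ltn_ord i))// exprS mulrA.
by rewrite -mulr_sumr; ring.
Qed.

Lemma hardy_seq_ge0 K u a n : 0 <= K -> 0 <= u -> (forall n, 0 <= a n) ->
  0 <= hardy_seq K u a n.
Proof.
move=> K0 u0 a0; rewrite addr_ge0 ?mulr_ge0 ?exprn_ge0//.
by apply: sumr_ge0 => i _; rewrite mulr_ge0 ?exprn_ge0.
Qed.

(* Compare y with e * x, where e is chosen such that K (1 + e) = (1 + K) / 2. *)
Lemma hardy_step (K r : R) : 0 < K < 1 -> 0 < r -> exists l C : R,
  [/\ 0 <= l < 1, 0 <= C & forall x y, 0 <= x -> 0 <= y ->
    (K * (x + y)) `^ r <= l * x `^ r + C * y `^ r].
Proof.
move=> /andP[K0 K1] r0; pose e : R := (1 - K) / (2 * K).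
have e0 : 0 < e by rewrite divr_gt0 ?subr_gt0 ?mulr_gt0.
pose mu : R := (1 + K) / 2; have mu0 : 0 < mu by rewrite /mu; lra.
have mu1 : mu < 1 by rewrite /mu; lra.
exists (mu `^ r), ((K * (e^-1 + 1)) `^ r); split; rewrite ?powR_ge0//=.
  have : mu `^ r < 1 `^ r by apply: gt0_ltr_powR; rewrite ?nnegrE ?ltW.
  by rewrite powR1.
move=> x y x0 y0; have [yx|xy] := leP y (e * x).
  apply: (@le_trans _ _ (mu `^ r * x `^ r)); last first.
    by rewrite lerDl mulr_ge0 ?powR_ge0.
  have h0 : 0 <= K * (x + y) by rewrite mulr_ge0 ?addr_ge0 ?(ltW K0).
  rewrite -powRM ?(ltW mu0)//; apply: le_powR => //; first exact: ltW.
  apply: (@le_trans _ _ (K * (x + e * x))); first by rewrite ler_pM2l// lerD2l.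
  by apply: eq_ler; rewrite /e /mu; field; rewrite gt_eqF.
have h0 : 0 <= K * (e^-1 + 1) by rewrite mulr_ge0 ?(ltW K0)// addr_ge0// invr_ge0 ltW.
apply: (@le_trans _ _ ((K * (e^-1 + 1)) `^ r * y `^ r)); last first.
  by rewrite lerDr mulr_ge0 ?powR_ge0.
have h1 : 0 <= K * (x + y) by rewrite mulr_ge0 ?addr_ge0 ?(ltW K0).
rewrite -powRM//; apply: le_powR => //; first exact: ltW.
rewrite -mulrA ler_pM2l// mulrDl mul1r lerD2r mulrC ler_pdivlMr// mulrC.
exact: ltW.
Qed.

(** For finite q the recursion and [hardy_step] bound the partial sum up to n+1 by u^r + l times the
    partial sum up to n + C times that of a^r. Since l < 1 the middle term is absorbed on the left;
    this works for r < 1 as well. For q = +oo the bound (u + M)/(1 - K) is preserved by the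
    recursion. *)
Lemma hardy q (K : R) : (0 < q)%E -> 0 < K < 1 -> exists2 C : R, 0 < C &
  forall u a M, 0 <= u -> (forall n, 0 <= a n) -> 0 <= M -> lq_le q a M ->
    lq_le q (hardy_seq K u a) (C * (u + M)).
Proof.
case: q => [r| |//] q0 /[dup] K01 /andP[K0 K1]; last first.
  exists (1 - K)^-1; first by rewrite invr_gt0 subr_gt0.
  move=> u a M u0 a0 M0 /= h; elim=> [|n IH].
    rewrite /hardy_seq expr0 mul1r big_ord0 addr0 mulrC ler_pdivlMr ?subr_gt0//.
    by rewrite -subr_ge0 (_ : _ - _ = M + K * u) ?addr_ge0 ?mulr_ge0 ?(ltW K0)//; ring.
  rewrite hardy_seqS; apply: (@le_trans _ _ (K * ((1 - K)^-1 * (u + M) + (u + M)))).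
    rewrite ler_pM2l// lerD// (le_trans (h n))// lerDr//.
  rewrite -subr_ge0 (_ : _ - _ = (1 - K) * (u + M)); last first.
    by field; rewrite gt_eqF// subr_gt0.
  by apply: mulr_ge0; [rewrite subr_ge0 ltW|exact: addr_ge0].
have [l [C [/andP[l0 l1] C0 hs]]] := hardy_step K01 (q0 : 0 < r).
pose D := (1 + C) / (1 - l); have D0 : 0 < D.
  by rewrite divr_gt0 ?subr_gt0// ltr_pwDl.
exists (D `^ r^-1); first by rewrite powR_gt0.
move=> u a M u0 a0 M0 /= h n; pose c := hardy_seq K u a.
have c0 i : 0 <= c i by apply: hardy_seq_ge0 => //; exact: ltW.
have le n' : \sum_(j < n'.+1) c j `^ r <= u `^ r + l * \sum_(j < n') c j `^ r + C * \sum_(j < n') a j `^ r.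
  rewrite big_ord_recl; rewrite -addrA lerD//.
    by rewrite /c /hardy_seq expr0 mul1r big_ord0 addr0.
  rewrite !mulr_sumr -big_split; apply: ler_sum => i _ /=.
  by rewrite {1}/c hardy_seqS; exact: hs.
rewrite powRM ?powR_ge0 ?addr_ge0// powRVK ?(ltW D0)//.
rewrite /D mulrAC ler_pdivlMr ?subr_gt0// mulrBr mulr1 lerBlDr.
apply: (@le_trans _ _ (\sum_(j < n.+1) c j `^ r)).
  by rewrite big_ord_recr lerDl powR_ge0.
apply: le_trans (le n) _; rewrite addrAC; apply: lerD; last by rewrite mulrC.
rewrite mulrDl mul1r lerD//.
  by apply: le_powR => //; [exact: ltW|rewrite lerDl].
by rewrite ler_wpM2l// (le_trans (h n))//; apply: le_powR => //; [exact: ltW|rewrite lerDr].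
Qed.

End ell_q.

Section embeddings.
Context d {T : measurableType d} {R : realType}.
Variables (P : probability T R) (k : scalar_kind) (p : R).
Hypothesis p1 : 1 <= p.
Notation Lp := (Lpfun P k p%:E).
Notation N := (Lpnorm P p%:E).
Notation K := (scalars k).
Notation nrm := (nrm P p).
Notation E D := (approx_num P k p D).
Implicit Types (x y : cfun T R) (D : set (cfun T R)).

Let p0 : 0 < p. Proof. exact: lt_le_trans p1. Qed.

Definition weighted_num D (alpha : R) x n : R := 2 `^ (n%:R * alpha) * E D (2 ^ n) x.

Lemma weighted_num_ge0 D alpha x n : 0 <= weighted_num D alpha x n.
Proof. by rewrite mulr_ge0 ?powR_ge0 ?approx_num_ge0. Qed.

Lemma approx_normE D alpha q x : D `<=` Lp -> Lp x ->
  approx_norm K N D alpha q x = ((nrm x)%:E + Lnorm counting q (EFin \o weighted_num D alpha x))%E.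
Proof.
move=> DL Lx; rewrite /approx_norm (LpnormE p0 Lx); congr (_ + Lnorm _ _ _)%E.
by apply/funext => n; rewrite best_approxE// -EFinM.
Qed.

Lemma approx_norm_finP D alpha q x : (0 < q)%E -> D `<=` Lp -> Lp x ->
  (approx_norm K N D alpha q x < +oo)%E <->
  exists2 M, 0 <= M & lq_le q (weighted_num D alpha x) M.
Proof.
move=> q0 DL Lx; rewrite approx_normE//; set L := Lnorm _ _ _.
have L0 : (0 <= L)%E by exact: Lnorm_ge0.
split=> [h|[M M0 /(Lnorm_countingP q0 (weighted_num_ge0 D alpha x) M0) h]].
  have Lf : L \is a fin_num.
    by rewrite ge0_fin_numE//; apply: le_lt_trans h; rewrite leeDr// lee_fin nrm_ge0.
  exists (fine L); first exact: fine_ge0.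
  apply/Lnorm_countingP => //; [exact: weighted_num_ge0|exact: fine_ge0|].
  by rewrite -/L fineK.
by apply: le_lt_trans (leeD2l _ h) _; rewrite -EFinD ltry.
Qed.

(** Reduces an embedding to a comparison for each n that does not involve q: Hardy's inequality
    bounds the right-hand sequence in l^q by the norm of x plus the l^q norm of the weighted numbers
    for the first dictionary. *)
Lemma embed_of_hardy (X D1 D2 : set (cfun T R)) alpha q (C kappa : R) : (0 < q)%E ->
  X `<=` Lp -> D1 `<=` Lp -> D2 `<=` Lp -> 0 <= C -> 0 < kappa < 1 ->
  (forall x n, X x ->
     weighted_num D2 alpha x n <= C * hardy_seq kappa (nrm x) (weighted_num D1 alpha x) n) ->
  approx_embed K X N D1 D2 alpha q.
Proof.
move=> q0 XL DL1 DL2 C0 kap hX; have [H H0 hH] := hardy q0 kap.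
have key x M : X x -> 0 <= M -> lq_le q (weighted_num D1 alpha x) M ->
    lq_le q (weighted_num D2 alpha x) (C * (H * (nrm x + M))).
  move=> Xx M0 h; apply: lq_le_scale (hX x ^~ Xx) _ => //.
  - exact: weighted_num_ge0.
  - by rewrite mulr_ge0 ?(ltW H0)// addr_ge0 ?nrm_ge0.
  - move=> n; apply: hardy_seq_ge0; [by case/andP: kap => /ltW|exact: nrm_ge0|exact: weighted_num_ge0].
  - by apply: hH => //; [exact: nrm_ge0|exact: weighted_num_ge0].
have nn x M : 0 <= M -> 0 <= C * (H * (nrm x + M)).
  by move=> M0; rewrite !mulr_ge0 ?(ltW H0)// addr_ge0 ?nrm_ge0.
split=> [x [Xx /(approx_norm_finP alpha q0 DL1 (XL _ Xx))[M M0 h]]|].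
  split=> //; apply/(approx_norm_finP alpha q0 DL2 (XL _ Xx)).
  by exists (C * (H * (nrm x + M))); [exact: nn|exact: key].
exists (1 + C * H) => x [Xx fx]; have Lx := XL _ Xx.
move: fx; rewrite !approx_normE//; set L := Lnorm _ _ _ => fx.
have L0 : (0 <= L)%E by exact: Lnorm_ge0.
have Lf : L \is a fin_num.
  by rewrite ge0_fin_numE//; apply: le_lt_trans fx; rewrite leeDr// lee_fin nrm_ge0.
have M0 : 0 <= fine L by exact: fine_ge0.
have /(key x _ Xx M0)/(Lnorm_countingP q0 (weighted_num_ge0 D2 alpha x) (nn x _ M0)) h :
    lq_le q (weighted_num D1 alpha x) (fine L).
  by apply/(Lnorm_countingP q0 (weighted_num_ge0 D1 alpha x) M0); rewrite -/L fineK.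
apply: le_trans (leeD2l _ h) _; rewrite -(fineK Lf) -!EFinD -EFinM lee_fin.
have n0 : 0 <= nrm x by exact: nrm_ge0.
rewrite -subr_ge0 (_ : _ - _ = fine L); last by ring.
exact: M0.
Qed.

End embeddings.

(** * The local orthonormal dictionary *)

Section dimension.
Context d {T : measurableType d} {R : realType}.
Variable P : probability T R.
Implicit Types (f g : cfun T R).

Lemma ae_forall_ord n (Q : 'I_n -> T -> Prop) :
  (forall i, \forall x \ae P, Q i x) -> \forall x \ae P, forall i, Q i x.
Proof.
move=> h; have : \forall x \ae P, forall j : nat, forall i : 'I_n, val i = j -> Q i x.
  apply: ae_foralln => j; have [jn|jn] := boolP (j < n)%N.
    by apply: filterS (h (Ordinal jn)) => x hx i e; rewrite (_ : i = Ordinal jn)//; exact: ord_inj.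
  by apply: aeW => x i e; move: jn; rewrite -e ltn_ord.
by apply: filterS => x hx i; exact: hx.
Qed.

Lemma Lpfun_complex k (p : \bar R) f : Lpfun P k p f -> Lpfun P ComplexScalars p f.
Proof. by move=> [[_ rf imf] nf]; split. Qed.

(** If m > D, the coefficient matrix has a nonzero vector u in its left kernel. The combination of
    the phi_i with coefficients u_i then vanishes almost everywhere, while its inner product with
    phi_j is u_j. Scalars are complex here because the kernel vector is found over the complex
    numbers in the real case, too. *)
Lemma orthonormal_dim (m D : nat) (phi : 'I_m -> cfun T R) (e : 'I_D -> cfun T R) :
  (forall i, Lpfun P ComplexScalars 2%:E (phi i)) ->
  (forall i j, inner P (phi i) (phi j) = (i == j)%:R) ->
  (forall i, exists c : 'I_D -> R[i],
     \forall x \ae P, phi i x = \sum_(a < D) c a * e a x :> R[i]) -> (m <= D)%N.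
Proof.
move=> Lphi on /choice[c hc]; rewrite leqNgt; apply/negP => Dm.
pose M : 'M[R[i]]_(m, D) := \matrix_(i, a) c i a.
have : kermx M != 0.
  by rewrite kermx_eq0 /row_free neq_ltn (leq_ltn_trans (rank_leq_col M) Dm).
case/rowV0Pn => u /sub_kermxP uM; apply/negP; rewrite negbK; apply/eqP/rowP => j.
pose g : cfun T R := \sum_(i < m) u 0 i *: phi i.
have Lu i : Lpfun P ComplexScalars 2%:E (u 0 i *: phi i) by apply: LpfunZ.
have Lg : Lpfun P ComplexScalars 2%:E g by apply: Lpfun_sum; rewrite ?ler1n.
have g0 : \forall x \ae P, g x = 0.
  have hall : \forall x \ae P, forall i : 'I_m, phi i x = \sum_(a < D) c i a * e a x. by exact: ae_forall_ord.
  apply: filterS hall => x h; rewrite /g sum_cfunE.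
  rewrite (eq_bigr (fun i => \sum_(a < D) u 0 i * M i a * e a x)); last first.
    move=> i _; rewrite cfunZE h.
    have E (z : R[i]) (s : 'I_D -> R[i]) : z * (\sum_a s a) = \sum_a z * s a by rewrite mulr_sumr.
    by apply: etrans (E _ _) _; apply: eq_bigr => a _; rewrite mxE mulrA.
  rewrite exchange_big big1//= => a _; rewrite -mulr_suml.
  by have /rowP/(_ a) := uM; rewrite mxE => ->; rewrite mxE mul0r.
have : inner P g (phi j) = inner P 0 (phi j).
  apply: (@inner_ae _ _ _ P ComplexScalars); [exact: Lpfun_mfun Lg|exact: scalar_mfun0|exact: Lpfun_mfun (Lphi j)|].
  by apply: filterS g0 => x ->.
rewrite inner0l /g (@inner_suml _ _ _ P ComplexScalars)//.
rewrite (bigD1 j)//= big1 ?addr0 => [|i ij].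
  by rewrite (@innerZl _ _ _ P ComplexScalars)// on eqxx mulr1 mxE.
by rewrite (@innerZl _ _ _ P ComplexScalars)// on (negbTE ij) mulr0.
Qed.

End dimension.

Section orthonormal_dictionary.
Context d {T : measurableType d} {R : realType}.
Variables (P : probability T R) (k : scalar_kind).
Variables (F : nat -> set (set T)) (S : set (cfun T R)).
Hypothesis Fbin : binary_filtration P F.
Hypothesis Sfin : fin_dim_space k S.
Hypothesis Sstab : stability P F S.
Variables (p tau : R).
Hypotheses (p1 : 1 < p) (tau0 : 0 < tau) (taup : tau < p).
Variables (m : nat -> nat) (Phi : forall n, 'I_(m n) -> cfun T R).
Hypothesis ons : local_orthonormal_system P k F S Phi.
Implicit Types (f g h : cfun T R).
Notation L2 := (Lpfun P k 2%:E).
Notation Lp := (Lpfun P k p%:E).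
Notation Q := (orth_proj_diff P F S).
Notation beta := (tau^-1 - p^-1).
Notation nrm := (nrm P p).
Notation Psi := (dictPsi P p Phi).
Notation C := (dictC F S).
Notation nterm := (nterm (scalars k)).
Notation at_ n := (is_atom (F n)).

Let p0 : 0 < p. Proof. by rewrite (lt_trans _ p1). Qed.

Lemma Q_halves n f : L2 f -> exists v w, [/\ S v, S w &
  \forall x \ae P, Q n f x = cutoff (half1 Fbin n) v x + cutoff (half2 Fbin n) w x].
Proof.
move=> Lf; have pQ := Q_pw Fbin Sfin Sstab (n := n) Lf.
case: n pQ => [|n] pQ.
  exists (Q 0 f), 0; split; [exact: (pw0E Fbin)|exact: (S_zero Sfin)|].
  by apply: aeW => x; rewrite /= cutoff_in// /cutoff mul0r addr0.
have [v Sv ev] := (pwP _ _ _ _).1 pQ _ (small_half_atom Fbin n).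
have [w Sw ew] := (pwP _ _ _ _).1 pQ _ (large_half_atom Fbin n).
exists v, w; split => //; have := Q_support Fbin Sfin Sstab n.+1 Lf.
apply: filterS => x hx; rewrite [half1 _ _]/= [half2 _ _]/=.
have disj := halves_disjoint Fbin n.
have [h1|n1] := pselect (small_half Fbin n x).
  rewrite cutoff_in// cutoff_out ?addr0; first exact: ev.
  by move=> h2; have : (small_half Fbin n `&` large_half Fbin n) x by []; rewrite disj.
rewrite [X in X + _]cutoff_out// add0r.
have [h2|n2] := pselect (large_half Fbin n x); first by rewrite cutoff_in//; exact: ew.
by rewrite cutoff_out//; apply: hx => -[].
Qed.

Lemma half1_atom n : all_atoms F (half1 Fbin n).
Proof.
by case: n => [|n]; [exists 0%N => //; exact/(atom0 Fbin)|exists n.+1 => //; exact: small_half_atom].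
Qed.

Lemma Q_nterm n f : L2 f -> exists2 g, nterm C 2 g & \forall x \ae P, Q n f x = g x.
Proof.
move=> Lf; have [v [w [Sv Sw e]]] := Q_halves n Lf.
have cut A u : all_atoms F A -> S u -> nterm C 1 (cutoff A u).
  move=> aA Su; rewrite -[cutoff A u]scale1r; apply: nterm1; first exact: scalars1.
  by exists u, A.
exists (cutoff (half1 Fbin n) v + cutoff (half2 Fbin n) w); last exact: e.
apply: (@ntermD _ _ k C 1 1); first by apply: cut => //; exact: half1_atom.
case: {e} n => [|n].
  rewrite (_ : cutoff _ _ = 0); first exact: nterm0.
  by apply/funext => x; rewrite cutoff_out.
by apply: cut => //; exists n.+1 => //; exact: large_half_atom.
Qed.

(** Up to null sets the range of Q_n is contained in the span of the functions [sbasis] cut to the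
    two halves, and orthonormality bounds the number of basis functions. The bound does not depend
    on n, so each step costs a fixed number of dictionary elements. *)
Lemma Phi_card n : (m n <= sdim Sfin + sdim Sfin)%N.
Proof.
have [h1 h2 _] := ons n.
pose e (a : 'I_(sdim Sfin + sdim Sfin)) := match fintype.split a with
  | inl b => cutoff (half1 Fbin n) (sbasis b)
  | inr b => cutoff (half2 Fbin n) (sbasis b) end.
apply: (@orthonormal_dim _ _ _ P _ _ (@Phi n) e) => // i.
  by have [Li _] := h1 i; exact: Lpfun_complex Li.
have [_ [f Lf ef]] := h1 i; have [v [w [Sv Sw e']]] := Q_halves n Lf.
have [c [_ cE]] := (sbasisE Sfin v).1 Sv; have [c' [_ cE']] := (sbasisE Sfin w).1 Sw.
exists (fun a => match fintype.split a with inl b => c b | inr b => c' b end).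
apply: filterS2 ef e' => x ex ex'; rewrite ex// ex' big_split_ord/=.
rewrite cE cE' !cutoff_sum !sum_cfunE; congr (_ + _); apply: eq_bigr => b _.
  by rewrite /e (unsplitK (inl b : 'I__ + 'I__)%type).
by rewrite /e (unsplitK (inr b : 'I__ + 'I__)%type).
Qed.

Lemma Phi_L2 n (i : 'I_(m n)) : L2 (Phi i).
Proof. by have [h _ _] := ons n; have [] := h i. Qed.

Lemma Phi_Q n (i : 'I_(m n)) : exists2 f, L2 f & \forall x \ae P, Phi i x = Q n f x.
Proof.
have [h _ _] := ons n; have [_ [f Lf e]] := h i; exists f => //.
by apply: filterS e => x ->.
Qed.

Lemma Phi_Lp n (i : 'I_(m n)) : Lp (Phi i).
Proof.
have [f Lf e] := Phi_Q i; apply: Lpfun_ae (Q_Lp Fbin Sfin Sstab n p0 Lf) _ e => //.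
exact: Lpfun_mfun (Phi_L2 i).
Qed.

Lemma Phi_nrm_gt0 n (i : 'I_(m n)) : 0 < nrm (Phi i).
Proof.
rewrite lt0r nrm_ge0 andbT; apply/eqP => n0; have [_ h _] := ons n.
have /eqP := h i i; rewrite eqxx (inner_self (Phi_L2 i)).
have z : \forall x \ae P, Phi i x = 0.
  have : \int[P]_x (modulus (Phi i) x `^ p) = 0 by rewrite -nrm_pow// n0 powR0 ?gt_eqF.
  move/(rint0_ae (fun x => powR_ge0 _ _) (Lpfun_ri p0 (Phi_Lp i))).
  by apply: filterS => x /eqP; rewrite powR_eq0 => /andP[/eqP/modulus_eq0].
rewrite (nrm_ae (k := k) 2 (Lpfun_mfun (Phi_L2 i)) (scalar_mfun0 k) z) nrm0// powR0//.
by rewrite eq_sym oner_eq0.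
Qed.

Lemma Psi_E n (i : 'I_(m n)) :
  ((fine (Lpnorm P p%:E (Phi i)))^-1)%:C%C *: Phi i = ((nrm (Phi i))^-1)%:C%C *: Phi i.
Proof. by rewrite (LpnormE p0 (Phi_Lp i)). Qed.

Lemma Psi_level g : Psi g -> exists n f, L2 f /\ \forall x \ae P, g x = Q n f x.
Proof.
move=> [n [i ->]]; rewrite Psi_E; have [f Lf e] := Phi_Q i.
set c := (_%:C)%C; have kc : scalars k c by exact: scalars_real.
exists n, (c *: f); split; first exact: LpfunZ.
apply: filterS2 e (QZ Fbin Sfin Sstab n kc Lf) => x ex ->.
by rewrite [LHS]/(c * Phi i x) ex.
Qed.

Lemma Psi_Lp : Psi `<=` Lp.
Proof.
by move=> _ [n [i ->]]; rewrite Psi_E; apply: LpfunZ => //; [exact: scalars_real|exact: Phi_Lp].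
Qed.

Lemma Psi_L2 : Psi `<=` L2.
Proof.
by move=> _ [n [i ->]]; rewrite Psi_E; apply: LpfunZ => //; [exact: scalars_real|exact: Phi_L2].
Qed.

Lemma C_bfun g : C g -> bfun P k g.
Proof.
move=> [f [A [Sf [n _ aA] ->]]]; apply: bfun_cutoff; first exact: atom_measurable Fbin _ _ aA.
exact: S_bfun Fbin Sfin Sstab _ Sf.
Qed.

Lemma C_Lp : C `<=` Lp.
Proof. by move=> g /C_bfun; exact: bfun_Lp. Qed.

Lemma C_pw g : C g -> exists n, piecewise F S n g.
Proof. by move=> [f [A [Sf [n _ aA] ->]]]; exists n; exact: (pw_cutoff Fbin Sfin). Qed.

Lemma nterm_C_pw n g : nterm C n g -> exists N, piecewise F S N g.
Proof.
move=> [l [c [x [_ kc Dx ->]]]]; have /choice[N hN] i := C_pw (Dx i).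
exists (\max_(i < l) N i)%N; apply: (pw_sum Sfin) => i _; apply: (pw_scale Sfin) => //.
by apply: (pw_le Fbin) (hN i); exact: leq_bigmax.
Qed.

Lemma Psi_near_C g : Psi g -> exists2 h, nterm C 2 h & \forall x \ae P, g x = h x.
Proof.
move=> /Psi_level[n [f [Lf e]]]; have [h Ch e'] := Q_nterm n Lf.
by exists h => //; apply: filterS2 e e' => x -> ->.
Qed.

Lemma nterm_Psi_near_C n g : nterm Psi n g ->
  exists2 h, nterm C (n * 2) h & \forall x \ae P, g x = h x.
Proof.
move=> [l [c [x [ln kc Dx ->]]]].
have /choice[y hy] i : exists h, nterm C 2 h /\ \forall w \ae P, x i w = h w.
  by have [h] := Psi_near_C (Dx i); exists h.
exists (\sum_(i < l) c i *: y i).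
  apply: (@nterm_le _ _ _ _ (\sum_(i < l) 2)%N).
    by rewrite sum_nat_const card_ord leq_mul2r ln orbT.
  by apply: nterm_sum => i _; apply: ntermZ => //; have [] := hy i.
have hall : \forall w \ae P, forall i : 'I_l, x i w = y i w.
  by apply: ae_forall_ord => i; have [] := hy i.
apply: filterS hall => w h; rewrite !sum_cfunE; apply: eq_bigr => i _.
by rewrite [LHS]/(c i * x i w) h.
Qed.

Lemma Q_nterm_Psi n f : L2 f -> exists2 g, nterm Psi (sdim Sfin + sdim Sfin) g &
  \forall x \ae P, Q n f x = g x.
Proof.
move=> Lf; have [_ _ h] := ons n; have [c kc e] := h f Lf.
exists (\sum_(i < m n) c i *: Phi i); last by apply: filterS e => x ->.
apply: (@nterm_le _ _ _ _ (\sum_(i < m n) 1)%N).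
  by rewrite sum_nat_const card_ord muln1; exact: Phi_card.
apply: nterm_sum => i _; have nz := Phi_nrm_gt0 i.
rewrite (_ : c i *: Phi i = (c i * (nrm (Phi i))%:C%C) *: (((nrm (Phi i))^-1)%:C%C *: Phi i)).
  apply: nterm1; first by apply: scalarsM => //; exact: scalars_real.
  by exists n, i; rewrite Psi_E.
rewrite scalerA -mulrA -rmorphM/= divff ?gt_eqF// rmorph1 mulr1//.
Qed.

(** Every element of Psi lives on a single step, and increments of different steps annihilate each
    other. An n-term combination therefore has at most n nonzero increments, and [bernstein_levels]
    applies to this set of steps. *)
Lemma bernstein_Psi : exists2 A : R, 0 < A & forall n h J, nterm Psi n h ->
  \sum_(j < J) nrm (Q j h) `^ tau <= (A * n%:R `^ beta * nrm h) `^ tau.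
Proof.
have [A A0 hA] := bernstein_levels Fbin Sfin Sstab p1 tau0 taup.
exists A => // n _ J [l [c [x [ln kc Dx ->]]]].
have /choice[lev hlev] i : exists n, exists f, L2 f /\ \forall w \ae P, x i w = Q n f w.
  by have [n' [f hf]] := Psi_level (Dx i); exists n', f.
pose G : {set 'I_J} := [set j : 'I_J | [exists i, lev i == j]]%SET.
set h := \sum_(i < l) _.
have Lx i : L2 (c i *: x i) by apply: LpfunZ => //; exact: Psi_L2.
have Lh : L2 h by apply: Lpfun_sum => //; rewrite ler1n.
have Lph : Lp h.
  by apply: Lpfun_sum => [|i _]; [exact: ltW|apply: LpfunZ => //; exact: Psi_Lp].
have cG : (#|G| <= n)%N.
  apply: leq_trans ln; rewrite cardE -(size_map val).
  rewrite -[leqRHS](size_enum_ord l) -(size_map lev); apply: uniq_leq_size.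
    by rewrite map_inj_uniq ?enum_uniq//; exact: val_inj.
  move=> _ /mapP[j + ->]; rewrite mem_enum inE => /existsP[i /eqP e].
  by rewrite -[\val j]/(nat_of_ord j) -e map_f// mem_enum.
have z (j : 'I_J) : j \notin G -> nrm (Q j h) = 0.
  move=> jG.
  have hi i : \forall w \ae P, Q j (c i *: x i) w = 0.
    have [f [Lf e]] := hlev i.
    have LQ := Q_L2 Fbin Sfin Sstab (lev i) Lf.
    have ne : lev i != j.
      by apply: contra jG => le; rewrite inE; apply/existsP; exists i.
    have h1 := QZ Fbin Sfin Sstab j (kc i) (Psi_L2 (Dx i)).
    have h2 := Q_ae Fbin Sfin Sstab j (Psi_L2 (Dx i)) LQ e.
    have h3 := Q_other Fbin Sfin Sstab Lf ne.
    by apply: filterS3 h1 h2 h3 => w -> -> ->; rewrite mulr0.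
  rewrite -(nrm0 P p0); apply: (nrm_ae (k := k)); [exact: Lpfun_mfun (Q_L2 Fbin Sfin Sstab j Lh)|exact: scalar_mfun0|].
  apply: filterS2 (Q_sum_ae Fbin Sfin Sstab j (index_enum 'I_l) Lx) (ae_forall_ord hi).
  by move=> w -> hw; rewrite big1.
rewrite (bigID (mem G))/= [X in _ + X]big1 ?addr0; last first.
  by move=> j jG; rewrite z// powR0// gt_eqF.
apply: le_trans (hA h J G Lh Lph) _; apply: le_powR; [exact: ltW|by rewrite !mulr_ge0 ?powR_ge0 ?nrm_ge0 ?(ltW A0)|].
rewrite ler_wpM2r ?nrm_ge0// ler_wpM2l ?(ltW A0)//; apply: le_powR => //.
  by rewrite ltW// (beta_gt0 p1 tau0 taup).
by rewrite ler_nat.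
Qed.

(** A function in S_M is the sum of its increments up to M, so [jackson_levels] for J = M + 1 splits
    the whole function; each retained step costs at most 2 [sdim] elements of Psi. *)
Lemma jackson_Psi : exists2 A : R, 0 < A & forall f M n (B : R), piecewise F S M f ->
  0 <= B -> (forall J, \sum_(j < J) nrm (Q j f) `^ tau <= B `^ tau) ->
  exists2 h, nterm Psi (n * (sdim Sfin + sdim Sfin)) h &
    nrm (f - h) <= A * n.+1%:R `^ (- beta) * B.
Proof.
have [A A0 hA] := jackson_levels Fbin Sfin Sstab p1 tau0 taup.
exists A => // f M n B pf B0 hB; have Lf := pw_L2 Fbin Sfin Sstab pf.
have [G cG hG] := hA f M.+1 n B Lf B0 (hB _).
have /choice[g hg] (j : 'I_M.+1) : exists g, nterm Psi (sdim Sfin + sdim Sfin) g /\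
    \forall x \ae P, Q j f x = g x.
  by have [g] := Q_nterm_Psi j Lf; exists g.
exists (\sum_(j in G) g j).
  apply: (@nterm_le _ _ _ _ (\sum_(j in G) (sdim Sfin + sdim Sfin))%N).
    by rewrite sum_nat_const leq_mul2r cG orbT.
  by apply: nterm_sum => j _; have [] := hg j.
have Lg j : Lp (g j) by have [/(nterm_Lp (ltW p1) Psi_Lp)] := hg j.
have -> : nrm (f - \sum_(j in G) g j) = nrm (\sum_(j in ~: G) Q j f); last exact: hG.
apply: (nrm_ae (k := k)).
- have := Lpfun_mfun Lf => mf; apply: Lpfun_mfun (LpfunB (ltW p1) (bfun_Lp p0 (pw_bfun Fbin Sfin Sstab pf)) _).
  by apply: Lpfun_sum => //; exact: ltW.
- by apply: scalar_mfun_sum => j _; exact: Lpfun_mfun (Q_L2 Fbin Sfin Sstab j Lf).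
have hp := proj_ae Fbin Sfin Sstab (Lpfun_mfun Lf) pf (aeW _ (fun x => erefl (f x))).
have hall : \forall w \ae P, forall j : 'I_M.+1, Q j f w = g j w.
  by apply: ae_forall_ord => j; have [] := hg j.
apply: filterS2 hp hall => w; rewrite -Q_sum => e hw.
rewrite cfunBE -e !sum_cfunE (bigID (mem G))/= (eq_bigr (fun j => g j w)) => [|j _]; last exact: hw.
rewrite [X in X - _]addrC addrK; apply: eq_bigl => j; by rewrite inE.
Qed.

End orthonormal_dictionary.

(** * Embeddings between the approximation spaces of the two dictionaries *)

Lemma hardy_seq_scale {R : realType} (t K u : R) (a : nat -> R) n :
  t ^+ n * hardy_seq K u a n = hardy_seq (K * t) u (fun i => t ^+ i * a i) n.
Proof.
rewrite /hardy_seq mulrDr exprMn; congr (_ + _); first by rewrite mulrA [t ^+ n * _]mulrC.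
rewrite mulr_sumr; apply: eq_bigr => i _; rewrite exprMn.
have -> : t ^+ n = t ^+ (n - i) * t ^+ i by rewrite -exprD subnK// ltnW.
by move: (t ^+ (n - i)) (t ^+ i) (K ^+ (n - i)) => x y z; ring.
Qed.

Lemma powR2_natM {R : realType} n (a : R) : 2 `^ (n%:R * a) = (2 `^ a) ^+ n.
Proof. by rewrite mulrC powRrM powR_mulrn ?powR_ge0. Qed.

Lemma powR2_lt {R : realType} (a b : R) : a < b -> 2 `^ a < 2 `^ b.
Proof.
move=> ab; rewrite -(subrK a b) powRD ?pnatr_eq0 ?implybT//.
by rewrite ltr_pMl ?powR_gt0// powR2_gt1// subr_gt0.
Qed.

Lemma addr_le_double {R : realType} (a b c e : R) : 0 < e -> b < c + e -> c <= a -> a + b <= 2 * (a + e).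
Proof. by lra. Qed.

Lemma addr_le_double_trans {R : realType} (a b c c' e : R) : a < c + e -> b < c' + e -> c' <= c ->
  a + b <= 2 * (c + e).
Proof. by lra. Qed.

Section embeddings_of_dictionaries.
Context d {T : measurableType d} {R : realType}.
Variables (P : probability T R) (k : scalar_kind).
Variables (F : nat -> set (set T)) (S : set (cfun T R)).
Hypothesis Fbin : binary_filtration P F.
Hypothesis Sfin : fin_dim_space k S.
Hypothesis Sstab : stability P F S.
Variables (p tau : R).
Hypotheses (p1 : 1 < p) (tau0 : 0 < tau) (taup : tau < p).
Variables (m : nat -> nat) (Phi : forall n, 'I_(m n) -> cfun T R).
Hypothesis ons : local_orthonormal_system P k F S Phi.
Implicit Types (f g h x y : cfun T R).
Notation L2 := (Lpfun P k 2%:E).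
Notation Lp := (Lpfun P k p%:E).
Notation Q := (orth_proj_diff P F S).
Notation beta := (tau^-1 - p^-1).
Notation nrm := (nrm P p).
Notation N := (Lpnorm P p%:E).
Notation Psi := (dictPsi P p Phi).
Notation C := (dictC F S).
Notation nterm := (nterm (scalars k)).
Notation E D := (approx_num P k p D).

Let p0 : 0 < p. Proof. by rewrite (lt_trans _ p1). Qed.
Let CL : C `<=` Lp := C_Lp Fbin Sfin Sstab p1.
Let PL : Psi `<=` Lp := Psi_Lp Fbin Sfin Sstab p1 ons.
Let b0 : 0 < beta := beta_gt0 p1 tau0 taup.

Lemma approx_C_Psi n x : Lp x -> E C (n * 2) x <= E Psi n x.
Proof.
move=> Lx; apply: (approx_numP (ltW p1) PL) => // y ny.
have [h nh e] := nterm_Psi_near_C Fbin Sfin Sstab p1 ons ny.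
apply: le_trans (approx_num_le (ltW p1) CL Lx nh) _; apply: eq_ler.
have Lh := nterm_Lp (ltW p1) CL nh; have Ly := nterm_Lp (ltW p1) PL ny.
apply: (nrm_ae (k := k)).
- exact: Lpfun_mfun (LpfunB (ltW p1) Lx Lh).
- exact: Lpfun_mfun (LpfunB (ltW p1) Lx Ly).
- by apply: filterS e => w e; rewrite !cfunBE e.
Qed.

(** By [approx_C_Psi] passing from Psi to C only shifts the dyadic index by one. The shift is cast
    as a Hardy bound with kernel 1/2, a choice compensated by the factor 2 in 1 + 2 t; index 0 is
    covered by the norm. *)
Lemma embed_Psi_C (X : set (cfun T R)) (alpha : R) q : (0 < q)%E -> X `<=` Lp ->
  approx_embed (scalars k) X N Psi C alpha q.
Proof.
move=> q0 XL; pose t : R := 2 `^ alpha; have t0 : 0 <= t by exact: powR_ge0.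
apply: (@embed_of_hardy _ _ _ P k p (ltW p1) X Psi C alpha q (1 + 2 * t) 2^-1) => //.
- by rewrite addr_ge0// mulr_ge0.
- by rewrite invr_gt0 invf_lt1 ?ltr1n ?ltr0n.
move=> x n /XL Lx; rewrite /weighted_num; case: n => [|n].
  rewrite mul0r powRr0 mul1r /hardy_seq expr0 mul1r big_ord0 addr0.
  apply: le_trans (approx_num_nrm (ltW p1) CL _ Lx) _.
  by rewrite ler_peMl ?nrm_ge0// lerDl mulr_ge0.
rewrite hardy_seqS; set a := hardy_seq _ _ _ n.
have a0 : 0 <= a.
  apply: hardy_seq_ge0 => [||i]; [by rewrite invr_ge0|exact: nrm_ge0|exact: weighted_num_ge0].
rewrite powR2_natM exprSr -/t -mulrA.
have e0 : 0 <= t ^+ n * E Psi (2 ^ n) x by rewrite mulr_ge0 ?exprn_ge0 ?approx_num_ge0.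
apply: (@le_trans _ _ (t * (t ^+ n * E Psi (2 ^ n) x))).
  rewrite mulrCA ler_wpM2l// ler_wpM2l ?exprn_ge0// expnSr.
  exact: approx_C_Psi.
rewrite powR2_natM -/t; move: (t ^+ n * _) e0 => z z0.
rewrite -subr_ge0 (_ : _ - _ = 2^-1 * a + 2^-1 * z + t * a); last by field.
by rewrite !addr_ge0 ?mulr_ge0 ?invr_ge0.
Qed.

Lemma cutoffZ (A : set T) c f : cutoff A (c *: f) = c *: cutoff A f.
Proof. by apply/funext => x; rewrite /cutoff !cfunZE mulrA. Qed.

Lemma SigmaSE n g : SigmaS F S n g <-> nterm C n g.
Proof.
split=> [[v [A [Sv aA ->]]]|[l [c [x [ln kc Dx ->]]]]].
  rewrite -[n in nterm C n](_ : (\sum_(i < n) 1)%N = n); last by rewrite sum_nat_const card_ord muln1.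
  apply: nterm_sum => i _; rewrite -[cutoff _ _]scale1r; apply: nterm1; first exact: scalars1.
  by exists (v i), (A i).
have /choice[fA hfA] i : exists fA : cfun T R * set T,
    [/\ S fA.1, all_atoms F fA.2 & x i = cutoff fA.2 fA.1].
  by have [f [A [Sf aA e]]] := Dx i; exists (f, A).
(* [SigmaS n] asks for exactly n summands: the n - l missing ones are zero functions on the whole
   space, and the coefficients are absorbed into S. *)
rewrite -(subnKC ln); exists (fun i => match fintype.split i with
    inl a => c a *: (fA a).1 | inr _ => 0 end),
  (fun i => match fintype.split i with inl a => (fA a).2 | inr _ => setT end); split.
- move=> i; case: fintype.split => [a|_]; last exact: S_zero Sfin.
  by apply: (S_scale Sfin) => //; have [] := hfA a.
- move=> i; case: fintype.split => [a|_]; first by have [] := hfA a.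
  by exists 0%N => //; exact/(atom0 Fbin).
rewrite big_split_ord/= [X in _ + X]big1 ?addr0 => [|i _].
  apply: eq_bigr => i _; rewrite (unsplitK (inl i : 'I__ + 'I__)%type) cutoffZ.
  by have [_ _ ->] := hfA i.
rewrite (unsplitK (inr i : 'I__ + 'I__)%type) cutoffT//.
Qed.

Lemma nterm_C_L2 n g : nterm C n g -> L2 g.
Proof.
by move=> /(nterm_C_pw Fbin Sfin)[M pg]; exact: (pw_L2 Fbin Sfin Sstab pg).
Qed.

Lemma Bernstein_real : Bernstein P F S p tau <-> exists2 B : R, 0 <= B &
  forall n g, (0 < n)%N -> nterm C n g -> forall J,
    \sum_(j < J) nrm (Q j g) `^ tau <= (B * n%:R `^ beta * nrm g) `^ tau.
Proof.
have key (B : R) n g : 0 <= B -> nterm C n g ->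
    (((\sum_(0 <= j <oo) Lpnorm P p%:E (Q j g) `^ tau) `^ tau^-1 <=
     (B * n%:R `^ beta)%:E * Lpnorm P p%:E g)%E <-> forall J,
    \sum_(j < J) nrm (Q j g) `^ tau <= (B * n%:R `^ beta * nrm g) `^ tau).
  move=> B0 ng; have Lg := nterm_C_L2 ng; have Lpg := nterm_Lp (ltW p1) CL ng.
  rewrite (LpnormE p0 Lpg) -EFinM.
  rewrite (eq_eseriesr (g := fun j => ((nrm (Q j g))%:E `^ tau)%E)); last first.
    by move=> j _; rewrite (LpnormE p0 (Q_Lp Fbin Sfin Sstab j p0 Lg)).
  apply: nneseries_powR_le => // [j|]; first exact: nrm_ge0.
  by rewrite !mulr_ge0 ?powR_ge0 ?nrm_ge0.
split=> [[B hB]|[B B0 hB]].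
  exists `|B| => // n g n0 ng; apply/(key _ _ _ (normr_ge0 B) ng).
  apply: le_trans (hB n g n0 ((SigmaSE n g).2 ng)) _.
  by rewrite lee_wpmul2r ?Lnorm_ge0// lee_fin ler_wpM2r ?powR_ge0// ler_norm.
exists B => n g n0 /SigmaSE ng; apply/(key _ _ _ B0 ng).
exact: hB.
Qed.

Section direct_estimate.
Variable B : R.
Hypothesis B0 : 0 <= B.
Hypothesis hB : forall n g, (0 < n)%N -> nterm C n g -> forall J,
    \sum_(j < J) nrm (Q j g) `^ tau <= (B * n%:R `^ beta * nrm g) `^ tau.
Notation L := (sdim Sfin + sdim Sfin)%N.

(** Up to the factor 2 and an arbitrarily small error, a bound for the norm of the i-th difference
    of near-best approximants. The difference at index 0 has no predecessor and gets the norm of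
    x. *)
Let s x i := if i is i'.+1 then E C (2 ^ i') x else nrm x.

Let s_ge0 x i : 0 <= s x i.
Proof. by case: i => [|i]; [exact: nrm_ge0|exact: approx_num_ge0]. Qed.

(** Put b = 2^beta. BI for the difference of index I - i costs b^(I-i), and its norm is at most of
    order kap^(-i) Sg, where Sg is the weighted sum on the right. Relative to b^I Sg these terms
    decay like (b kap)^(-i), and b kap > 1 is exactly the hypothesis on [kap]. So the differences
    are summed downwards from I; K1 is the square root of b kap because [quasi_sum] spends half of
    the decay. Finally Jackson with 2^I steps gains b^(-I), which cancels b^I. *)
Lemma direct_step (kap : R) : 2 `^ (- beta) < kap <= 1 -> exists2 A : R, 0 < A &
  forall x I, Lp x -> E Psi (2 ^ I * L) x <= A * \sum_(i < I.+1) kap ^+ (I - i) * s x i.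
Proof.
move=> /andP[kap1 kap2]; pose b : R := 2 `^ beta; have bp : 0 < b by rewrite powR_gt0.
have kap0 : 0 < kap by rewrite (lt_trans _ kap1)// powR_gt0.
have bk : 1 < b * kap by rewrite -ltr_pdivrMl// mulr1 /b -powRN.
pose K1 : R := (b * kap) `^ 2^-1.
have bk0 : 0 <= b * kap by rewrite ltW// (lt_trans ltr01).
have K1gt : 1 < K1.
  have : 1 `^ 2^-1 < K1 by apply: gt0_ltr_powR; rewrite ?nnegrE ?invr_gt0.
  by rewrite powR1.
have K12 i : K1 ^+ (2 * i) = b ^+ i * kap ^+ i.
  have K12 : K1 ^+ 2 = b * kap.
    by rewrite -powR_mulrn ?powR_ge0// /K1 -powRrM mulVf ?pnatr_eq0// powRr1.
  by rewrite exprM K12 exprMn.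
have [Cq Cq0 hq] := quasi_sum Fbin Sfin Sstab p1 tau0 K1gt.
have [Cj Cj0 hj] := jackson_Psi Fbin Sfin Sstab p1 tau0 taup ons.
pose D := 2 * B * b; have D0 : 0 <= D by rewrite !mulr_ge0// ltW.
pose A := 1 + Cj * (Cq * D).
have A0 : 0 < A by rewrite ltr_pwDl// !mulr_ge0// ltW.
exists A => // x I Lx.
(* Best approximants need not exist. Near-best ones with error e enter the sum with I + 1 weights of
   size at most 1, so an error of e / (A (I+1)) is harmless. *)
suff slack e : 0 < e -> E Psi (2 ^ I * L) x <= A * \sum_(i < I.+1) kap ^+ (I - i) * (s x i + e).
  apply/ler_addgt0Pr => e e0.
  have AI : 0 < A * I.+1%:R by rewrite mulr_gt0// ltr0n.
  apply: le_trans (slack (e / (A * I.+1%:R)) _) _; first by rewrite divr_gt0.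
  set e' := e / _; have e'0 : 0 <= e' by rewrite ltW// divr_gt0.
  apply: (@le_trans _ _ (A * (\sum_(i < I.+1) kap ^+ (I - i) * s x i + \sum_(i < I.+1) e'))).
    rewrite ler_pM2l// -big_split; apply: ler_sum => i _ /=.
    by rewrite mulrDr lerD2l ler_piMl// exprn_ile1// ltW.
  rewrite mulrDr lerD2l sumr_const card_ord -mulr_natl mulrA /e' mulrCA mulfV ?mulr1//.
  by rewrite gt_eqF.
move=> e0; pose Sg := \sum_(i < I.+1) kap ^+ (I - i) * (s x i + e).
have Sg0 : 0 <= Sg.
  by apply: sumr_ge0 => i _; rewrite mulr_ge0 ?exprn_ge0 ?(ltW kap0)// addr_ge0 ?(ltW e0).
have Sgi i : (i <= I)%N -> kap ^+ (I - i) * (s x i + e) <= Sg.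
  move=> iI; rewrite /Sg (bigD1 (Ordinal (iI : (i < I.+1)%N)))//= lerDl.
  by apply: sumr_ge0 => j _; rewrite mulr_ge0 ?exprn_ge0 ?(ltW kap0)// addr_ge0 ?(ltW e0).
have /choice[h hh] i : exists h, nterm C (2 ^ i) h /\ nrm (x - h) < E C (2 ^ i) x + e.
  by have [h ? ?] := approx_num_near (ltW p1) CL (2 ^ i) Lx e0; exists h.
have Lh i : Lp (h i) by have [/(nterm_Lp (ltW p1) CL)] := hh i.
pose y i := if i is i'.+1 then h i - h i' else h 0%N.
have ny i : nterm C (2 ^ i.+1) (y i).
  case: i => [|i] /=; first by apply: nterm_le (hh 0%N).1.
  apply: (@nterm_le _ _ _ _ (2 ^ i.+1 + 2 ^ i)%N); first by rewrite [leqRHS]expnS mul2n -addnn leq_add2l leq_exp2l.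
  by apply: ntermD; [exact: (hh _).1|apply: ntermN; exact: (hh _).1].
have ly i : nrm (y i) <= 2 * (s x i + e).
  case: i => [|i] /=.
    have -> : h 0%N = x - (x - h 0%N) by rewrite opprB addrC subrK.
    apply: le_trans (nrmB (ltW p1) Lx (LpfunB (ltW p1) Lx (Lh _))) _.
    have [_ hl] := hh 0%N; have := approx_num_nrm (ltW p1) CL (2 ^ 0) Lx.
    move=> h1; exact: addr_le_double e0 hl h1.
  rewrite (@subr_via _ (h i.+1) (h i) x).
  apply: le_trans (nrmB (ltW p1) (LpfunB (ltW p1) Lx (Lh _)) (LpfunB (ltW p1) Lx (Lh _))) _.
  have [_ hl] := hh i; have [_ hl'] := hh i.+1.
  have : E C (2 ^ i.+1) x <= E C (2 ^ i) x.
    by apply: (approx_num_anti (ltW p1) CL) => //; rewrite leq_exp2l.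
  move=> h1; exact: addr_le_double_trans hl hl' h1.
have sumy : \sum_(i < I.+1) y (I - i)%N = h I.
  rewrite (reindex_inj rev_ord_inj)/= (eq_bigr (fun i : 'I_I.+1 => y i)); last first.
    by move=> i _; rewrite subSS subKn// -ltnS.
  elim: (I) => [|n IH]; first by rewrite big_ord1.
  by rewrite big_ord_recr IH /= addrC subrK.
have By i J : (i <= I)%N -> \sum_(j < J) nrm (Q j (y (I - i)%N)) `^ tau <=
    (D * b ^+ I * Sg * K1 ^- (2 * i)) `^ tau.
  move=> iI; have pos : (0 < 2 ^ (I - i).+1)%N by rewrite expn_gt0.
  apply: le_trans (hB pos (ny _) J) _; apply: le_powR; rewrite ?(ltW tau0) ?mulr_ge0 ?powR_ge0 ?nrm_ge0//.
  rewrite natrX powRX// -/b K12 exprS.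
  apply: (@le_trans _ _ (B * (b * b ^+ (I - i)) * (2 * (s x (I - i)%N + e)))).
    by rewrite ler_wpM2l// !mulr_ge0 ?exprn_ge0 ?(ltW bp).
  have := Sgi (I - i)%N (leq_subr _ _); rewrite subKn// => h1.
  have ki : 0 < kap ^+ i by rewrite exprn_gt0.
  have bi : 0 < b ^+ i by rewrite exprn_gt0.
  have -> : b ^+ I = b ^+ (I - i) * b ^+ i by rewrite -exprD subnK.
  have bI : 0 <= b ^+ (I - i) by rewrite exprn_ge0// ltW.
  have -> : D * (b ^+ (I - i) * b ^+ i) * Sg / (b ^+ i * kap ^+ i) = D * b ^+ (I - i) * (Sg / kap ^+ i).
    by field; rewrite !gt_eqF.
  have : s x (I - i)%N + e <= Sg / kap ^+ i by rewrite ler_pdivlMr// mulrC.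
  move: (b ^+ (I - i)) bI (s x (I - i)%N + e) (Sg / kap ^+ i) => u u0 v w vw.
  have -> : B * (b * u) * (2 * v) = D * u * v by rewrite /D; ring.
  by rewrite ler_wpM2l// mulr_ge0.
have M0 : 0 <= D * b ^+ I * Sg by rewrite !mulr_ge0 ?exprn_ge0 ?(ltW bp).
have Ly i : L2 (y (I - i)%N) by exact: nterm_C_L2 (ny _).
have Bh J : \sum_(j < J) nrm (Q j (h I)) `^ tau <= (Cq * (D * b ^+ I * Sg)) `^ tau.
  rewrite -sumy; apply: (hq I.+1 J (fun i => y (I - i)%N)) => // i iI.
  exact: By.
have [M pM] := nterm_C_pw Fbin Sfin (hh I).1.
have C0 : 0 <= Cq * (D * b ^+ I * Sg) by rewrite mulr_ge0// ltW.
have [g ng hg] := hj (h I) M (2 ^ I)%N _ pM C0 Bh.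
have Lg := nterm_Lp (ltW p1) PL ng.
apply: le_trans (approx_num_le (ltW p1) PL Lx ng) _.
have -> : x - g = (x - h I) + (h I - g) by rewrite addrA subrK.
apply: le_trans (nrmD (ltW p1) (LpfunB (ltW p1) Lx (Lh _)) (LpfunB (ltW p1) (Lh _) Lg)) _.
rewrite /A mulrDl mul1r; apply: lerD.
  have [_ /ltW hl] := hh I; apply: le_trans hl (le_trans _ (Sgi I (leqnn _))).
  rewrite subnn expr0 mul1r lerD2r; case: (I) => [|n] /=; first exact: (approx_num_nrm (ltW p1) CL _ Lx).
  by apply: (approx_num_anti (ltW p1) CL) => //; rewrite leq_exp2l.
apply: le_trans hg _.
have nb : (2 ^ I).+1%:R `^ (- beta) <= b ^- I.
  rewrite powRN lef_pV2 ?posrE ?powR_gt0 ?exprn_gt0//.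
  rewrite /b -powRX//; apply: le_powR; [exact: ltW|exact: exprn_ge0|].
  by rewrite -natrX ler_nat.
have bI : 0 < b ^+ I by rewrite exprn_gt0.
apply: (@le_trans _ _ (Cj * b ^- I * (Cq * (D * b ^+ I * Sg)))).
  by rewrite ler_wpM2r// ler_wpM2l// ltW.
by apply: eq_ler; rewrite -/Sg; field; rewrite gt_eqF.
Qed.

(** Removes the factor L from the number of terms: with L <= 2^l the dyadic index is shifted by l,
    at the cost of kap^(-l), and for n < l the norm of x suffices. The further factor kap^(-1) comes
    from the index shift in [s]. *)
Lemma direct_hardy (kap : R) : 2 `^ (- beta) < kap <= 1 -> exists2 A : R, 0 < A &
  forall x n, Lp x -> E Psi (2 ^ n) x <= A * hardy_seq kap (nrm x) (fun i => E C (2 ^ i) x) n.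
Proof.
move=> /[dup] kap12 /andP[kap1 kap2].
have kap0 : 0 < kap by rewrite (lt_trans _ kap1)// powR_gt0.
have [A A0 hA] := direct_step kap12.
have [l Ll] : exists l, (L <= 2 ^ l)%N by exists L; rewrite ltnW// ltn_expl.
exists ((1 + A) * kap ^- l.+1); first by rewrite mulr_gt0 ?invr_gt0 ?exprn_gt0// addr_gt0.
move=> x n Lx; pose H I := \sum_(i < I.+1) kap ^+ (I - i) * s x i.
have H0 I : 0 <= H I by apply: sumr_ge0 => i _; rewrite mulr_ge0 ?exprn_ge0// ltW.
have HS I : kap * H I <= H I.+1.
  rewrite /H [leRHS]big_ord_recr/= mulr_sumr; rewrite -[leLHS]addr0 lerD//.
    by apply: ler_sum => i _; rewrite mulrA -exprS -subSn// -ltnS.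
  by rewrite mulr_ge0 ?exprn_ge0 ?approx_num_ge0// ltW.
have Hl i I : kap ^+ i * H I <= H (I + i)%N.
  elim: i => [|i IH]; first by rewrite expr0 mul1r addn0.
  by rewrite exprS -mulrA addnS; apply: le_trans (HS _); rewrite ler_pM2l.
have Hh : kap * H n <= hardy_seq kap (nrm x) (fun i => E C (2 ^ i) x) n.
  rewrite /H big_ord_recl subn0 mulrDr /hardy_seq; apply: lerD.
    by rewrite mulrA -exprS ler_wpM2r ?nrm_ge0// exprS ler_piMl ?exprn_ge0// ltW.
  by rewrite mulr_sumr; apply: ler_sum => i _; rewrite mulrA -exprS lift0 -subSn.
apply: (@le_trans _ _ ((1 + A) * kap ^- l * H n)); last first.
  have -> : (1 + A) * kap ^- l.+1 = (1 + A) * kap ^- l * kap^-1 by rewrite exprSr invfM mulrA.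
  rewrite -[leRHS]mulrA ler_wpM2l//; last by rewrite [leRHS]mulrC ler_pdivlMr// mulrC.
  by rewrite mulr_ge0 ?invr_ge0 ?exprn_ge0 ?(ltW kap0)// addr_ge0// ltW.
have [ln|nl] := leqP l n.
  apply: (@le_trans _ _ (E Psi (2 ^ (n - l) * L) x)).
    apply: (approx_num_anti (ltW p1) PL) => //.
    by rewrite -[in leqRHS](subnK ln) expnD leq_mul2l Ll orbT.
  apply: le_trans (hA x (n - l)%N Lx) _; rewrite -/(H _).
  have := Hl l (n - l)%N; rewrite subnK// => h; rewrite -mulrA.
  apply: ler_pM => //; [exact: ltW|by rewrite lerDr|].
  by rewrite mulrC ler_pdivlMr ?exprn_gt0// mulrC.
apply: le_trans (approx_num_nrm (ltW p1) PL _ Lx) _.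
have h0 : kap ^+ n * nrm x <= H n.
  by rewrite /H big_ord_recl subn0 lerDl; apply: sumr_ge0 => i _; rewrite mulr_ge0 ?exprn_ge0// ltW.
apply: (@le_trans _ _ (kap ^- l * H n)); last first.
  by rewrite -mulrA ler_peMl ?lerDl ?(ltW A0)// mulr_ge0 ?invr_ge0 ?exprn_ge0// ltW.
rewrite mulrC ler_pdivlMr ?exprn_gt0//; apply: le_trans h0; rewrite mulrC ler_wpM2r ?nrm_ge0//.
by apply: ler_wiXn2l => //; [exact: ltW|exact: ltnW].
Qed.

Lemma embed_C_Psi (X : set (cfun T R)) (alpha : R) q : (0 < q)%E -> alpha < beta ->
  X `<=` Lp -> approx_embed (scalars k) X N C Psi alpha q.
Proof.
(* The kernel needs kap > 2^(-beta) for [direct_step] and kap 2^alpha < 1 for Hardy, so the exponent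
   is the midpoint of alpha and beta; the maximum with 0 ensures kap <= 1. *)
move=> q0 ab XL; pose de := Num.max 0 ((alpha + beta) / 2).
have de0 : 0 <= de by rewrite le_max lexx.
have deb : de < beta by rewrite gt_max b0/= ltr_pdivrMr// mulr_natr mulr2n ltrD2r.
have ade : alpha < de by rewrite lt_max; apply/orP; right; rewrite ltr_pdivlMr// mulr_natr mulr2n ltrD2l.
pose kap : R := 2 `^ (- de).
have kap12 : 2 `^ (- beta) < kap <= 1.
  rewrite /kap powR2_lt ?ltrN2//= powRN invf_le1 ?powR_gt0//.
  by apply: (@le_trans _ _ (2 `^ 0)); [rewrite powRr0|rewrite ler_powR ?ler1n].
have [A A0 hA] := direct_hardy kap12.
apply: (@embed_of_hardy _ _ _ P k p (ltW p1) X C Psi alpha q A (kap * 2 `^ alpha)) => //.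
- exact: ltW.
- rewrite mulr_gt0 ?powR_gt0//= /kap powRN mulrC ltr_pdivrMr ?powR_gt0// mul1r.
  exact: powR2_lt.
move=> x n /XL Lx; rewrite /weighted_num powR2_natM.
apply: le_trans (ler_wpM2l _ (hA x n Lx)) _; first by rewrite exprn_ge0 ?powR_ge0.
rewrite mulrCA hardy_seq_scale; apply: eq_ler; congr (_ * hardy_seq _ _ _ _).
by apply/funext => i; rewrite powR2_natM.
Qed.

End direct_estimate.

End embeddings_of_dictionaries.

Lemma expr_unbounded {R : realType} (b x : R) : 1 < b -> exists n, x <= b ^+ n.
Proof.
move=> b1; have bern n : n%:R * (b - 1) <= b ^+ n.
  elim: n => [|n IH]; first by rewrite mul0r expr0.
  have h1 : 1 <= b ^+ n by rewrite exprn_ege1// ltW.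
  rewrite exprS -natr1 mulrDl mul1r; apply: (@le_trans _ _ (b ^+ n + (b - 1) * b ^+ n)).
    by apply: lerD => //; rewrite ler_peMr// subr_ge0 ltW.
  by apply: eq_ler; ring.
exists (Num.bound `|x / (b - 1)|); apply: le_trans (bern _).
rewrite -ler_pdivrMr ?subr_gt0//; apply: le_trans (ler_norm _) (ltW (archi_boundP _)).
exact: normr_ge0.
Qed.

Lemma add1r_le_mul_double {R : realType} (a t : R) : 0 <= a -> 1 < t -> 1 + a <= (1 + a) * (2 * t).
Proof. by move=> a0 t1; rewrite ler_peMr; lra. Qed.

Lemma mulr_add_le_double {R : realType} (a v z : R) : 0 <= a -> 0 < z -> v <= z ->
  a * z + a * v <= (1 + a) * 2 * z.
Proof.
move=> a0 z0 vz; have : a * v <= a * z by rewrite ler_wpM2l.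
have : 0 <= a * z by rewrite mulr_ge0// ltW.
by rewrite !mulrDl mul1r; lra.
Qed.

(** * Direct estimates on Sigma_n imply the Bernstein inequality *)

Section inverse_estimate.
Context d {T : measurableType d} {R : realType}.
Variables (P : probability T R) (k : scalar_kind).
Variables (F : nat -> set (set T)) (S : set (cfun T R)).
Hypothesis Fbin : binary_filtration P F.
Hypothesis Sfin : fin_dim_space k S.
Hypothesis Sstab : stability P F S.
Variables (p tau : R).
Hypotheses (p1 : 1 < p) (tau0 : 0 < tau) (taup : tau < p).
Variables (m : nat -> nat) (Phi : forall n, 'I_(m n) -> cfun T R).
Hypothesis ons : local_orthonormal_system P k F S Phi.
Implicit Types (f g h x y : cfun T R).
Notation L2 := (Lpfun P k 2%:E).
Notation Lp := (Lpfun P k p%:E).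
Notation Q := (orth_proj_diff P F S).
Notation beta := (tau^-1 - p^-1).
Notation nrm := (nrm P p).
Notation Psi := (dictPsi P p Phi).
Notation C := (dictC F S).
Notation nterm := (nterm (scalars k)).
Notation E D := (approx_num P k p D).

Let p0 : 0 < p. Proof. by rewrite (lt_trans _ p1). Qed.
Let CL : C `<=` Lp := C_Lp Fbin Sfin Sstab p1.
Let PL : Psi `<=` Lp := Psi_Lp Fbin Sfin Sstab p1 ons.
Let b0 : 0 < beta := beta_gt0 p1 tau0 taup.

Lemma Q_continuous : exists2 A : R, 0 < A & forall j f, L2 f -> Lp f -> nrm (Q j f) <= A * nrm f.
Proof.
have [A A0 hA] := bernstein_levels Fbin Sfin Sstab p1 tau0 taup.
exists A => // j f Lf Lpf; have := hA f j.+1 [set @ord_max j]%SET Lf Lpf.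
rewrite big_set1 cards1 powR1 mulr1 => h.
have h' : (nrm (Q j f) `^ tau) `^ tau^-1 <= ((A * nrm f) `^ tau) `^ tau^-1.
  by apply: le_powR; rewrite ?invr_ge0 ?powR_ge0// ltW.
by move: h'; rewrite !powRKV ?nrm_ge0// mulr_ge0 ?nrm_ge0// ltW.
Qed.

Lemma nterm_Psi_L2 n g : nterm Psi n g -> L2 g.
Proof.
move=> [l [c [x [_ kc Dx ->]]]]; apply: Lpfun_sum => [|i _]; first by rewrite ler1n.
by apply: LpfunZ => //; exact: (Psi_L2 Fbin Sfin Sstab p1 ons (Dx i)).
Qed.

(** Let 2^l be comparable to n, b = 2^beta and t = 2^alpha. Near-best approximants of g with 2^(l+i)
    terms of Psi have errors of order t^(-i) ||g||, so Bernstein for Psi bounds the i-th difference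
    by a multiple of b^l (b/t)^i ||g||, and b < t. The remainder g - h_I is not sparse in Psi; it is
    treated by the uniform boundedness of the Q_j. Only J increments matter, so I is chosen with b^I
    >= J^(1/tau), which makes the final constant independent of J. *)
Lemma inverse_Bernstein (alpha K : R) : beta < alpha -> 0 <= K ->
  (forall n g i, (0 < n)%N -> nterm C n g ->
     2 `^ (i%:R * alpha) * E Psi (2 ^ i) g <= K * n%:R `^ alpha * nrm g) ->
  exists2 B : R, 0 <= B & forall n g, (0 < n)%N -> nterm C n g -> forall J,
    \sum_(j < J) nrm (Q j g) `^ tau <= (B * n%:R `^ beta * nrm g) `^ tau.
Proof.
move=> ba K0 hK; have a0 : 0 < alpha by exact: lt_trans ba.
pose b : R := 2 `^ beta; have b1 : 1 < b by exact: powR2_gt1.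
have bp : 0 < b by rewrite (lt_trans _ b1).
pose t : R := 2 `^ alpha; have t1 : 1 < t by exact: powR2_gt1.
have tp : 0 < t by rewrite (lt_trans _ t1).
have bt : b < t by exact: powR2_lt.
have [Cl Cl0 hl] := Q_continuous.
have [A A0 hA] := bernstein_Psi Fbin Sfin Sstab p1 tau0 taup ons.
pose K1 : R := (t / b) `^ 2^-1.
have tb0 : 0 < t / b by rewrite divr_gt0.
have K1gt : 1 < K1.
  have : 1 `^ 2^-1 < K1.
    by apply: gt0_ltr_powR; rewrite ?nnegrE ?invr_gt0 ?(ltW tb0)// ltr_pdivlMr// mul1r.
  by rewrite powR1.
have K12 i : K1 ^+ (2 * i) = (t / b) ^+ i.
  have K12 : K1 ^+ 2 = t / b.
    by rewrite -powR_mulrn ?powR_ge0// /K1 -powRrM mulVf ?pnatr_eq0// powRr1// ltW.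
  by rewrite exprM K12.
have [Cq Cq0 hq] := quasi_sum Fbin Sfin Sstab p1 tau0 K1gt.
pose D0 := K + 1; have D00 : 0 < D0 by rewrite ltr_wpDl.
pose D1 := (1 + D0) * (2 * t); have D10 : 0 < D1 by rewrite !mulr_gt0// addr_gt0.
have [D2 D2E D20] : exists2 D2, D2 = A * D1 + Cl * D0 * t & 0 < D2.
  by exists (A * D1 + Cl * D0 * t) => //; rewrite (addr_gt0 (mulr_gt0 A0 D10) (mulr_gt0 (mulr_gt0 Cl0 D00) tp)).
exists (Cq * D2 * b ^+ 2); first by rewrite !mulr_ge0 ?exprn_ge0// ltW.
move=> n g n0 ng J; have Lg := nterm_C_L2 Fbin Sfin Sstab ng.
have Lpg := nterm_Lp (ltW p1) CL ng.
have n0' : 0 < n%:R :> R by rewrite ltr0n.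
(* The tolerance t^(-i) ||g|| of the near-best approximants must be positive, so functions of norm 0
   are handled separately. *)
have [G0|Gn] := eqVneq (nrm g) 0.
  rewrite big1 ?powR_ge0// => j _; have := hl j g Lg Lpg; rewrite G0 mulr0 => h.
  have -> : nrm (Q j g) = 0 by apply/eqP; rewrite eq_le h nrm_ge0.
  by rewrite powR0// gt_eqF.
have G0 : 0 < nrm g by rewrite lt0r Gn nrm_ge0.
(* Then n < 2^l <= 2 n: the lower bound gives n^alpha <= t^l, the upper one b^l <= b n^beta. *)
pose l := (trunc_log 2 n).+1.
have /andP[l1 l2] : (2 ^ trunc_log 2 n <= n < 2 ^ l)%N by exact: trunc_log_bounds.
have nl : n%:R `^ alpha <= t ^+ l.
  rewrite /t -powRX//; apply: le_powR; [exact: ltW|exact: ltW|].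
  by rewrite -natrX ler_nat ltnW.
have /choice[h hh] i : exists h, nterm Psi (2 ^ (l + i)) h /\ nrm (g - h) <= D0 * t ^- i * nrm g.
  have e0 : 0 < t ^- i * nrm g by rewrite mulr_gt0// invr_gt0 exprn_gt0.
  have [h nh hlt] := approx_num_near (ltW p1) PL (2 ^ (l + i)) Lpg e0.
  exists h; split => //; apply: le_trans (ltW hlt) _.
  rewrite /D0 mulrDl mulrDl mul1r lerD2r.
  have := hK n g (l + i)%N n0 ng; rewrite powR2_natM -/t => hle.
  rewrite -(@ler_pM2l _ (t ^+ (l + i))) ?exprn_gt0//; apply: le_trans hle _.
  have -> : t ^+ (l + i) * (K / t ^+ i * nrm g) = K * t ^+ l * nrm g.
    by rewrite exprD; field; rewrite gt_eqF// exprn_gt0.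
  by rewrite ler_wpM2r ?nrm_ge0// ler_wpM2l.
have Lh i : Lp (h i) by have [/(nterm_Lp (ltW p1) PL)] := hh i.
have L2h i : L2 (h i) by have [/nterm_Psi_L2] := hh i.
have [I hI] := @expr_unbounded R b (J%:R `^ tau^-1) b1.
pose y i := if i is i'.+1 then h i - h i' else h 0%N.
have ny i : nterm Psi (2 ^ (l + i).+1) (y i).
  case: i => [|i] /=; first by apply: nterm_le (hh 0%N).1; rewrite leq_exp2l.
  apply: (@nterm_le _ _ _ _ (2 ^ (l + i.+1) + 2 ^ (l + i))%N).
    by rewrite [leqRHS]expnS mul2n -addnn leq_add2l leq_exp2l// addnS.
  by apply: ntermD; [exact: (hh _).1|apply: ntermN; exact: (hh _).1].
have ly i : nrm (y i) <= D1 * t ^- i * nrm g.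
  case: i => [|i] /=.
    have -> : h 0%N = g - (g - h 0%N) by rewrite opprB addrC subrK.
    apply: le_trans (nrmB (ltW p1) Lpg (LpfunB (ltW p1) Lpg (Lh _))) _.
    have [_ h1] := hh 0%N; apply: le_trans (lerD (lexx _) h1) _.
    rewrite expr0 invr1 !mulr1 -{1}(mul1r (nrm g)) -mulrDl ler_wpM2r ?nrm_ge0//.
    exact: add1r_le_mul_double (ltW D00) t1.
  rewrite (@subr_via _ (h i.+1) (h i) g).
  apply: le_trans (nrmB (ltW p1) (LpfunB (ltW p1) Lpg (Lh _)) (LpfunB (ltW p1) Lpg (Lh _))) _.
  have [_ h1] := hh i; have [_ h2] := hh i.+1; apply: le_trans (lerD h1 h2) _.
  rewrite -mulrDl ler_wpM2r ?nrm_ge0// exprS invfM.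
  have ti : 0 < t ^- i by rewrite invr_gt0 exprn_gt0.
  have tV : t^-1 <= 1 by rewrite invf_le1// ltW.
  rewrite /D1; move: (t ^- i) ti => z z0.
  have -> : (1 + D0) * (2 * t) * (t^-1 * z) = (1 + D0) * 2 * z by field; rewrite gt_eqF.
  by apply: mulr_add_le_double; [exact: ltW|by []|rewrite ler_piMl// ltW].
clearbody D1 D0.
pose z i := if (i <= I)%N then y i else g - h I.
have sumz : \sum_(i < I.+2) z i = g.
  rewrite big_ord_recr/= {2}/z ltnn (eq_bigr (fun i : 'I_I.+1 => y i)); last first.
    by move=> i _; rewrite /z -ltnS ltn_ord.
  suff -> : \sum_(i < I.+1) y i = h I by rewrite addrC subrK.
  elim: (I) => [|i IH]; first by rewrite big_ord1.
  by rewrite big_ord_recr IH /= addrC subrK.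
have Lz i : L2 (z i).
  rewrite /z; case: ifP => _; first exact: nterm_Psi_L2 (ny i).
  by apply: LpfunB => //; rewrite ler1n.
have bl : 1 <= b ^+ l.+1 by rewrite exprn_ege1// ltW.
have M0 : 0 <= D2 * b ^+ l.+1 * nrm g.
  by rewrite (mulr_ge0 (mulr_ge0 (ltW D20) (le_trans ler01 bl)))// nrm_ge0.
have Bz i : (i < I.+2)%N -> \sum_(j < J) nrm (Q j (z i)) `^ tau <=
    (D2 * b ^+ l.+1 * nrm g * K1 ^- (2 * i)) `^ tau.
  rewrite ltnS leq_eqVlt => /orP[/eqP ->|iI]; last first.
    rewrite /z -ltnS iI; apply: le_trans (hA _ _ J (ny i)) _.
    apply: le_powR; [exact: ltW|by rewrite !mulr_ge0 ?powR_ge0 ?nrm_ge0// ltW|].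
    rewrite natrX powRX// -/b K12 -addSn exprD expr_div_n invf_div.
    have bi : 0 < b ^+ i by rewrite exprn_gt0.
    have ti : 0 < t ^- i by rewrite invr_gt0 exprn_gt0.
    have bl0 : 0 < b ^+ l.+1 by rewrite exprn_gt0.
    have h1 := ly i; move: h1 bi ti bl0 bl M0; move: (b ^+ i) (t ^- i) (b ^+ l.+1) (nrm (y i)) => u v w r h1 u0 v0 w0 _ _.
    apply: (@le_trans _ _ (A * (w * u) * (D1 * v * nrm g))).
      by rewrite ler_wpM2l// !mulr_ge0// ltW.
    rewrite -subr_ge0 D2E (_ : _ - _ = Cl * D0 * t * (w * u) * (v * nrm g)); last by ring.
    by rewrite !mulr_ge0// ltW.
  rewrite /z ltnn; have [_ hI1] := hh I.
  have LgI : L2 (g - h I) by apply: LpfunB => //; rewrite ler1n.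
  have LpgI : Lp (g - h I) by apply: (LpfunB (ltW p1)).
  apply: (@le_trans _ _ (\sum_(j < J) (Cl * (D0 * t ^- I * nrm g)) `^ tau)).
    apply: ler_sum => j _; apply: le_powR; [exact: ltW|exact: nrm_ge0|].
    by apply: le_trans (hl j _ LgI LpgI) _; rewrite ler_pM2l.
  have c0 : 0 <= Cl * (D0 * t ^- I * nrm g).
    by rewrite !mulr_ge0 ?nrm_ge0 ?invr_ge0 ?exprn_ge0// ltW.
  rewrite sumr_const card_ord -mulr_natl -[J%:R](@powRVK _ _ tau)// -powRM ?powR_ge0//.
  apply: le_powR; [exact: ltW|by rewrite mulr_ge0 ?powR_ge0|].
  apply: le_trans (ler_wpM2r c0 hI) _; rewrite K12 expr_div_n invf_div.
  have bI : 0 < b ^+ I by rewrite exprn_gt0.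
  have tI : 0 < t ^+ I by rewrite exprn_gt0.
  rewrite (exprS t I) (exprS b I).
  move: (b ^+ I) (t ^+ I) (b ^+ l.+1) bI tI bl => u v w u0 v0 w1.
  apply: (@le_trans _ _ (Cl * D0 * t * w * nrm g * (b * u / (t * v)))); last first.
    rewrite ler_wpM2r ?mulr_ge0 ?invr_ge0 ?mulr_ge0 ?(ltW bp) ?(ltW u0) ?(ltW tp) ?(ltW v0)//.
    rewrite ler_wpM2r ?(ltW G0)// ler_wpM2r ?(le_trans ler01 w1)// D2E lerDr.
    by rewrite mulr_ge0// ltW.
  have -> : Cl * D0 * t * w * nrm g * (b * u / (t * v)) = (w * b) * (u * (Cl * (D0 / v * nrm g))).
    by field; rewrite !gt_eqF.
  rewrite ler_peMl//; last by rewrite -[1]mulr1 ler_pM// ltW.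
  by rewrite !mulr_ge0 ?invr_ge0// ltW.
have := hq I.+2 J z _ M0 Lz Bz; rewrite sumz => h1; apply: le_trans h1 _.
apply: le_powR; [exact: ltW|by rewrite mulr_ge0// ltW|].
have nb : b ^+ l <= b * n%:R `^ beta.
  rewrite /b -powRX// -powRM//; apply: le_powR; [exact: ltW|exact: exprn_ge0|].
  by rewrite -natrX -natrM ler_nat expnS leq_mul2l.
rewrite exprS; have -> : Cq * D2 * b ^+ 2 * n%:R `^ beta * nrm g =
    Cq * (D2 * (b * (b * n%:R `^ beta)) * nrm g) by ring.
by rewrite ler_pM2l// ler_wpM2r ?nrm_ge0// ler_pM2l// ler_pM2l.
Qed.

End inverse_estimate.

(** * The gliding hump *)

Section series_limit.
Context d {T : measurableType d} {R : realType}.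
Variables (P : probability T R) (k : scalar_kind).
Implicit Types (f g h : cfun T R) (p : R).

Lemma limn_einf_ge (u : (\bar R)^nat) (c : \bar R) N :
  (forall n, (N <= n)%N -> (c <= u n)%E) -> (c <= limn_einf u)%E.
Proof.
move=> h; rewrite limn_einf_lim; apply: lime_ge; first exact: is_cvg_einfs.
exists N => // n /= Nn; apply: le_ereal_inf_tmp => _ [j /= nj <-].
by apply: h; exact: leq_trans nj.
Qed.

Lemma limn_einf_le (u : (\bar R)^nat) (c : \bar R) :
  (forall n, (u n <= c)%E) -> (limn_einf u <= c)%E.
Proof.
move=> h; rewrite limn_einf_lim; apply: lime_le; first exact: is_cvg_einfs.
apply: nearW => n; apply: le_trans (h n).
by apply: ereal_inf_lbound; exists n => /=.
Qed.

Lemma rint_modulus_le p f : 1 < p -> Lpfun P k p%:E f ->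
  P.-integrable setT (EFin \o modulus f) /\ \int[P]_x modulus f x <= nrm P p f.
Proof.
move=> p1 Lf; have h1 := @hoelder_modulus _ _ _ P k p f (fun=> 1) p1 Lf.
have [|//||i1 l1] := h1; first exact: measurable_cst.
  by apply: eq_integrable (ri_cst P 1) => // x _ /=; rewrite powR1.
split; first by apply: eq_integrable i1 => // x _ /=; rewrite mulr1.
apply: le_trans (le_trans l1 _); first by apply: eq_ler; apply: eq_Rintegral => x _; rewrite mulr1.
by rewrite powR1 rint_cst powR1 mulr1.
Qed.

Lemma series_cut_cvg (u v : nat -> R) (M : R) : (forall i, `|u i| <= v i) ->
  (forall n, \sum_(i < n) v i <= M) -> cvgn (series u).
Proof.
move=> uv vM; apply: normed_cvg; apply: nondecreasing_is_cvgn.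
  apply/nondecreasing_seqP => n; change (\sum_(0 <= i < n) `|u i| <= \sum_(0 <= i < n.+1) `|u i|).
  rewrite big_nat_recr//= lerDl; exact: normr_ge0.
exists M => _ [n _ <-]; apply: le_trans (vM n).
change (\sum_(0 <= i < n) `|u i| <= \sum_(i < n) v i); rewrite big_mkord.
by apply: ler_sum.
Qed.

Lemma le_abs_Re_Im (z : R[i]) :
  ComplexField.Normc.normc z <= `|complex.Re z| + `|complex.Im z|.
Proof.
case: z => a b /=; rewrite -[leRHS]ger0_norm ?addr_ge0// -sqrtr_sqr ler_wsqrtr//.
rewrite -[in leLHS](real_normK (num_real a)) -[in leLHS](real_normK (num_real b)).
have h : 0 <= `|a| * `|b| by rewrite mulr_ge0.
rewrite sqrrD -subr_ge0 (_ : _ - _ = 2 * (`|a| * `|b|)) ?mulr_ge0//; ring.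
Qed.

(* Almost everywhere convergence comes from an L^1 estimate, the norm estimate
   from Fatou.  The factor 2 stands in for the continuity of [powR]: eventually
   the partial sums from n on are at least half as large as their limit. *)
Lemma Lp_series p (f : nat -> cfun T R) (t : nat -> R) : 1 < p ->
  (forall i, Lpfun P k p%:E (f i)) -> (forall n N, \sum_(i < N) nrm P p (f (n + i)%N) <= t n) ->
  exists x, Lpfun P k p%:E x /\ forall n, nrm P p (x - \sum_(i < n) f i) <= 2 * t n.
Proof.
move=> p1 Lf ht; have p0 : 0 < p by exact: lt_trans p1.
have mf i := Lpfun_mfun (Lf i).
have mm i : measurable_fun setT (modulus (f i)) := measurable_modulus (mf i).
pose v w := (\sum_(i <oo) (modulus (f i) w)%:E)%E.
have v0 w : (0 <= v w)%E by apply: nneseries_ge0 => i _ _; rewrite lee_fin modulus_ge0.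
have mv : measurable_fun setT v.
  apply: (ge0_emeasurable_sum (P := predT)) => [i w _ _|i _].
    by rewrite lee_fin modulus_ge0.
  exact/measurable_EFinP.
have iv : P.-integrable setT v.
  apply/integrableP; split => //; apply: (@le_lt_trans _ _ (t 0%N)%:E); last exact: ltry.
  rewrite (eq_integral v) => [|w _]; last by rewrite gee0_abs.
  rewrite integral_nneseries//; [|by move=> i; exact/measurable_EFinP|by move=> i w _; rewrite lee_fin modulus_ge0].
  apply: lime_le.
    by apply: is_cvg_nneseries => i _ _; apply: integral_ge0 => w _; rewrite lee_fin modulus_ge0.
  apply: nearW => n; rewrite big_mkord.
  rewrite (eq_bigr (fun i : 'I_n => (\int[P]_w modulus (f i) w)%:E)); last first.
    move=> i _; rewrite /Rintegral fineK//; apply: integrable_fin_num => //.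
    by have [] := rint_modulus_le p1 (Lf i).
  rewrite sumEFin lee_fin; apply: le_trans (ht 0%N n); apply: ler_sum => i _.
  by have [] := rint_modulus_le p1 (Lf i).
pose E := [set w | (v w < +oo)%E].
have mE : measurable E by rewrite -[E]setTI; exact: emeasurable_fun_infty_o.
have aeE : \forall w \ae P, E w.
  have := integrable_ae measurableT iv; apply: filterS => w /(_ I) h.
  by rewrite /E/= -ge0_fin_numE.
have hv w n : E w -> \sum_(i < n) modulus (f i) w <= fine (v w).
  move=> Ew; rewrite -lee_fin fineK ?ge0_fin_numE// -sumEFin -(big_mkord xpredT (fun i => (modulus (f i) w)%:E)).
  by apply: nneseries_lim_ge => i _ _; rewrite lee_fin modulus_ge0.
(* Cutting the terms to the set E of absolute convergence makes the series converge at every point,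
   so its limit is measurable. *)
pose r (c : R[i] -> R) i w := c (f i w) * \1_E w.
have cr (c : R[i] -> R) w : (forall z, `|c z| <= ComplexField.Normc.normc z) ->
    series (fun i => r c i w) @ \oo --> limn (series (fun i => r c i w)).
  move=> hc; suff : cvgn (series (fun i => r c i w)) by [].
  have [Ew|nE] := pselect (E w).
    apply: (@series_cut_cvg _ (fun i => modulus (f i) w) (fine (v w))) => [i|n]; last exact: hv.
    by rewrite /r indicE mem_set// mulr1; exact: hc.
  apply: (@series_cut_cvg _ (fun=> 0) 0) => [i|n]; last by rewrite big1.
  by rewrite /r indicE memNset// mulr0 normr0.
pose x : cfun T R := fun w => Complex (limn (series (fun i => r (@complex.Re R) i w)))
                                      (limn (series (fun i => r (@complex.Im R) i w))).
have mr (c : R[i] -> R) i : measurable_fun setT (fun w => c (f i w)) -> measurable_fun setT (r c i).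
  by move=> mc; apply: measurable_funM => //; exact: measurable_indic.
have ml (c : R[i] -> R) : (forall i, measurable_fun setT (fun w => c (f i w))) ->
    (forall z, `|c z| <= ComplexField.Normc.normc z) ->
    measurable_fun setT (fun w => limn (series (fun i => r c i w))).
  move=> mc hc; apply: (@measurable_fun_cvg _ _ _ _ (fun n w => series (fun i => r c i w) n)).
    by move=> n; apply: measurable_sum => i; exact: mr.
  by move=> w _; exact: cr.
have mx : scalar_mfun k x.
  split.
  - move=> w; have kf i w' : scalars k (f i w') by have [h _ _] := mf i.
    case: k kf => //= kf; rewrite (_ : series _ = fun=> 0) ?lim_cst//.
    by apply/funext => n; rewrite /series/= big1// => i _; rewrite /r kf mul0r.
  - by apply: ml => [i|z]; [have [] := mf i|exact: abs_Re_le].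
  - by apply: ml => [i|z]; [have [] := mf i|exact: abs_Im_le].
have LS n : Lpfun P k p%:E (\sum_(i < n) f i) by apply: Lpfun_sum => //; exact: ltW.
have key n : (Lpnorm P p%:E (((2^-1)%:C)%C *: (x - \sum_(i < n) f i)) <= (t n)%:E)%E.
  have t0 : 0 <= t n by have := ht n 0%N; rewrite big_ord0.
  set g := _ *: _; pose D N : cfun T R := \sum_(i < N) f (n + i)%N.
  have LD N : Lpfun P k p%:E (D N) by apply: Lpfun_sum => //; exact: ltW.
  have mg : scalar_mfun k g.
    apply: scalar_mfunZ; first exact: scalars_real.
    apply: scalar_mfunD => //; rewrite -scaleN1r; apply: scalar_mfunZ; first exact/scalarsN/scalars1.
    exact: Lpfun_mfun (LS n).
  rewrite LpnormE0//; have -> : (t n)%:E = ((t n `^ p)%:E `^ p^-1)%E by rewrite poweR_EFin powRKV.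
  apply: gt0_ler_poweR; first by rewrite invr_ge0 ltW.
  - rewrite in_itv/= leey andbT; apply: integral_ge0 => w _; rewrite lee_fin powR_ge0//.
  - by rewrite in_itv/= leey andbT lee_fin powR_ge0.
  have mD N : measurable_fun setT (fun w => (modulus (D N) w `^ p)%:E).
    by apply/measurable_EFinP; apply: measurable_modulus_powR (Lpfun_mfun (LD N)).
  have D0 N w : (0 <= (modulus (D N) w `^ p)%:E)%E by rewrite lee_fin powR_ge0.
  have fD := @fatou _ _ _ P setT measurableT (fun N w => (modulus (D N) w `^ p)%:E) mD (fun N w _ => D0 N w).
  apply: le_trans (le_trans fD _); last first.
    apply: limn_einf_le => N.
    have -> : (\int[P]_w (modulus (D N) w `^ p)%:E)%E = (nrm P p (D N) `^ p)%:E.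
      by rewrite nrm_pow// /Rintegral fineK//; apply: integrable_fin_num => //; exact: Lpfun_ri.
    rewrite lee_fin; apply: le_powR; [exact: ltW|exact: nrm_ge0|].
    by apply: le_trans (ht n N); apply: (@nrm_sum _ _ _ P k) => //; exact: ltW.
  apply: ae_ge0_le_integral => //.
  - by move=> w _; rewrite lee_fin powR_ge0.
  - by apply/measurable_EFinP; exact: measurable_modulus_powR mg.
  - by move=> w _; apply: (@limn_einf_ge _ _ 0) => N _; exact: D0.
  - rewrite (_ : (fun w => _) = fun w => (- limn_esup (-%E \o (fun N => (modulus (D N) w `^ p)%:E)))%E).
      apply: measurableT_comp => //; apply: measurable_fun_limn_esup => N.
      exact: measurableT_comp.
    by apply/funext => w; rewrite limn_esupN oppeK.
  apply: filterS aeE => w Ew _.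
  have mgw : modulus g w = 2^-1 * modulus (x - \sum_(i < n) f i) w.
    by rewrite /g modulusZ normcZ_real ger0_norm ?invr_ge0.
  have : 0 <= modulus g w by exact: modulus_ge0.
  rewrite le_eqVlt => /predU1P[<-|g0].
    by rewrite powR0 ?gt_eqF//; apply: (@limn_einf_ge _ _ 0) => N _; exact: D0.
  have lim (c : R[i] -> R) : (forall z, `|c z| <= ComplexField.Normc.normc z) ->
      exists M0, forall M, (M0 <= M)%N ->
        `|limn (series (fun i => r c i w)) - series (fun i => r c i w) M| < modulus g w / 2.
    move=> hc; have /cvgrPdist_lt/(_ (modulus g w / 2)) := cr c w hc.
    by case; [rewrite divr_gt0|move=> M0 _ hM0; exists M0 => M; exact: hM0].
  have [M1 hM1] := lim _ (@abs_Re_le R); have [M2 hM2] := lim _ (@abs_Im_le R).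
  apply: (@limn_einf_ge _ _ (maxn M1 M2)) => N; rewrite geq_max => /andP[N1 N2].
  rewrite lee_fin; apply: le_powR; [exact: ltW|exact: modulus_ge0|].
  pose M := (n + N)%N.
  have SE : \sum_(i < M) f i = \sum_(i < n) f i + D N.
    by rewrite /M big_split_ord.
  have ReB (y z : R[i]) : complex.Re (y - z) = complex.Re y - complex.Re z by case: y z => [? ?] [].
  have ImB (y z : R[i]) : complex.Im (y - z) = complex.Im y - complex.Im z by case: y z => [? ?] [].
  have hRe : complex.Re ((x - \sum_(i < M) f i) w) =
      limn (series (fun i => r (@complex.Re R) i w)) - series (fun i => r (@complex.Re R) i w) M.
    rewrite cfunBE sum_cfunE ReB; congr (_ - _).
    rewrite /series/= big_mkord (big_morph (@complex.Re R) (id1 := 0) (op1 := +%R))//.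
      by apply: eq_bigr => i _; rewrite /r indicE mem_set// mulr1.
    by case=> [? ?] [].
  have hIm : complex.Im ((x - \sum_(i < M) f i) w) =
      limn (series (fun i => r (@complex.Im R) i w)) - series (fun i => r (@complex.Im R) i w) M.
    rewrite cfunBE sum_cfunE ImB; congr (_ - _).
    rewrite /series/= big_mkord (big_morph (@complex.Im R) (id1 := 0) (op1 := +%R))//.
      by apply: eq_bigr => i _; rewrite /r indicE mem_set// mulr1.
    by case=> [? ?] [].
  have hM : modulus (x - \sum_(i < M) f i) w <= modulus g w.
    apply: le_trans (le_abs_Re_Im _) _; rewrite hRe hIm.
    have h1 := hM1 M (leq_trans N1 (leq_addl _ _)); have h2 := hM2 M (leq_trans N2 (leq_addl _ _)).
    by apply: le_trans (ltW (ltrD h1 h2)) _; apply: eq_ler; field.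
  have : modulus (x - \sum_(i < n) f i) w <= modulus (x - \sum_(i < M) f i) w + modulus (D N) w.
    by apply: le_trans (modulusD _ _ _); rewrite SE opprD addrA subrK.
  have : modulus (x - \sum_(i < n) f i) w = 2 * modulus g w.
    by rewrite mgw mulrA divff ?pnatr_eq0// mul1r.
  move: hM; move: (modulus _ _) (modulus _ _) (modulus _ _) (modulus _ _) => a b c e.
  by clear; lra.
have Lx n : Lpfun P k p%:E (x - \sum_(i < n) f i).
  have k2 : scalars k ((2 : R)%:C)%C by exact: scalars_real.
  have Lh : Lpfun P k p%:E (((2^-1)%:C)%C *: (x - \sum_(i < n) f i)).
    split; last by apply: le_lt_trans (key n) _; rewrite ltry.
    apply: scalar_mfunZ; first exact: scalars_real.
    apply: scalar_mfunD => //; rewrite -scaleN1r; apply: scalar_mfunZ; first exact/scalarsN/scalars1.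
    exact: Lpfun_mfun (LS n).
  have := LpfunZ p0 k2 Lh; rewrite scalerA -rmorphM/= divff ?pnatr_eq0// rmorph1 scale1r//.
exists x; split; first by have := Lx 0%N; rewrite big_ord0 subr0.
move=> n; have := key n; rewrite (@LpnormE _ _ _ P k)//; last by apply: LpfunZ => //; exact: scalars_real.
rewrite lee_fin (nrmZ _ p0 (Lx n)) normcZ_real ger0_norm ?invr_ge0//.
by rewrite mulrC ler_pdivrMr// mulrC.
Qed.

End series_limit.

Section ell_q_families.
Context {R : realType}.
Implicit Types (a : nat -> R) (M u : R) (q : \bar R).

Lemma lq_le_term q a M n : (0 < q)%E -> (forall i, 0 <= a i) -> 0 <= M -> lq_le q a M -> a n <= M.
Proof.
case: q => [r| |//] q0 a0 M0 /= h; last exact: h.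
have h1 : a n `^ r <= M `^ r.
  apply: le_trans (h n.+1); rewrite big_ord_recr/= lerDr.
  by apply: sumr_ge0 => i _; exact: powR_ge0.
rewrite -(powRKV (a0 n) (q0 : 0 < r)) -(powRKV M0 (q0 : 0 < r)).
by apply: le_powR; rewrite ?powR_ge0// invr_ge0 ltW.
Qed.

(** A geometric sequence is the Hardy sequence with a = 0, which settles all q at once. *)
Lemma lq_le_geo q (K : R) : (0 < q)%E -> 1 < K -> exists2 C : R, 0 < C &
  forall u, 0 <= u -> lq_le q (fun n => u * K ^- n) (C * u).
Proof.
move=> q0 K1; have K0 : 0 < K by rewrite (lt_trans _ K1).
have [|C C0 h] := @hardy _ q K^-1 q0; first by rewrite invr_gt0 K0 invf_lt1.
exists C => // u u0; have : lq_le q (fun=> 0) (0 : R).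
  case: q q0 {h} => [r| |//] q0 /=; last by [].
  by move=> n; rewrite big1 ?powR_ge0// => i _; rewrite powR0// gt_eqF.
move=> /(h u _ 0 u0 (fun=> lexx 0) (lexx 0)); rewrite addr0.
rewrite (_ : hardy_seq _ _ _ = fun n => u * K ^- n)//; apply/funext => n.
by rewrite /hardy_seq big1 ?addr0 => [|i _]; rewrite ?mulr0// exprVn mulrC.
Qed.

(** For finite q half of the decay 4^(-i) pays for the weights 2^i in [wsum_powR], the other half
    makes the sum over i converge; thus q < 1 is no obstacle. *)
Lemma lq_le_family q : (0 < q)%E -> exists2 C : R, 0 < C &
  forall (b : nat -> nat -> R) (M : R), 0 <= M -> (forall i n, 0 <= b i n) ->
    (forall i, lq_le q (b i) (M * 4 ^- i)) ->
    lq_le q (fun n => \sum_(i < n.+1) b i n) (C * M).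
Proof.
case: q => [r| |//] q0; last first.
  exists (4 / (4 - 1)) => [|b M M0 b0 h n]; first by rewrite divr_gt0// subr_gt0 ltr1n.
  apply: (@le_trans _ _ (\sum_(i < n.+1) M * 4 ^- i)); first by apply: ler_sum => i _; exact: h.
  by rewrite -mulr_sumr mulrC ler_wpM2r// sum_geo_inv_le// ltr1n.
have r0 : 0 < r := q0.
have K1 : 1 < 2 :> R by rewrite ltr1n.
pose Kt : R := 2 `^ r; have Kt1 : 1 < Kt by exact: powR2_gt1.
have g0 : 0 < Kt / (Kt - 1) by rewrite divr_gt0 ?subr_gt0 ?(lt_trans ltr01 Kt1).
exists (2 / (2 - 1) * (Kt / (Kt - 1)) `^ r^-1).
  by rewrite mulr_gt0 ?powR_gt0// divr_gt0// subr_gt0.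
move=> b M M0 b0 h n /=; set c : R := 2 / (2 - 1).
have c0 : 0 <= c by rewrite divr_ge0// subr_ge0 ltW.
apply: (@le_trans _ _ (\sum_(j < n) c `^ r * \sum_(i < n) (2 ^+ i * b i j) `^ r)).
  apply: ler_sum => j _; apply: le_trans (@wsum_powR R 2 r j.+1 (fun i => b i j) K1 r0 (fun i => b0 i j)) _.
  rewrite ler_wpM2l ?powR_ge0//.
  rewrite (big_ord_widen n (fun i => (2 ^+ i * b i j) `^ r))// big_mkcond/=.
  by apply: ler_sum => i _; case: ifP => // _; exact: powR_ge0.
rewrite -mulr_sumr exchange_big/= -mulrA (powRM _ c0); last by apply: mulr_ge0 => //; exact: powR_ge0.
rewrite ler_wpM2l ?powR_ge0// powRM ?powR_ge0// powRVK ?(ltW g0)//.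
apply: (@le_trans _ _ (\sum_(i < n) M `^ r * Kt ^- i)); last first.
  by rewrite -mulr_sumr mulrC ler_wpM2r ?powR_ge0// sum_geo_inv_le.
apply: ler_sum => i _.
rewrite (eq_bigr (fun j : 'I_n => (2 ^+ i) `^ r * b i j `^ r)); last first.
  by move=> j _; rewrite powRM// exprn_ge0.
rewrite -mulr_sumr; apply: le_trans (ler_wpM2l (powR_ge0 _ _) (h i n)) _.
have Ki : 0 < 2 ^+ i :> R by rewrite exprn_gt0.
rewrite -powRM ?mulr_ge0 ?invr_ge0 ?exprn_ge0//.
have -> : 2 ^+ i * (M * 4 ^- i) = M * 2 ^- i.
  have -> : 4 = 2 * 2 :> R by rewrite -natrM.
  by rewrite exprMn; field; rewrite gt_eqF.
rewrite powRM ?invr_ge0 ?(ltW Ki)// powRV ?(ltW Ki)// ler_wpM2l ?powR_ge0//.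
by rewrite /Kt powRX.
Qed.

Lemma lq_le_cut q (t : R) : (0 < q)%E -> 1 < t -> exists2 C : R, 0 < C &
  forall (D : pred nat) (W : R), 0 <= W -> (forall n, D n.+1 -> D n) ->
    (forall n, D n -> t ^+ n <= W) ->
    lq_le q (fun n => if D n then t ^+ n else 0) (C * W).
Proof.
case: q => [r| |//] q0 t1; last first.
  by exists 1 => // D W W0 DS h n; rewrite mul1r; case: ifP => //; exact: h.
have r0 : 0 < r := q0; have t0 : 0 < t by rewrite (lt_trans _ t1).
pose Kt : R := t `^ r; have Kt1 : 1 < Kt.
  have : 1 `^ r < t `^ r by apply: gt0_ltr_powR; rewrite ?nnegrE ?ltW.
  by rewrite powR1.
have g0 : 0 < Kt / (Kt - 1) by rewrite divr_gt0 ?subr_gt0 ?(lt_trans ltr01 Kt1).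
exists ((Kt / (Kt - 1)) `^ r^-1); first by rewrite powR_gt0.
move=> D W W0 DS h n /=; rewrite powRM ?powR_ge0// powRVK ?(ltW g0)//.
rewrite (eq_bigr (fun i : 'I_n => if D i then Kt ^+ i else 0)); last first.
  by move=> i _; case: ifP => _; rewrite ?powR0 ?gt_eqF// powRX// ltW.
rewrite -big_mkcond/=; apply: sum_geo_down_le => //; first exact: powR_ge0.
move=> i Di; rewrite /Kt -powRX ?(ltW t0)//.
by apply: le_powR; [exact: ltW|rewrite exprn_ge0// ltW|exact: h].
Qed.

End ell_q_families.

Lemma sign_choice {R : realType} (a b c : R) : 2 * a <= b + c -> b < a -> a <= c.
Proof. by lra. Qed.

Lemma le_mul_of_mul_div_le {R : realType} (t j eta ti e : R) : 0 < t -> 0 < eta ->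
  t * j / eta <= t * ti * e -> j <= ti * (eta * e).
Proof.
move=> t0 e0; rewrite ler_pdivrMr// => h; rewrite -(ler_pM2l t0); apply: le_trans h _.
by apply: eq_ler; ring.
Qed.

Lemma le_of_double_le_add1 {R : realType} (a u v w : R) : 1 <= a -> 2 * a <= u -> u <= v + w -> w <= 1 ->
  a <= v.
Proof. by lra. Qed.

Lemma double_le_of_div4 {R : realType} (t e e' : R) : 1 < t -> 0 < e -> e' <= e / (4 * t) -> 2 * e' <= e.
Proof.
move=> t1 e0 h; suff : e / (4 * t) <= e / 4 by lra.
by rewrite ler_pM2l// lef_pV2 ?posrE ?mulr_gt0 ?(lt_trans ltr01 t1)// ler_peMr// ltW.
Qed.

Lemma lq_le_mono {R : realType} (q : \bar R) (a : nat -> R) (M M' : R) :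
  (0 < q)%E -> 0 <= M -> M <= M' -> lq_le q a M -> lq_le q a M'.
Proof.
case: q => [r| |//] q0 M0 MM /= h n; last exact: le_trans (h n) MM.
by apply: le_trans (h n) _; apply: le_powR => //; exact: ltW.
Qed.

Section gliding_hump.
Context d {T : measurableType d} {R : realType}.
Variables (P : probability T R) (k : scalar_kind).
Variables (F : nat -> set (set T)) (S : set (cfun T R)).
Hypothesis Fbin : binary_filtration P F.
Hypothesis Sfin : fin_dim_space k S.
Hypothesis Sstab : stability P F S.
Variables (p tau : R).
Hypotheses (p1 : 1 < p) (tau0 : 0 < tau) (taup : tau < p).
Variables (m : nat -> nat) (Phi : forall n, 'I_(m n) -> cfun T R).
Hypothesis ons : local_orthonormal_system P k F S Phi.
Implicit Types (f g h x y : cfun T R).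
Notation Lp := (Lpfun P k p%:E).
Notation beta := (tau^-1 - p^-1).
Notation nrm := (nrm P p).
Notation Psi := (dictPsi P p Phi).
Notation C := (dictC F S).
Notation nterm := (nterm (scalars k)).
Notation E D := (approx_num P k p D).

Let p0 : 0 < p. Proof. by rewrite (lt_trans _ p1). Qed.
Let CL : C `<=` Lp := C_Lp Fbin Sfin Sstab p1.
Let PL : Psi `<=` Lp := Psi_Lp Fbin Sfin Sstab p1 ons.
Let b0 : 0 < beta := beta_gt0 p1 tau0 taup.

Variable alpha : R.
Hypothesis ba : beta < alpha.
Hypothesis noBI : ~ Bernstein P F S p tau.

Variable t : R.
Hypothesis tE : t = 2 `^ alpha.
Let a0 : 0 < alpha. Proof. exact: lt_trans ba. Qed.
Let t1 : 1 < t. Proof. by rewrite tE powR2_gt1. Qed.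
Let t0 : 0 < t. Proof. exact: lt_trans t1. Qed.

(** If there were no such hump for K, scaling g to norm n^(-alpha) would show the hypothesis of
    [inverse_Bernstein], hence BI. The index is a successor because [hump_sign] loses one dyadic
    step; at index 0 the inequality to be excluded cannot occur, since K >= 1 and n^alpha >= 1. *)
Lemma hump K : 1 <= K -> exists n i g, [/\ (0 < n)%N, nterm C n g,
  nrm g <= (n%:R `^ alpha)^-1 & K < t ^+ i.+1 * E Psi (2 ^ i.+1) g].
Proof.
move=> K1; apply: contrapT => no; apply: noBI.
apply/(Bernstein_real Fbin Sfin Sstab p1 tau0).
have K0 : 0 <= K by exact: le_trans K1.
apply: (inverse_Bernstein Fbin Sfin Sstab p1 tau0 taup ons ba K0) => n g i n0 ng.
rewrite powR2_natM -tE; have Lg := nterm_Lp (ltW p1) CL ng.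
have na1 : 1 <= n%:R `^ alpha.
  have : 1 `^ alpha <= n%:R `^ alpha by apply: le_powR; rewrite ?ler1n// ltW.
  by rewrite powR1.
have na0 : 0 < n%:R `^ alpha by exact: lt_le_trans na1.
have Eg := approx_num_nrm (ltW p1) PL (2 ^ i) Lg.
have [Gz|Gn] := eqVneq (nrm g) 0.
  by rewrite Gz mulr0 pmulr_rle0 ?exprn_gt0// -Gz.
have G0 : 0 < nrm g by rewrite lt0r Gn nrm_ge0.
case: i Eg => [|i] Eg.
  rewrite expr0 mul1r; apply: le_trans Eg _; rewrite ler_peMl ?nrm_ge0//.
  exact: mulr_ege1.
pose c := n%:R `^ alpha * nrm g; have c0 : 0 < c by rewrite mulr_gt0.
rewrite leNgt; apply/negP => lt; apply: no.
exists n, i, (((c^-1)%:C)%C *: g); split => //.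
- by apply: ntermZ => //; exact: scalars_real.
- by rewrite (nrmZ _ p0 Lg) normcZ_real ger0_norm ?invr_ge0 ?(ltW c0)// /c invfM mulfVK.
have Lg' : Lp (((c^-1)%:C)%C *: g) by apply: LpfunZ => //; exact: scalars_real.
have := approx_numZ (ltW p1) PL (2 ^ i.+1) c Lg'.
rewrite scalerA -rmorphM/= divff ?gt_eqF// rmorph1 scale1r (ger0_norm (ltW c0)) => h.
rewrite -(ltr_pM2r c0); apply: lt_le_trans (_ : t ^+ i.+1 * E Psi (2 ^ i.+1) g <= _).
  by rewrite /c mulrA.
by rewrite -mulrA ler_pM2l ?exprn_gt0// [leRHS]mulrC.
Qed.

(** The size that a hump must have so that, after multiplication by e and the loss of one dyadic
    step, 2 (j+1) remains. The summand 1 secures the hypothesis 1 <= K of [hump]. *)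
Let bigK j (e : R) := 1 + t * (2 * j.+1%:R) / e.

(* [eta j] is fixed before the j-th hump, whose quality [bigK j (eta j)] can thus
   outweigh it; the later [eta] are too small to spoil the j-th hump. *)
Lemma humps : exists (n i : nat -> nat) (g : nat -> cfun T R) (eta : nat -> R),
  eta 0%N = 1 /\ forall j,
  [/\ eta j.+1 = eta j / (4 * t) / t ^+ (i j).+1, 0 < eta j, (0 < n j)%N, nterm C (n j) (g j) &
      nrm (g j) <= ((n j)%:R `^ alpha)^-1 /\
      2 * j.+1%:R <= t ^+ i j * (eta j * E Psi (2 ^ (i j).+1) (g j))].
Proof.
have bK j (e : R) : 0 < e -> 1 <= bigK j e.
  by move=> e0; rewrite lerDl divr_ge0 ?mulr_ge0 ?ler0n// ltW.
have /choice[w hw] (je : nat * R) : exists w : nat * nat * cfun T R, 0 < je.2 ->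
    [/\ (0 < w.1.1)%N, nterm C w.1.1 w.2, nrm w.2 <= (w.1.1%:R `^ alpha)^-1 &
        bigK je.1 je.2 < t ^+ w.1.2.+1 * E Psi (2 ^ w.1.2.+1) w.2].
  case: je => j e /=; have [e0|e0] := boolP (0 < e); last first.
    by exists (0%N, 0%N, 0).
  by have [n [i [g hg]]] := hump (bK j e e0); exists (n, i, g).
(* The factor 1/(4 t) makes eta_j <= (4 t)^(-j), hence the series summable with room for the weights
   t^j; the power of t makes the tail after hump j negligible at level i_j. *)
pose fix eta j := if j is j'.+1 then eta j' / (4 * t) / t ^+ (w (j', eta j')).1.2.+1 else 1.
have eta0 j : 0 < eta j.
  elim: j => [|j IH] //=; rewrite !divr_gt0// ?mulr_gt0// exprn_gt0//.
exists (fun j => (w (j, eta j)).1.1), (fun j => (w (j, eta j)).1.2), (fun j => (w (j, eta j)).2), eta.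
split => // j; have [n0 ng gn gK] := hw (j, eta j) (eta0 j); split => //; split => //.
move: gK => /=; set i := (w _).1.2; set e := E _ _ _ => gK.
have ej := eta0 j; have : t * (2 * j.+1%:R) / eta j <= t ^+ i.+1 * e.
  by apply: le_trans (ltW gK); rewrite /bigK lerDr.
rewrite exprS; exact: le_mul_of_mul_div_le.
Qed.

(* One of the signs 1, -1 works: the two errors add up to at least the error of
   the difference 2 * eta * g, computed with twice as many terms. *)
Lemma hump_sign y g (eta : R) i : Lp y -> Lp g -> 0 <= eta -> exists s : R,
  `|s| = 1 /\ eta * E Psi (2 ^ i.+1) g <= E Psi (2 ^ i) (y + ((s * eta)%:C)%C *: g).
Proof.
move=> Ly Lg eta0; have Le (a : R) : Lp ((a%:C)%C *: g) by apply: LpfunZ => //; exact: scalars_real.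
pose u s := y + ((s * eta)%:C)%C *: g.
have Lu s : Lp (u s) by apply: (LpfunD (ltW p1)).
have h : 2 * (eta * E Psi (2 ^ i.+1) g) <= E Psi (2 ^ i) (u 1) + E Psi (2 ^ i) (u (-1)).
  have [->|e0] := eqVneq eta 0; first by rewrite mul0r mulr0 addr_ge0 ?approx_num_ge0.
  have ep : 0 < 2 * eta by rewrite mulr_gt0// lt0r e0.
  have := approx_numD (ltW p1) PL (2 ^ i) (2 ^ i) (Lu 1) (LpfunN p0 (Lu (-1))).
  have -> : (2 ^ i + 2 ^ i = 2 ^ i.+1)%N by rewrite expnS mul2n addnn.
  have -> : u 1 - u (-1) = ((2 * eta)%:C)%C *: g.
    rewrite /u mul1r mulN1r opprD addrACA subrr add0r -scalerBl -rmorphB/= opprK.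
    by rewrite mulr_natl mulr2n.
  have hN : E Psi (2 ^ i) (- u (-1)) <= E Psi (2 ^ i) (u (-1)).
    have := approx_numZ (ltW p1) PL (2 ^ i) (-1) (Lu (-1)).
    by rewrite rmorphN1 scaleN1r normrN1 mul1r.
  have hS : 2 * eta * E Psi (2 ^ i.+1) g <= E Psi (2 ^ i.+1) (((2 * eta)%:C)%C *: g).
    have := approx_numZ (ltW p1) PL (2 ^ i.+1) (2 * eta)^-1 (Le (2 * eta)).
    rewrite scalerA -rmorphM/= mulVf ?gt_eqF// rmorph1 scale1r ger0_norm ?invr_ge0 ?(ltW ep)//.
    by rewrite ler_pdivlMl.
  move=> h; rewrite mulrA; apply: le_trans hS (le_trans h _).
  by rewrite lerD2l.
have [h1|h1] := leP (eta * E Psi (2 ^ i.+1) g) (E Psi (2 ^ i) (u 1)).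
  by exists 1; rewrite normr1.
exists (-1); rewrite normrN1; split => //; rewrite -/(u (-1)).
exact: sign_choice h h1.
Qed.

(** A budget of 2^l terms in which hump j may use 2^(l-j-1). *)
Lemma sum_expn_le l : (\sum_(j < l) 2 ^ (l - j.+1) <= 2 ^ l)%N.
Proof.
elim: l => [|l IH]; first by rewrite big_ord0.
rewrite big_ord_recl subSS subn0 expnS mul2n -addnn leq_add2l.
by apply: leq_trans IH; apply: leq_sum => j _; rewrite lift0 subSS.
Qed.

(** The function x is the sum of f_j, the humps eta_j g_j with signs. For C, level l represents
    exactly those humps whose length fits their share of the 2^l terms; the others contribute their
    norm eta_j n_j^(-alpha), and the tail from l on contributes 4 eta_l. A hump is too long only at
    levels with 2^l < n_j 2^(j+1), where t^l is at most n_j^alpha t^(j+1), so its total contribution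
    is of order eta_j t^(j+1), which decays like 4^(-j). For Psi, hump j alone makes the weighted
    number at level i_j exceed j + 1. One function x serves all q. *)
Lemma gliding_hump : exists x, [/\ LpS P k F S p x,
  forall q : \bar R, (0 < q)%E -> exists2 M, 0 <= M & lq_le q (weighted_num P k p C alpha x) M &
  forall j, exists i, j.+1%:R <= weighted_num P k p Psi alpha x i].
Proof.
have [n [i [g [eta [e0 H]]]]] := humps.
have eta0 j : 0 < eta j by have [] := H j.
have Lg j : Lp (g j) by have [_ _ _ /(nterm_Lp (ltW p1) CL)] := H j.
have n1 j : 1 <= (n j)%:R `^ alpha.
  have : 1 `^ alpha <= (n j)%:R `^ alpha by apply: le_powR; rewrite ?(ltW a0)// ler1n; have [] := H j.
  by rewrite powR1.
have nn j : 0 < (n j)%:R `^ alpha by exact: lt_le_trans (n1 j).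
(* The sign of hump j depends on the partial sum before it, hence on all earlier signs; it is
   therefore chosen for all pairs of an index and a function. *)
have /choice[s hs] (jy : nat * cfun T R) : exists s : R, Lp jy.2 -> `|s| = 1 /\
    eta jy.1 * E Psi (2 ^ (i jy.1).+1) (g jy.1) <=
    E Psi (2 ^ i jy.1) (jy.2 + ((s * eta jy.1)%:C)%C *: g jy.1).
  have [Ly|nL] := pselect (Lp jy.2); last by exists 0.
  by have [s hs] := hump_sign (i jy.1) Ly (Lg jy.1) (ltW (eta0 jy.1)); exists s.
pose fix X j := if j is j'.+1 then X j' + ((s (j', X j') * eta j')%:C)%C *: g j' else 0.
pose f j := ((s (j, X j) * eta j)%:C)%C *: g j.
have XS j : X j.+1 = X j + f j by [].
have Lf j : Lp (f j) by apply: LpfunZ => //; exact: scalars_real.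
have LX j : Lp (X j).
  by elim: j => [|j IH]; [exact: Lpfun0|rewrite XS; apply: (LpfunD (ltW p1))].
have sumf j : \sum_(l < j) f l = X j.
  by elim: j => [|j IH]; [rewrite big_ord0|rewrite big_ord_recr IH].
have nf j : nrm (f j) <= eta j * ((n j)%:R `^ alpha)^-1.
  rewrite (nrmZ _ p0 (Lg j)) normcZ_real normrM; have [-> _] := hs (j, X j) (LX j).
  rewrite mul1r gtr0_norm// ler_pM2l//; by have [_ _ _ _ []] := H j.
have nfe j : nrm (f j) <= eta j.
  by apply: le_trans (nf j) _; rewrite ler_piMr ?(ltW (eta0 j))// invf_le1.
have t41 : 1 < 4 * t by rewrite (lt_le_trans t1)// ler_peMl ?(ltW t0)// ler1n.
have t4 : 0 < 4 * t by rewrite mulr_gt0.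
have etaS j : eta j.+1 * t ^+ (i j).+1 = eta j / (4 * t).
  by have [-> _ _ _ _] := H j; rewrite divfK// gt_eqF// exprn_gt0.
have eta4 j : eta j.+1 <= eta j / (4 * t).
  by rewrite -etaS ler_peMr ?(ltW (eta0 _))// exprn_ege1// ltW.
have eta2 j : 2 * eta j.+1 <= eta j.
  exact: double_le_of_div4 t1 (eta0 j) (eta4 j).
have etaK j : eta j <= (4 * t) ^- j.
  elim: j => [|j IH]; first by rewrite e0 expr0 invr1.
  by apply: le_trans (eta4 j) _; rewrite exprSr (invfM ((4 * t) ^+ j)) ler_wpM2r// invr_ge0 ltW.
have etasum N j : \sum_(l < N) eta (j + l)%N <= 2 * eta j.
  elim: N j => [|N IH] j; first by rewrite big_ord0 mulr_ge0// ltW.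
  rewrite big_ord_recl addn0 mulr_natl mulr2n lerD2l.
  apply: le_trans (eta2 j); rewrite (eq_bigr (fun l : 'I_N => eta (j.+1 + l)%N)); first exact: IH.
  by move=> l _; rewrite lift0 addnS.
have [|x [Lx hx]] := @Lp_series _ T R P k p f (fun j => 2 * eta j) p1 Lf.
  by move=> j N; apply: le_trans (etasum N j); apply: ler_sum => l _; exact: nfe.
have {}hx j : nrm (x - X j) <= 4 * eta j.
  by rewrite -sumf; apply: le_trans (hx j) _; rewrite mulrA -natrM.
have nfC j : nterm C (n j) (f j).
  by apply: ntermZ; [exact: scalars_real|have [] := H j].
exists x; split.
- split=> // e e1; have [j hj] := @expr_unbounded R (4 * t) (8 / e) t41.
  exists (X j).
    exists (\sum_(l < j) n l)%N => //; rewrite -sumf; exact: nterm_sum.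
  rewrite (LpnormE p0 (LpfunB (ltW p1) Lx (LX j))) lte_fin; apply: le_lt_trans (hx j) _.
  apply: (@le_lt_trans _ _ (4 * (4 * t) ^- j)); first by rewrite ler_pM2l.
  rewrite ltr_pdivrMr ?exprn_gt0//; apply: (@lt_le_trans _ _ 8); first by rewrite ltr_nat.
  by rewrite mulrC -ler_pdivrMr.
- move=> q q0.
  have [C1 C10 hC1] := @lq_le_geo R q 4 q0 (ltr1n R 4).
  have [C2 C20 hC2] := lq_le_cut q0 t1.
  have [C3 C30 hC3] := @lq_le_family R q q0.
  (* Hump j exceeds its share 2^(l-j-1) of the terms at level l. *)
  pose cond j l := (2 ^ l < n j * 2 ^ j.+1)%N.
  (* Index 0 bounds the tail from l on, index j+1 the contribution of hump j while it is too
     long. *)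
  pose b j l := if j is j'.+1 then eta j' * ((n j')%:R `^ alpha)^-1 * (if cond j' l then t ^+ l else 0)
                else 4 * 4 ^- l.
  have bb0 j l : 0 <= b j l.
    case: j => [|j] /=; first by rewrite mulr_ge0// invr_ge0 exprn_ge0.
    by rewrite !mulr_ge0 ?invr_ge0 ?(ltW (eta0 _)) ?powR_ge0//; case: ifP => // _; rewrite exprn_ge0 ?(ltW t0).
  pose M := C1 * 4 + C2 * t * 4.
  have M0 : 0 <= M by rewrite addr_ge0// !mulr_ge0// ltW.
  have hb j : lq_le q (b j) (M * 4 ^- j).
    case: j => [|j].
      apply: (lq_le_mono q0 _ _ (hC1 4 _)) => //; first by rewrite mulr_ge0// ltW.
      by rewrite expr0 invr1 mulr1 lerDl !mulr_ge0// ltW.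
    (* The largest value t^l can take while hump j is too long; n_j^alpha in it cancels the norm of
       the hump. *)
    pose W := (n j)%:R `^ alpha * t ^+ j.+1.
    have W0 : 0 <= W by rewrite mulr_ge0 ?powR_ge0// exprn_ge0// ltW.
    have hc : lq_le q (fun l => if cond j l then t ^+ l else 0) (C2 * W).
      apply: hC2 => // [l|l]; first by apply: ltn_trans; rewrite ltn_exp2l.
      rewrite /cond => /ltnW hl; rewrite /W tE -!powRX// -powRM ?exprn_ge0//.
      apply: le_powR; [exact: ltW|exact: exprn_ge0|].
      by rewrite -!natrX -natrM ler_nat.
    have ce : 0 <= eta j * ((n j)%:R `^ alpha)^-1 by rewrite mulr_ge0 ?invr_ge0 ?(ltW (nn j)) ?(ltW (eta0 j)).
    have CW : 0 <= C2 * W by rewrite mulr_ge0// ltW.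
    apply: (lq_le_mono q0 _ _ (lq_le_scale q0 (bb0 j.+1) CW ce _ _ hc)).
    + exact: mulr_ge0.
    + have -> : eta j * ((n j)%:R `^ alpha)^-1 * (C2 * W) = C2 * (eta j * t ^+ j.+1).
        by rewrite /W; field; rewrite gt_eqF.
      apply: (@le_trans _ _ (C2 * t * 4 * 4 ^- j.+1)); last first.
        by rewrite ler_wpM2r ?invr_ge0 ?exprn_ge0// lerDr mulr_ge0// ltW.
      have := etaK j; rewrite exprMn => hj.
      apply: (@le_trans _ _ (C2 * ((4 ^+ j * t ^+ j)^-1 * t ^+ j.+1))).
        by rewrite ler_pM2l// ler_wpM2r// exprn_ge0// ltW.
      by apply: eq_ler; rewrite !exprS; field; rewrite !gt_eqF ?exprn_gt0.
    + by move=> l; case: ifP => // _; rewrite exprn_ge0// ltW.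
    + by move=> l.
  have up l : weighted_num P k p C alpha x l <= \sum_(j < l.+1) b j l.
    rewrite /weighted_num powR2_natM -tE big_ord_recl.
    pose h := \sum_(j < l | ~~ cond j l) f j.
    have nh : nterm C (2 ^ l) h.
      apply: (@nterm_le _ _ _ _ (\sum_(j < l | ~~ cond j l) n j)%N); last by apply: nterm_sum => j _.
      apply: leq_trans (sum_expn_le l); rewrite [leqRHS](bigID (fun j : 'I_l => ~~ cond j l))/=.
      apply: leq_trans (leq_addr _ _); apply: leq_sum => j; rewrite -leqNgt => hj.
      rewrite -(@leq_pmul2r (2 ^ j.+1)) ?expn_gt0// -expnD subnK//.
    apply: (@le_trans _ _ (t ^+ l * (4 * eta l + \sum_(j < l | cond j l) eta j * ((n j)%:R `^ alpha)^-1))).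
      rewrite ler_pM2l ?exprn_gt0//; apply: le_trans (approx_num_le (ltW p1) CL Lx nh) _.
      have -> : x - h = (x - X l) + \sum_(j < l | cond j l) f j.
        rewrite -(sumf l) (bigID (fun j : 'I_l => cond j l))/= -/h.
        by rewrite opprD addrA addrAC subrK.
      have Lsum : Lp (\sum_(j < l | cond j l) f j) by apply: Lpfun_sum => //; exact: ltW.
      apply: le_trans (nrmD (ltW p1) (LpfunB (ltW p1) Lx (LX l)) Lsum) _.
      apply: lerD; first exact: hx.
      apply: le_trans (_ : \sum_(j < l | cond j l) nrm (f j) <= _).
        by apply: (@nrm_sum _ _ _ P k) => //; exact: ltW.
      by apply: ler_sum => j _; exact: nf.
    rewrite mulrDr; apply: lerD.
      rewrite /b /=; apply: (@le_trans _ _ (t ^+ l * (4 * (4 * t) ^- l))).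
        by rewrite ler_pM2l ?exprn_gt0// ler_pM2l.
      by rewrite exprMn; apply: eq_ler; field; rewrite !gt_eqF ?exprn_gt0.
    rewrite [leRHS](eq_bigr (fun j : 'I_l => b j.+1 l)) => [|j _]; last by rewrite lift0.
    rewrite mulr_sumr big_mkcond/=; apply: ler_sum => j _; rewrite /b.
    case: ifP => _; last by rewrite mulr0.
    by rewrite mulrC.
  exists (1 * (C3 * M)); first by rewrite mul1r mulr_ge0// ltW.
  apply: (lq_le_scale q0 _ _ _ _ _ (hC3 b M M0 bb0 hb)) => //.
  + exact: weighted_num_ge0.
  + by rewrite mulr_ge0// ltW.
  + by move=> l; apply: sumr_ge0.
  + by move=> l; rewrite mul1r; exact: up.
- move=> j; exists (i j); rewrite /weighted_num powR2_natM -tE.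
  have [_ h1] := hs (j, X j) (LX j); rewrite /= -/(f j) -XS in h1.
  have h2 := approx_num_lip (ltW p1) PL (2 ^ i j) (LX j.+1) Lx.
  have h3 : nrm (X j.+1 - x) <= 4 * eta j.+1 by rewrite -nrmN opprB; exact: hx.
  have [_ _ _ _ [_ h4]] := H j.
  (* At level i_j the tail after hump j costs at most 1, which leaves 2 (j+1) - 1 >= j+1. *)
  have h5 : t ^+ i j * (4 * eta j.+1) <= 1.
    have -> : t ^+ i j * (4 * eta j.+1) = 4 * (eta j.+1 * t ^+ (i j).+1) / t.
      by rewrite exprS; field; rewrite gt_eqF.
    rewrite etaS ler_pdivrMr// mul1r.
    have -> : 4 * (eta j / (4 * t)) = eta j / t by field; rewrite gt_eqF.
    rewrite ler_pdivrMr//; apply: (@le_trans _ _ 1).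
      by apply: le_trans (etaK j) _; rewrite invf_le1 ?exprn_gt0// exprn_ege1// ltW.
    by apply: mulr_ege1; exact: ltW.
  have h6 : t ^+ i j * (eta j * E Psi (2 ^ (i j).+1) (g j)) <=
      t ^+ i j * E Psi (2 ^ i j) x + t ^+ i j * (4 * eta j.+1).
    rewrite -mulrDr ler_pM2l ?exprn_gt0//; apply: le_trans h1 (le_trans h2 _).
    by rewrite lerD2l.
  by apply: le_of_double_le_add1 h4 h6 h5; rewrite ler1n.
Qed.

End gliding_hump.

Theorem theorem2p6 (R : realType) (d : measure_display) (T : measurableType d)
    (P : probability T R) (k : scalar_kind) (F : nat -> set (set T))
    (S : set (cfun T R)) (p tau : R) (m : nat -> nat)
    (Phi : forall n, 'I_(m n) -> cfun T R) :
  binary_filtration P F ->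
  fin_dim_space k S ->
  stability P F S ->
  1 < p -> 0 < tau -> tau < p ->
  local_orthonormal_system P k F S Phi ->
  let beta := tau^-1 - p^-1 in
  let K := scalars k in
  let X := LpS P k F S p in
  let N := Lpnorm P p%:E in
  let C := dictC F S in
  let Psi := dictPsi P p Phi in
  (~ Bernstein P F S p tau ->
     forall (alpha : R) (q : \bar R), beta < alpha -> (0 < q)%E ->
       approx_embed K X N Psi C alpha q /\
       approx_space K X N Psi alpha q <> approx_space K X N C alpha q) /\
  (Bernstein P F S p tau ->
     forall (alpha : R) (q : \bar R), 0 < alpha < beta -> (0 < q)%E ->
       [/\ approx_space K X N C alpha q = approx_space K X N Psi alpha q,
           approx_embed K X N C Psi alpha q &
           approx_embed K X N Psi C alpha q]).
Proof.
move=> Fbin Sfin Sstab p1 tau0 taup ons beta K X N C Psi.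
have XL : X `<=` Lpfun P k p%:E by move=> x [].
have CL := C_Lp Fbin Sfin Sstab p1; have PL := Psi_Lp Fbin Sfin Sstab p1 ons.
have PC alpha q : (0 < q)%E -> approx_embed K X N Psi C alpha q.
  by move=> q0; exact: (embed_Psi_C Fbin Sfin Sstab p1 ons alpha q0 XL).
split=> [noBI alpha q ba q0|/(Bernstein_real Fbin Sfin Sstab p1 tau0)[B B0 hB] alpha q /andP[_ ab] q0].
  split; first exact: PC.
  have [x [Xx hC hPsi]] := gliding_hump Fbin Sfin Sstab p1 tau0 taup ons ba noBI erefl.
  move=> eqs; have : approx_space K X N C alpha q x.
    by split=> //; apply/(approx_norm_finP (ltW p1) alpha q0 CL (XL _ Xx)); exact: hC.
  rewrite -eqs => -[_ /(approx_norm_finP (ltW p1) alpha q0 PL (XL _ Xx))[M M0 hM]].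
  (* The weighted numbers for Psi are unbounded, whereas membership would bound each of them by M,
     whatever q is. *)
  case: (hPsi (Num.bound M)) => j; apply/negP; rewrite -ltNge.
  apply: le_lt_trans (lq_le_term j q0 (weighted_num_ge0 P k p Psi alpha x) M0 hM) _.
  by apply: lt_trans (archi_boundP M0) _; rewrite ltr_nat.
have CP := embed_C_Psi Fbin Sfin Sstab p1 tau0 taup ons B0 hB q0 ab XL.
split; [|exact: CP|exact: PC].
by apply/seteqP; split; [exact: CP.1|exact: (PC alpha q q0).1].
Qed.
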